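(* (i) The formula $$g_\wedge(x,y)=j(x,\star[y])\qquad (x,y\in\mathbb V_\Sigma^\wedge)$$ uniquely defines a linear operator $\star:\mathbb V_\Sigma^\wedge\to\mathbb V_\Sigma^\wedge$ such that $\star(\mathbb V_\Sigma^{\wedge k})\subseteq\mathbb V_\Sigma^{\wedge m-k}$ for all $k$. (ii) The map $\star$ is bijective, and for all $x,\vartheta\in\mathbb V_\Sigma^\wedge$, $q\in\Sigma$, $a\in\mathcal A$: $$\star[xq]=\star[x]S^{-1}(q),\qquad \star[qx]=q\star[x],$$ $$\varkappa\star=(\star\otimes\mathrm{id})\varkappa,\qquad \star(\vartheta\circ a_\lambda)=\star(\vartheta)\circ a,$$ where $a_\lambda=(\mathrm{id}\otimes\lambda)\phi(a)$.
   Context: **Group and coordinate space.** $G$ is a compact matrix quantum group with Hopf $*$-algebra $\mathcal A$ of polynomial functions (coproduct $\phi(a)=a^{(1)}\otimes a^{(2)}$, counit $\epsilon$, antipode $\kappa$). $\mathbb V$ is a finite-dimensional complex vector space (the left-invariant part of a $*$-covariant bicovariant $\mathcal A$-bimodule) with an antilinear involution $*$, a right $\mathcal A$-module structure $\circ$ and a right coaction $\varkappa:\mathbb V\to\mathbb V\otimes\mathcal A$ such that $\varkappa*=( *\otimes* )\varkappa$, $(\theta\circ a)^*=\theta^*\circ\kappa(a)^*$, $\varkappa(\theta\circ a)=\sum_k(\theta_k\circ a^{(2)})\otimes\kappa(a^{(1)})c_ka^{(3)}$ if $\varkappa(\theta)=\sum_k\theta_k\otimes c_k$. $\tau(\eta\otimes\vartheta)=\sum_k\vartheta_k\otimes(\eta\circ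 c_k)$ is the associated braid operator. $\theta_1,\dots,\theta_d$ is a basis of $\mathbb V$. **Quantum metric.** $\sigma:\mathbb V\otimes\mathbb V\to\mathbb V\otimes\mathbb V$ is an invertible braid operator with $*\sigma=\sigma*$ (where $(x_1\otimes\dots\otimes x_n)^*=x_n^*\otimes\dots\otimes x_1^*$), compatible with $\circ$ and $\varkappa$. $\Sigma$ is a unital $*$-algebra and $g:\mathbb V\otimes\mathbb V\to\Sigma$ is linear with: $g\sigma=g$; $g(x,y)^*=g(y^*,x^* )$; with $g\cdot g:x\otimes y\otimes z\otimes t\mapsto g(x,y)g(z,t)$, $g\cdot g=(g\cdot g)(\mathrm{id}\otimes\sigma\otimes\mathrm{id})(\sigma^{\mp1}\otimes\sigma^{\pm1})(\mathrm{id}\otimes\sigma^{-1}\otimes\mathrm{id})$; the matrix $(g(\theta_i,\theta_j))$ is invertible over $\Sigma$ and $\Sigma$ is generated by its entries and those of its inverse; there is a twisting $\nu_\Sigma:\mathbb V\otimes\Sigma\to\Sigma\otimes\mathbb V$, coming from a unital homomorphism $\Sigma\to M_d(\Sigma)$, with $\nu_\Sigma(\mathrm{id}\otimes g)=(g\otimes\mathrm{id})(\mathrm{id}\otimes\sigma)(\sigma^{-1}\otimes\mathrm{id})$. Then $\mathbb V_\Sigma=\Sigma\otimes\mathbb V$ is a $\Sigma$-bimodule with $\theta q=\nu_\Sigma(\theta\otimes q)$, it has the $*$-structure $(q\theta)^*=\theta^*q^*$, and $\sigma,g$ extend to $\Sigma$-bilinear maps on $\mathbb V_\Sigma\otimes_\Sigma\mathbb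 V_\Sigma$. $\Sigma$ is realized by (possibly unbounded) operators on a common dense domain $H_0\subseteq l^2(\mathbb Z)$, $*$ being the formal adjoint, with cyclic and separating vectors in $H_0$, and $g(\xi^*,\xi)>0$ for all $0\ne\xi\in\mathbb V_\Sigma$. $\Sigma$ carries a right $\mathcal A$-module structure $\circ$ with $(pq)\circ a=(p\circ a^{(1)})(q\circ a^{(2)})$, $1\circ a=\epsilon(a)1$ and a coaction $\varkappa_\Sigma:\Sigma\to\Sigma\otimes\mathcal A$ which is a unital $*$-homomorphism, determined by $g(x,y)\circ a=g(x\circ a^{(1)},y\circ a^{(2)})$, $\varkappa_\Sigma g(x,y)=(g\otimes\mathrm{id})\varkappa(x\otimes y)$. **Exterior algebra.** $A^n_\sigma=\sum_{\pi\in S_n}(-1)^{\ell(\pi)}\sigma_\pi$ are the braided antisymmetrizers ($\sigma_\pi$ from a reduced expression of $\pi$); they are assumed positive for the $\Sigma$-valued scalar product $\langle\psi,\xi\rangle=g(\psi^*,\xi)$ on $\mathbb V_\Sigma^{\otimes n}$, and $\mathrm{im}(A^n_\sigma)$ is assumed to be the space of $\tau$-antisymmetric $n$-tensors. Here $g$ is extended to $\mathbb V_\Sigma^{\otimes n}\otimes_\Sigma\mathbb V_\Sigma^{\otimes n}$ by $g((\psi\otimes x)\otimes(y\otimes\xi))=g(\psi,g(x,y)\xi)$, different degrees being orthogonal. $\mathbb V^\wedge=\mathbb V^\otimes/\ker A_\sigma$, $\mathbb V_\Sigma^\wedge=\mathbb V_\Sigma^\otimes/\ker A_\sigma\leftrightarrow\Sigma\otimes\mathbb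 V^\wedge\leftrightarrow\mathbb V^\wedge\otimes\Sigma$. The structures $\circ$ and $\varkappa$ extend to $\mathbb V_\Sigma^\wedge$ by $(xy)\circ a=(x\circ a^{(1)})(y\circ a^{(2)})$, $\varkappa(xy)=\varkappa(x)\varkappa(y)$. The form $g_\wedge:\mathbb V_\Sigma^\wedge\times\mathbb V_\Sigma^\wedge\to\Sigma$ is induced by $g_\wedge(\psi,\xi)=g(\psi,A_\sigma\xi)$, $g_\wedge(1,1)=1$. **Volume element.** There is $m\in\mathbb N$ with $\mathbb V^{\wedge m}\cong\mathbb C$ and $\mathbb V^{\wedge k}=0$ for $k>m$ (the pairing $\mathbb V^{\wedge k}\times\mathbb V^{\wedge m-k}\to\mathbb V^{\wedge m}$ given by the product being nondegenerate), and $w=w^*$ is a generator of $\mathbb V^{\wedge m}$. Orientability is assumed: $\varkappa(w)=w\otimes1$; and $w\circ a=\lambda(a)w$, where the unital multiplicative functional $\lambda:\mathcal A\to\mathbb C$ is assumed central ($(\lambda\otimes\mathrm{id})\phi=(\mathrm{id}\otimes\lambda)\phi$). One has $\mathbb V_\Sigma^{\wedge m}=\Sigma w=w\Sigma$, and $S:\Sigma\to\Sigma$ is the automorphism with $wq=S(q)w$. The pairing $j:\mathbb V_\Sigma^\wedge\times\mathbb V_\Sigma^\wedge\to\Sigma$ is defined by letting $j(x,y)w$ be the degree-$m$ component of $x\wedge y$. *)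

(* Defs.v *)
From HB Require Import structures.
From mathcomp Require Import all_boot all_order all_algebra perm generic_quotient.
From mathcomp Require Import boolp classical_sets reals.
From mathcomp Require Import complex finmap.
From mathcomp.multinomials Require Import monalg.
From mathcomp Require Import topology normedtype sequences.

Set Implicit Arguments.
Unset Strict Implicit.
Unset Printing Implicit Defensive.

Import Order.TTheory GRing.Theory Num.Theory.
Import numFieldNormedType.Exports.
Local Open Scope ring_scope.

(* Algebraic tensor products.  An element of U (x) V is a class of finite     *)
(* formal sums of pairs; two formal sums are identified when every bilinear   *)
(* map gives them the same value.                                             *)

Section Tensor.
Variables (K : fieldType) (U V : lmodType K).

Definition bilinear_map (W : lmodType K) (b : U -> V -> W) : Prop :=
  (forall v, linear (b^~ v)) /\ (forall u, linear (b u)).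

Definition tsum (W : zmodType) (b : U -> V -> W) (s : seq (U * V)) : W :=
  \sum_(p <- s) b p.1 p.2.

Definition teq (s t : seq (U * V)) : bool :=
  `[< forall (W : lmodType K) (b : U -> V -> W),
      bilinear_map b -> tsum b s = tsum b t >].

Lemma teq_refl : reflexive teq.
Proof. by move=> s; apply/asboolP. Qed.

Lemma teq_sym : symmetric teq.
Proof.
by move=> s t; apply/asboolP/asboolP => h W b hb; rewrite (h W b hb).
Qed.

Lemma teq_trans : transitive teq.
Proof.
move=> t s r /asboolP h1 /asboolP h2; apply/asboolP => W b hb.
by rewrite (h1 W b hb) (h2 W b hb).
Qed.

Canonical teq_equiv := EquivRel teq teq_refl teq_sym teq_trans.

Definition tensor := {eq_quot teq_equiv}%qT.
HB.instance Definition _ := Choice.on tensor.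
HB.instance Definition _ := EqQuotient.on tensor.

Lemma teq_pi (s t : seq (U * V)) :
  (forall (W : lmodType K) (b : U -> V -> W),
      bilinear_map b -> tsum b s = tsum b t) ->
  \pi_tensor%qT s = \pi_tensor%qT t.
Proof. by move=> h; apply/eqmodP/asboolP. Qed.

Lemma tsum_repr (W : lmodType K) (b : U -> V -> W) (s : seq (U * V)) :
  bilinear_map b -> tsum b (repr (\pi_tensor%qT s)) = tsum b s.
Proof.
move=> hb; have /asboolP h : teq (repr (\pi_tensor%qT s)) s.
  by have /eqmodP := reprK (\pi_tensor%qT s).
exact: h.
Qed.

Definition tzero : tensor := \pi_tensor%qT [::].
Definition tadd (x y : tensor) : tensor := \pi_tensor%qT (repr x ++ repr y).
Definition tscale (c : K) (x : tensor) : tensor :=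
  \pi_tensor%qT [seq (c *: p.1, p.2) | p <- repr x].
Definition topp (x : tensor) : tensor := tscale (-1) x.

Lemma tsum_cat (W : zmodType) (b : U -> V -> W) s t :
  tsum b (s ++ t) = tsum b s + tsum b t.
Proof. by rewrite /tsum big_cat. Qed.

Lemma tsum_scale (W : lmodType K) (b : U -> V -> W) c s : bilinear_map b ->
  tsum b [seq (c *: p.1, p.2) | p <- s] = c *: tsum b s.
Proof.
move=> [hl _]; rewrite /tsum big_map scaler_sumr; apply: eq_bigr => -[u v] _ /=.
have b0 : b 0 v = 0.
  by move: (hl v (-1) 0 0); rewrite scaler0 addr0 scaleN1r addNr.
by move: (hl v c u 0); rewrite /= !addr0 b0 addr0.
Qed.

Lemma taddA : associative tadd.
Proof.
move=> x y z; apply: teq_pi => W b hb.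
by rewrite !tsum_cat !tsum_repr // !tsum_cat addrA.
Qed.

Lemma taddC : commutative tadd.
Proof. by move=> x y; apply: teq_pi => W b hb; rewrite !tsum_cat addrC. Qed.

Lemma tadd0 : left_id tzero tadd.
Proof.
move=> x; rewrite -[RHS](reprK x); apply: teq_pi => W b hb.
by rewrite tsum_cat tsum_repr // /tsum big_nil add0r.
Qed.

Lemma taddN : left_inverse tzero topp tadd.
Proof.
move=> x; apply: teq_pi => W b hb.
rewrite tsum_cat tsum_repr // tsum_scale // scaleN1r addNr.
by rewrite /tsum big_nil.
Qed.

HB.instance Definition _ :=
  GRing.isZmodule.Build tensor taddA taddC tadd0 taddN.

Lemma tscaleA c e (x : tensor) : tscale c (tscale e x) = tscale (c * e) x.
Proof.
apply: teq_pi => W b hb.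
by rewrite !tsum_scale // tsum_repr // tsum_scale // scalerA.
Qed.

Lemma tscale1 : left_id 1 tscale.
Proof.
move=> x; rewrite -[RHS](reprK x); apply: teq_pi => W b hb.
by rewrite tsum_scale // scale1r.
Qed.

Lemma tscaleDr : right_distributive tscale +%R.
Proof.
move=> c x y; apply: teq_pi => W b hb.
rewrite tsum_scale // tsum_repr // !tsum_cat !tsum_repr // !tsum_scale //.
by rewrite scalerDr.
Qed.

Lemma tscaleDl x : {morph tscale^~ x : c e / c + e}.
Proof.
move=> c e; apply: teq_pi => W b hb.
by rewrite tsum_cat !tsum_repr // !tsum_scale // scalerDl.
Qed.

HB.instance Definition _ :=
  GRing.Zmodule_isLmodule.Build K tensor tscaleA tscale1 tscaleDr tscaleDl.

Definition tens (u : U) (v : V) : tensor := \pi_tensor%qT [:: (u, v)].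

(* The additive map u (x) v |-> b u v; meaningful for b bilinear, and for b   *)
(* antilinear in both variables.                                              *)
Definition tlift (W : zmodType) (b : U -> V -> W) (t : tensor) : W :=
  tsum b (repr t).

Lemma tliftE (W : lmodType K) (b : U -> V -> W) u v :
  bilinear_map b -> tlift b (tens u v) = b u v.
Proof. by move=> hb; rewrite /tlift tsum_repr // /tsum big_seq1. Qed.

Lemma tensP (t : tensor) : t = \sum_(p <- repr t) tens p.1 p.2.
Proof.
have E (s : seq (U * V)) : \pi_tensor%qT s = \sum_(p <- s) tens p.1 p.2.
  elim: s => [|[u v] s IH]; first by rewrite big_nil.
  rewrite big_cons -IH; apply: teq_pi => W b hb.
  by rewrite tsum_cat !tsum_repr // -tsum_cat.
by rewrite -E reprK.
Qed.

End Tensor.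

Notation "x ⊗ y" := (tens x y) (at level 35, right associativity) : ring_scope.

Section TensorMaps.
Variable K : fieldType.

Definition tmap (U1 U2 V1 V2 : lmodType K) (f : U1 -> U2) (h : V1 -> V2)
  (t : tensor U1 V1) : tensor U2 V2 := tlift (fun u v => f u ⊗ h v) t.

Definition tassoc (U V W : lmodType K) (t : tensor (tensor U V) W) :
    tensor U (tensor V W) :=
  tlift (fun uv w => tlift (fun u v => u ⊗ (v ⊗ w)) uv) t.

Definition tmul (A B : algType K) (s t : tensor A B) : tensor A B :=
  tlift (fun a b => tlift (fun a' b' => (a * a') ⊗ (b * b')) t) s.

End TensorMaps.

Section StarAlgebras.
Variable C : numClosedFieldType.

Definition antilinear (U : lmodType C) (f : U -> U) : Prop :=
  forall (c : C) (x y : U), f (c *: x + y) = c^* *: f x + f y.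

Definition star_structure (B : algType C) (s : B -> B) : Prop :=
  [/\ antilinear s, involutive s & forall x y, s (x * y) = s y * s x].

Definition alg_generated (B : algType C) (gens : B -> Prop) : Prop :=
  forall P : B -> Prop,
    P 1 -> (forall (c : C) x y, P x -> P y -> P (c *: x + y)) ->
    (forall x y, P x -> P y -> P (x * y)) -> (forall x, gens x -> P x) ->
    forall x, P x.

Record hopf_star (A : algType C) := HopfStar {
  hstar : A -> A;
  cop : {linear A -> tensor A A};
  eps : {scalar A};
  antip : {linear A -> A};
  hstarP : star_structure hstar;
  cop1 : cop 1 = 1 ⊗ 1;
  copM : forall a b, cop (a * b) = tmul (cop a) (cop b);
  cop_star : forall a, cop (hstar a) = tmap hstar hstar (cop a);
  cop_coassoc : forall a, tassoc (tmap cop id (cop a)) = tmap id cop (cop a);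
  eps1 : eps 1 = 1;
  epsM : forall a b, eps (a * b) = eps a * eps b;
  eps_star : forall a, eps (hstar a) = (eps a)^*;
  cop_epsl : forall a, tlift (fun a1 a2 => eps a1 *: a2) (cop a) = a;
  cop_epsr : forall a, tlift (fun a1 a2 => eps a2 *: a1) (cop a) = a;
  antipl : forall a, tlift (fun a1 a2 => antip a1 * a2) (cop a) = eps a *: 1;
  antipr : forall a, tlift (fun a1 a2 => a1 * antip a2) (cop a) = eps a *: 1
}.

(* The Hopf *-algebra of polynomial functions on a compact matrix quantum     *)
(* group: generated, as a *-algebra, by the entries of a unitary matrix       *)
(* corepresentation.                                                          *)
Definition compact_matrix_qgroup (A : algType C) (G : hopf_star A) : Prop :=
  exists (n : nat) (u : 'M[A]_n),
    [/\ forall i j, cop G (u i j) = \sum_k u i k ⊗ u k j,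
        forall i j, \sum_k hstar G (u k i) * u k j = (i == j)%:R,
        forall i j, \sum_k u i k * hstar G (u j k) = (i == j)%:R
      & alg_generated (fun a => exists i j, a = u i j \/ a = hstar G (u i j))].

Section Hopf.
Variables (A : algType C) (G : hopf_star A).

(* Sweedler notation: sw a F is the sum F a^(1) a^(2).                        *)
Definition sw (W : zmodType) (a : A) (F : A -> A -> W) : W := tlift F (cop G a).

Definition sw3 (W : zmodType) (a : A) (F : A -> A -> A -> W) : W :=
  sw a (fun b a3 => sw b (fun a1 a2 => F a1 a2 a3)).

Definition right_module (U : lmodType C) (act : U -> A -> U) : Prop :=
  [/\ bilinear_map act, forall u, act u 1 = u
    & forall u a b, act (act u a) b = act u (a * b)].

Definition right_coaction (U : lmodType C) (k : U -> tensor U A) : Prop :=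
  (forall u, tassoc (tmap k id (k u)) = tmap id (cop G) (k u)) /\
  (forall u, tlift (fun x c => eps G c *: x) (k u) = u).

Record coord_space (V : lmodType C) := CoordSpace {
  vstar : V -> V;
  vact : V -> A -> V;
  vcoact : {linear V -> tensor V A};
  vstar_antilinear : antilinear vstar;
  vstarK : involutive vstar;
  vactP : right_module vact;
  vcoactP : right_coaction vcoact;
  vcoact_star : forall v, vcoact (vstar v) = tmap vstar (hstar G) (vcoact v);
  vact_star : forall v a,
    vstar (vact v a) = vact (vstar v) (hstar G (antip G a));
  vcoact_act : forall v a,
    vcoact (vact v a) =
    tlift (fun vk ck =>
      sw3 a (fun a1 a2 a3 => vact vk a2 ⊗ (antip G a1 * ck * a3))) (vcoact v)
}.

Section Square.
Variables (V : lmodType C) (E : coord_space V).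

Definition star2 (t : tensor V V) : tensor V V :=
  tlift (fun x y => vstar E y ⊗ vstar E x) t.

Definition act2 (t : tensor V V) (a : A) : tensor V V :=
  tlift (fun x y => sw a (fun a1 a2 => vact E x a1 ⊗ vact E y a2)) t.

Definition coact2 (t : tensor V V) : tensor (tensor V V) A :=
  tlift (fun x y =>
    tlift (fun xk ck =>
      tlift (fun yl cl => (xk ⊗ yl) ⊗ (ck * cl)) (vcoact E y)) (vcoact E x)) t.

Definition tau (t : tensor V V) : tensor V V :=
  tlift (fun x y => tlift (fun yk ck => yk ⊗ vact E x ck) (vcoact E y)) t.

End Square.
End Hopf.

(* Realizations on dense subspaces of l^2(Z); vectors are functions int -> C, *)
(* sums over Z are limits of symmetric partial sums.                          *)

Definition psum (x : int -> C) (N : nat) : C :=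
  \sum_(k < N.*2.+1) x (k%:Z - N%:Z).

Definition sqnorm_le (x : int -> C) (e : C) : Prop :=
  forall N, psum (fun k => `|x k| ^+ 2) N <= e.

Definition l2 (x : int -> C) : Prop := exists e, sqnorm_le x e.

Definition l2_dense (D : (int -> C) -> Prop) : Prop :=
  forall x e, l2 x -> 0 < e -> exists2 y, D y & sqnorm_le (fun k => x k - y k) e.

Definition inner (x y : int -> C) : C := limn (psum (fun k => (x k)^* * y k)).

Definition comb (c : C) (x y : int -> C) : int -> C := fun k => c * x k + y k.

Record realization (S : algType C) (star : S -> S) := Realization {
  rdom : (int -> C) -> Prop;
  rho : S -> (int -> C) -> (int -> C);
  dom_l2 : forall x, rdom x -> l2 x;
  dom0 : rdom (fun _ => 0);
  dom_comb : forall c x y, rdom x -> rdom y -> rdom (comb c x y);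
  dom_dense : l2_dense rdom;
  rho_dom : forall q x, rdom x -> rdom (rho q x);
  rho_linear : forall q c x y, rdom x -> rdom y ->
    rho q (comb c x y) = comb c (rho q x) (rho q y);
  rhoD : forall c p q x, rdom x ->
    rho (c *: p + q) x = comb c (rho p x) (rho q x);
  rhoM : forall p q x, rdom x -> rho (p * q) x = rho p (rho q x);
  rho1 : forall x, rdom x -> rho 1 x = x;
  rho_star : forall q x y, rdom x -> rdom y ->
    inner (rho (star q) x) y = inner x (rho q y);
  rho_cyclic : exists2 x, rdom x & l2_dense (fun y => exists q, y = rho q x);
  rho_separating : exists2 x, rdom x & forall q, rho q x = (fun _ => 0) -> q = 0
}.

Definition op_ge0 (S : algType C) (star : S -> S) (r : realization star)
  (q : S) : Prop := forall x, rdom r x -> 0 <= inner x (rho r q x).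

End StarAlgebras.

(* Permutations and reduced words: the letter i stands for the adjacent       *)
(* transposition of i and i + 1 in 'S_n, and the word i1 ... ir for the       *)
(* functional composite s_i1 o ... o s_ir.                                    *)

Section Words.
Variable n : nat.

Definition adj (i : nat) : 'S_n :=
  match insub i : option 'I_n, insub i.+1 : option 'I_n with
  | Some a, Some b => tperm a b
  | _, _ => 1%g
  end.

Definition perm_of_word (w : seq nat) : 'S_n :=
  foldr (fun i s => (s * adj i)%g) 1%g w.

Definition perm_length (s : 'S_n) : nat :=
  #|[pred p : 'I_n * 'I_n | (p.1 < p.2)%N && (s p.2 < s p.1)%N]|.

Definition reduced_word (s : 'S_n) (w : seq nat) : Prop :=
  perm_of_word w = s /\ size w = perm_length s.

Definition some_reduced_word (s : 'S_n) : seq nat :=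
  xget [::] [set w | reduced_word s w]%classic.

End Words.

(* The tensor algebra of V_Sigma = Sigma (x) V over Sigma, as the free left   *)
(* Sigma-module on the words in the basis theta; the monomial << [:: i; j] >> *)
(* is theta_i (x) theta_j.  Right multiplication by scalars is through        *)
(* theta_i q = \sum_j mu(q)_ij theta_j.                                       *)

Section TensorAlgebra.
Variables (C : numClosedFieldType) (V : vectType C) (d : nat).
Variables (theta : d.-tuple V) (Sig : algType C).

Local Notation word := (seq 'I_d).
Local Notation T := {malg Sig[seq 'I_d]}.
Local Notation e := (tnth theta).

Definition lext (M : lmodType Sig) (f : word -> M) (t : T) : M :=
  \sum_(I <- msupp t) t@_I *: f I.

Definition homog (n : nat) (t : T) : Prop :=
  forall I, I \in msupp t -> size I = n.

Definition degree_part (n : nat) (t : T) : T :=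
  lext (fun I => if size I == n then << I >> else 0) t.

(* Membership in 1 (x) V^(x), the copy of the complex tensor algebra of V.    *)
Definition complex_coef (t : T) : Prop :=
  forall I, exists c : C, t@_I = c%:A.

Definition of_scalar (q : Sig) : T := << q *g [::] >>.

Definition of_vec (v : V) : T := \sum_k (coord theta k v)%:A *: << [:: k] >>.

Section Position.
Variable f : tensor V V -> tensor V V.

Definition entry (i j k l : 'I_d) : C :=
  tlift (fun x y => coord theta k x * coord theta l y) (f (e i ⊗ e j)).

(* f acting on the tensor factors p and p + 1, counted from 0.                *)
Definition op_at (p : nat) : T -> T :=
  lext (fun I => match drop p I with
    | i :: j :: K => \sum_k \sum_l
        (entry i j k l)%:A *: << take p I ++ [:: k, l & K] >>
    | _ => << I >>
    end).

Definition op_word (w : seq nat) (t : T) : T := foldr op_at t w.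

Definition antisym : T -> T :=
  lext (fun I => \sum_(s : 'S_(size I))
    (-1) ^+ perm_length s *: op_word (some_reduced_word s) << I >>).

End Position.

Section Twisted.
Variable mu : Sig -> 'M[Sig]_d.

Definition letter_mul (i : 'I_d) (t : T) : T :=
  \sum_(K <- msupp t) \sum_j mu t@_K i j *: << j :: K >>.

Definition tensor_mul (s t : T) : T :=
  lext (fun I => foldr letter_mul t I) s.

Section Star.
Variables (vst : V -> V) (sst : Sig -> Sig).

Definition word_star (I : word) : T :=
  foldr (fun i t => tensor_mul t (of_vec (vst (e i)))) << [::] >> I.

Definition tensor_star (t : T) : T :=
  \sum_(I <- msupp t) tensor_mul (word_star I) (of_scalar (sst t@_I)).

End Star.

Section Metric.
Variable g : tensor V V -> Sig.

Definition met12 : T -> T :=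
  lext (fun I => if I is i :: j :: K then g (e i ⊗ e j) *: << K >> else 0).

Definition met_met (t : T) : Sig :=
  \sum_(I <- msupp t) t@_I *
    (if I is [:: i; j; k; l] then g (e i ⊗ e j) * g (e k ⊗ e l) else 0).

(* x (x) (y (x) xi) |-> g(x, y) xi for x = theta_i, extended Sigma-linearly:  *)
(* theta_i (q theta_j xi) |-> \sum_l mu(q)_il g(theta_l, theta_j) xi.         *)
Definition contract (i : 'I_d) (t : T) : T :=
  \sum_(K <- msupp t)
    (if K is j :: K' then (\sum_l mu t@_K i l * g (e l ⊗ e j)) *: << K' >>
     else 0).

(* g on tensors: g(psi (x) x, y (x) xi) = g(psi, g(x, y) xi), with different  *)
(* degrees orthogonal.                                                        *)
Definition tensor_met (s t : T) : Sig :=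
  \sum_(I <- msupp s) s@_I * (foldr contract t I)@_[::].

End Metric.
End Twisted.
End TensorAlgebra.

Section Setting.
Variables (C : numClosedFieldType) (A : algType C) (G : hopf_star A).
Variables (V : vectType C) (E : coord_space G V) (d : nat).
Variable theta : d.-tuple V.

(* braid is sigma, met is g, and mu : Sigma -> M_d(Sigma) is the unital       *)
(* homomorphism that gives the twisting nu_Sigma; mu_met is the identity      *)
(* nu_Sigma (id (x) g) = (g (x) id) (id (x) sigma) (sigma^-1 (x) id).         *)
(* In met_pos, positivity is that of the form of the operator on the domain.  *)
Record quantum_metric (Sig : algType C) := QuantumMetric {
  braid : {linear tensor V V -> tensor V V};
  braidV : {linear tensor V V -> tensor V V};
  braidK : cancel braid braidV;
  braidVK : cancel braidV braid;
  braid_eq : forall t : {malg Sig[seq 'I_d]}, homog 3 t ->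
    op_at theta braid 0 (op_at theta braid 1 (op_at theta braid 0 t)) =
    op_at theta braid 1 (op_at theta braid 0 (op_at theta braid 1 t));
  braid_star : forall t, star2 E (braid t) = braid (star2 E t);
  braid_act : forall t a, braid (act2 E t a) = act2 E (braid t) a;
  braid_coact : forall t, coact2 E (braid t) = tmap braid id (coact2 E t);

  sstar : Sig -> Sig;
  sstarP : star_structure sstar;

  met : {linear tensor V V -> Sig};
  met_braid : forall t, met (braid t) = met t;
  met_star : forall x y, sstar (met (x ⊗ y)) = met (vstar E y ⊗ vstar E x);
  met_metl : forall t : {malg Sig[seq 'I_d]}, homog 4 t ->
    met_met theta met t =
    met_met theta met (op_at theta braid 1 (op_at theta braidV 0
      (op_at theta braid 2 (op_at theta braidV 1 t))));
  met_metr : forall t : {malg Sig[seq 'I_d]}, homog 4 t ->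
    met_met theta met t =
    met_met theta met (op_at theta braid 1 (op_at theta braid 0
      (op_at theta braidV 2 (op_at theta braidV 1 t))));

  metV : 'M[Sig]_d;
  metVl : metV *m (\matrix_(i, j) met (tnth theta i ⊗ tnth theta j)) = 1%:M;
  metVr : (\matrix_(i, j) met (tnth theta i ⊗ tnth theta j)) *m metV = 1%:M;
  met_generated : alg_generated (fun q => exists i j,
    q = met (tnth theta i ⊗ tnth theta j) \/ q = metV i j);

  mu : Sig -> 'M[Sig]_d;
  muD : forall (c : C) p q, mu (c *: p + q) = c%:A *: mu p + mu q;
  mu1 : mu 1 = 1%:M;
  muM : forall p q, mu (p * q) = mu p *m mu q;
  mu_met : forall i j k,
    letter_mul mu i (of_scalar d (met (tnth theta j ⊗ tnth theta k))) =
    met12 theta met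
      (op_at theta braid 1 (op_at theta braidV 0 << [:: i; j; k] >>));

  real : realization sstar;
  met_pos : forall t, homog 1 t -> t != 0 ->
    let q := tensor_met theta mu met
               (tensor_star theta mu (vstar E) sstar t) t in
    op_ge0 real q /\ q != 0;

  sact : Sig -> A -> Sig;
  sactP : right_module sact;
  sactM : forall p q a,
    sact (p * q) a = sw G a (fun a1 a2 => sact p a1 * sact q a2);
  sact1 : forall a, sact 1 a = eps G a *: 1;
  sact_met : forall x y a,
    sact (met (x ⊗ y)) a =
    sw G a (fun a1 a2 => met (vact E x a1 ⊗ vact E y a2));

  scoact : {linear Sig -> tensor Sig A};
  scoactP : right_coaction G scoact;
  scoact1 : scoact 1 = 1 ⊗ 1;
  scoactM : forall p q, scoact (p * q) = tmul (scoact p) (scoact q);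
  scoact_star : forall q, scoact (sstar q) = tmap sstar (hstar G) (scoact q);
  scoact_met : forall x y,
    scoact (met (x ⊗ y)) = tmap met id (coact2 E (x ⊗ y))
}.

Section Exterior.
Variables (Sig : algType C) (M : quantum_metric Sig).

Local Notation T := {malg Sig[seq 'I_d]}.

Definition asig : T -> T := antisym theta (braid M).
Definition mulT : T -> T -> T := tensor_mul (mu M).
Definition starT : T -> T := tensor_star theta (mu M) (vstar E) (sstar M).
Definition metT : T -> T -> Sig := tensor_met theta (mu M) (met M).

Definition asig_positive : Prop :=
  forall n t, homog n t -> op_ge0 (real M) (metT (starT t) (asig t)).

Definition asig_image : Prop :=
  forall n (t : T), homog n t -> complex_coef t ->
    (exists s, [/\ homog n s, complex_coef s & t = asig s]) <->
    (forall p, (p.+1 < n)%N -> op_at theta (tau E) p t = - t).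

(* The exterior algebra of V_Sigma, as a quotient: an algebra W with a        *)
(* surjective homomorphism pr from the tensor algebra, of kernel ker A_sigma. *)
(* The operations on W are those induced by, or extending, the given ones.    *)
Record exterior (W : algType C) := Exterior {
  pr : T -> W;
  prD : forall (c : C) s t, pr (c%:A *: s + t) = c *: pr s + pr t;
  pr1 : pr << [::] >> = 1;
  prM : forall s t, pr (mulT s t) = pr s * pr t;
  pr_surj : forall x, exists t, pr t = x;
  pr_ker : forall t, pr t = 0 <-> asig t = 0;

  wcomp : nat -> W -> W;
  wcompE : forall k t, wcomp k (pr t) = pr (degree_part k t);
  wstar : W -> W;
  wstarE : forall t, wstar (pr t) = pr (starT t);
  wmet : W -> W -> Sig;
  wmetE : forall s t, wmet (pr s) (pr t) = metT s (asig t);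

  wact : W -> A -> W;
  wact_bilinear : bilinear_map wact;
  wact_scalar : forall q a,
    wact (pr (of_scalar d q)) a = pr (of_scalar d (sact M q a));
  wact_vec : forall v a,
    wact (pr (of_vec theta Sig v)) a = pr (of_vec theta Sig (vact E v a));
  wactM : forall x y a,
    wact (x * y) a = sw G a (fun a1 a2 => wact x a1 * wact y a2);

  wcoact : {linear W -> tensor W A};
  wcoact_scalar : forall q,
    wcoact (pr (of_scalar d q)) =
    tmap (fun p => pr (of_scalar d p)) id (scoact M q);
  wcoact_vec : forall v,
    wcoact (pr (of_vec theta Sig v)) =
    tmap (fun u => pr (of_vec theta Sig u)) id (vcoact E v);
  wcoactM : forall x y, wcoact (x * y) = tmul (wcoact x) (wcoact y)
}.

Section Volume.
Variables (W : algType C) (X : exterior W).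

Definition of_sigma (q : Sig) : W := pr X (of_scalar d q).

(* The degree k parts of the exterior algebras of V_Sigma and V, the latter   *)
(* seen inside the former.                                                    *)
Definition wdeg (k : nat) (x : W) : Prop := exists2 t, homog k t & x = pr X t.
Definition vdeg (k : nat) (x : W) : Prop :=
  exists t, [/\ homog k t, complex_coef t & x = pr X t].

(* vtop is the dimension m and vol the volume element w; twist is the         *)
(* automorphism S, with inverse twistV, and jpair is the pairing j.           *)
Record volume := Volume {
  vtop : nat;
  vol : W;
  vol_deg : vdeg vtop vol;
  vol_neq0 : vol != 0;
  vol_gen : forall x, vdeg vtop x -> exists c : C, x = c *: vol;
  vdeg_gt : forall k x, (vtop < k)%N -> vdeg k x -> x = 0;
  pairing_nondegl : forall k x, (k <= vtop)%N -> vdeg k x ->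
    (forall y, vdeg (vtop - k) y -> x * y = 0) -> x = 0;
  pairing_nondegr : forall k y, (k <= vtop)%N -> vdeg (vtop - k) y ->
    (forall x, vdeg k x -> x * y = 0) -> y = 0;
  vol_star : wstar X vol = vol;

  vol_coact : wcoact X vol = vol ⊗ 1;
  lam : {scalar A};
  lam1 : lam 1 = 1;
  lamM : forall a b, lam (a * b) = lam a * lam b;
  lam_central : forall a,
    sw G a (fun a1 a2 => lam a1 *: a2) = sw G a (fun a1 a2 => lam a2 *: a1);
  vol_act : forall a, wact X vol a = lam a *: vol;

  twist : {lrmorphism Sig -> Sig};
  twistV : Sig -> Sig;
  twistK : cancel twist twistV;
  twistVK : cancel twistV twist;
  vol_twist : forall q, vol * of_sigma q = of_sigma (twist q) * vol;

  jpair : W -> W -> Sig;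
  jpairE : forall x y, of_sigma (jpair x y) * vol = wcomp X vtop (x * y)
}.

(* The element a_lambda = (id (x) lambda) phi(a).                             *)
Definition twist_arg (v : volume) (a : A) : A :=
  sw G a (fun a1 a2 => lam v a2 *: a1).

End Volume.
End Exterior.
End Setting.

(* Main.v *)
(** Write theta_I for the words in the basis and j(x, z) for the coefficient of
    w in x z.  A generalized inverse of the complex matrix of the wedge pairing
    gives elements f_I of the exterior algebra of V with
    x = \sum_I j(x, f_I) theta_I, and y |-> \sum_I f_I S^-1(g(theta_I, y))
    solves g(x, y) = j(x, star y), since w q = S(q) w.

    Uniqueness uses that the words span from the right as well, because the
    star structure is an antimultiplicative involution.  Its compatibility with
    the twisting holds for the entries of the metric matrix, by the formula for
    nu_Sigma (id (x) g) and the invariance of sigma under *, and passes to the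
    entries of the inverse matrix.

    Positivity makes g hermitian on the exterior algebra by polarization.  Thus
    g is right Sigma-linear, and a reconstruction y = \sum_J h_J g(x_J, y)
    turns into x = \sum_J g(x, x_J') h_J' with the conjugates x_J', h_J' of
    x_J, h_J; the former gives injectivity and the latter surjectivity of the
    star operator.

    For the covariance, the formula for nu_Sigma (id (x) g) moves each scalar
    g(theta_a, theta_b) to the far left, so that g(theta_I, theta_J) becomes a
    braided complex tensor contracted by g at adjacent places; hence it is
    covariant, and the nondegeneracy of j transfers this to star. *)

Require Import Defs.
From HB Require Import structures.
From mathcomp Require Import all_boot all_order all_algebra perm.
From mathcomp Require Import boolp classical_sets reals.
From mathcomp Require Import complex finmap.
From mathcomp.multinomials Require Import monalg.
From mathcomp Require Import topology normedtype sequences.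
From mathcomp Require Import zify ring lra.

Set Implicit Arguments.
Unset Strict Implicit.
Unset Printing Implicit Defensive.

Import Order.TTheory GRing.Theory Num.Theory.
Import numFieldNormedType.Exports.
Local Open Scope ring_scope.

(** * Tensor products *)

(** Two obstacles shape the proof. The first is that words span the exterior powers but are
    dependent there, while Sigma is a noncommutative ring. Products of words, braidings and
    antisymmetrizers have complex matrices, however, so every reconstruction formula is derived over
    the complex numbers, from a matrix Q with P Q P = P, and the scalars are restored by linearity.
    The definitions give g linearity on the left and balance in the middle, and [mu] moves scalars
    from the right of a letter to its left; everything that concerns scalars on the far right has to
    be won from the star structure. The second obstacle is that the coaction and the action also
    transform the scalars, so covariance cannot be extended from words by Sigma-linearity. It is
    therefore stated for functions of complex words with values in the exterior algebra, a class
    that is stable under products and under composition with braidings. The argument uses only a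
    ring homomorphism from W into a ring B whose matrix coefficients commute with the copy of W;
    this holds for 1 (x) A in W (x) A and for functionals in Hom(A, W) alike. *)

Section LinearMaps.
Variables (K : pzRingType) (U V : lmodType K).

Definition lin_fun (f : U -> V) (_ : linear f) := f.

Variables (f : U -> V) (fL : linear f).

HB.instance Definition _ := GRing.isLinear.Build K U V *:%R (lin_fun fL) fL.

Lemma lin0 : f 0 = 0. Proof. exact: (linear0 (lin_fun fL)). Qed.
Lemma linD x y : f (x + y) = f x + f y.
Proof. exact: (linearD (lin_fun fL)). Qed.
Lemma linB x y : f (x - y) = f x - f y.
Proof. exact: (linearB (lin_fun fL)). Qed.
Lemma linZ c x : f (c *: x) = c *: f x.
Proof. by rewrite -[c *: x]addr0 fL lin0 addr0. Qed.
Lemma lin_sum (I : Type) (r : seq I) (P : pred I) (F : I -> U) :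
  f (\sum_(i <- r | P i) F i) = \sum_(i <- r | P i) f (F i).
Proof. exact: (linear_sum (lin_fun fL)). Qed.

End LinearMaps.

Section TensorTheory.
Variables (K : fieldType) (U V : lmodType K).
Implicit Types (x y t : tensor U V).

Lemma tens_bilinear : bilinear_map (@tens K U V).
Proof.
split=> w c x y; apply: teq_pi => W b hb.
  rewrite !tsum_cat !tsum_repr // tsum_scale // tsum_repr // /tsum !big_seq1 /=.
  exact: (hb.1 w).
rewrite !tsum_cat !tsum_repr // tsum_scale // tsum_repr // /tsum !big_seq1 /=.
exact: (hb.2 w).
Qed.

Lemma tensZl c u v : (c *: u : U) ⊗ (v : V) = c *: (u ⊗ v).
Proof. exact: (linZ (tens_bilinear.1 v)). Qed.
Lemma tensZr c u v : (u : U) ⊗ (c *: v : V) = c *: (u ⊗ v).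
Proof. exact: (linZ (tens_bilinear.2 u)). Qed.
Lemma tens_suml (I : Type) (r : seq I) (P : pred I) (F : I -> U) (v : V) :
  (\sum_(i <- r | P i) F i) ⊗ v = \sum_(i <- r | P i) F i ⊗ v.
Proof. exact: (lin_sum (tens_bilinear.1 v)). Qed.
Lemma tens_sumr (I : Type) (r : seq I) (P : pred I) (F : I -> V) (u : U) :
  u ⊗ (\sum_(i <- r | P i) F i) = \sum_(i <- r | P i) u ⊗ F i.
Proof. exact: (lin_sum (tens_bilinear.2 u)). Qed.

Lemma tensor_ind (P : tensor U V -> Prop) :
  P 0 -> (forall x y, P x -> P y -> P (x + y)) -> (forall u v, P (u ⊗ v)) ->
  forall t, P t.
Proof.
move=> P0 PD Pt t; rewrite (tensP t).
by elim: (repr t) => [|p s IH]; rewrite ?big_nil // big_cons; apply: PD.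
Qed.

Lemma tlift_linear (W : lmodType K) (b : U -> V -> W) :
  bilinear_map b -> linear (tlift b).
Proof.
by move=> hb c x y; rewrite /tlift !(tsum_repr,tsum_cat,tsum_scale).
Qed.

Lemma tlift_param (W W' : lmodType K) (b : W' -> U -> V -> W) t :
  (forall u v, linear (fun a => b a u v)) -> linear (fun a => tlift (b a) t).
Proof.
move=> hb c x y; rewrite /tlift /tsum scaler_sumr -big_split /=.
by apply: eq_bigr => p _; rewrite hb.
Qed.

Lemma eq_tlift (W : zmodType) (b b' : U -> V -> W) t :
  (forall u v, b u v = b' u v) -> tlift b t = tlift b' t.
Proof. by move=> h; apply: eq_bigr => p _. Qed.

(** Pure tensors absorb scalars, so additivity is enough; this makes the lemma applicable to
    antilinear maps such as [star2]. *)
Lemma tensor_ext (W : zmodType) (f h : tensor U V -> W) :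
  {morph f : x y / x + y} -> {morph h : x y / x + y} ->
  (forall u v, f (u ⊗ v) = h (u ⊗ v)) -> f =1 h.
Proof.
have D0 (k : tensor U V -> W) : {morph k : x y / x + y} -> k 0 = 0.
  by move=> kD; apply: (addrI (k 0)); rewrite -kD !addr0.
move=> fD hD fh; apply: tensor_ind => // [|x y fx fy]; first by rewrite !D0.
by rewrite fD hD fx fy.
Qed.

Lemma tlift_comp (W W' : lmodType K) (b : U -> V -> W) (f : W -> W') t :
  linear f -> f (tlift b t) = tlift (fun u v => f (b u v)) t.
Proof. by move=> fL; rewrite /tlift /tsum lin_sum. Qed.

End TensorTheory.

Section TensorMapTheory.
Variable K : fieldType.

Lemma tmap_bilinear (U1 U2 V1 V2 : lmodType K) (f : U1 -> U2) (h : V1 -> V2) :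
  linear f -> linear h -> bilinear_map (fun u v => f u ⊗ h v).
Proof.
move=> fL hL; split=> w c x y /=; first by rewrite fL (tens_bilinear _ _).1.
by rewrite hL (tens_bilinear _ _).2.
Qed.

Lemma tmap_linear (U1 U2 V1 V2 : lmodType K) (f : U1 -> U2) (h : V1 -> V2) :
  linear f -> linear h -> linear (tmap f h).
Proof. by move=> fL hL; exact: tlift_linear (tmap_bilinear fL hL). Qed.

Lemma tmapE (U1 U2 V1 V2 : lmodType K) (f : U1 -> U2) (h : V1 -> V2) u v :
  linear f -> linear h -> tmap f h (u ⊗ v) = f u ⊗ h v.
Proof. by move=> fL hL; rewrite /tmap tliftE //; exact: tmap_bilinear. Qed.

Variables A B : algType K.

Lemma tmul_inner (a : A) (b : B) :
  bilinear_map (fun (a' : A) (b' : B) => (a * a') ⊗ (b * b')).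
Proof.
by split=> w c x y /=; rewrite mulrDr -scalerAr ?(tens_bilinear _ _).1
  ?(tens_bilinear _ _).2.
Qed.

Lemma tmul_outer (t : tensor A B) : bilinear_map (fun (a : A) (b : B) =>
  tlift (fun a' b' => (a * a') ⊗ (b * b')) t).
Proof.
by split=> w; apply: tlift_param => u v c x y /=; rewrite mulrDl -scalerAl
  ?(tens_bilinear _ _).1 ?(tens_bilinear _ _).2.
Qed.

Lemma tmulE (a a' : A) (b b' : B) :
  tmul (a ⊗ b) (a' ⊗ b') = (a * a') ⊗ (b * b').
Proof. by rewrite /tmul tliftE ?tliftE //; [exact: tmul_inner|exact: tmul_outer]. Qed.

Lemma tmul_linl (t : tensor A B) : linear (fun s => tmul s t).
Proof. exact: tlift_linear (tmul_outer t). Qed.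

Lemma tmul_linr (s : tensor A B) : linear (tmul s).
Proof.
elim/tensor_ind: s => [|s s' hs hs'|a b] c x y.
- by rewrite !(lin0 (tmul_linl _)) scaler0 addr0.
- by rewrite !(linD (tmul_linl _)) hs hs' scalerDr addrACA.
by rewrite /tmul !tliftE; try exact: tmul_outer; exact: tlift_linear (tmul_inner a b) _ _ _.
Qed.

Lemma tmulDl : left_distributive (@tmul K A B) +%R.
Proof. by move=> x y z; rewrite (linD (tmul_linl z)). Qed.

Lemma tmulDr : right_distributive (@tmul K A B) +%R.
Proof. by move=> x y z; rewrite (linD (tmul_linr x)). Qed.

Lemma tmulA : associative (@tmul K A B).
Proof.
move=> x y z; elim/tensor_ind: x => [|x x' hx hx'|a b].
- by rewrite !(lin0 (tmul_linl _)).
- by rewrite !tmulDl hx hx'.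
elim/tensor_ind: y => [|y y' hy hy'|a' b'].
- by rewrite (lin0 (tmul_linl _)) !(lin0 (tmul_linr _)) (lin0 (tmul_linl _)).
- by rewrite tmulDl !tmulDr tmulDl hy hy'.
elim/tensor_ind: z => [|z z' hz hz'|a'' b''].
- by rewrite !(lin0 (tmul_linr _)).
- by rewrite !tmulDr hz hz'.
by rewrite !tmulE !mulrA.
Qed.

Lemma tmul1l : left_id (1 ⊗ 1) (@tmul K A B).
Proof.
move=> x; elim/tensor_ind: x => [|x x' hx hx'|a b].
- by rewrite (lin0 (tmul_linr _)).
- by rewrite tmulDr hx hx'.
by rewrite tmulE !mul1r.
Qed.

Lemma tmul1r : right_id (1 ⊗ 1) (@tmul K A B).
Proof.
move=> x; elim/tensor_ind: x => [|x x' hx hx'|a b].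
- by rewrite (lin0 (tmul_linl _)).
- by rewrite tmulDl hx hx'.
by rewrite tmulE !mulr1.
Qed.

(** A synonym on which the ring structure can be declared, since [tensor] itself is formed for
    arbitrary modules. *)
Definition tensor_alg := tensor A B.
HB.instance Definition _ := GRing.Lmodule.on tensor_alg.
HB.instance Definition _ := GRing.Zmodule_isPzRing.Build tensor_alg
  tmulA tmul1l tmul1r tmulDl tmulDr.

End TensorMapTheory.

(** The pairing matrices indexed by words are singular in general, and P Q P = P is what remains of
    an inverse. Over a field it is [mulmxKpV] for [pinvmx], transported along enumerations of the
    index types. *)
Lemma generalized_inverse (F : fieldType) (X Y : finType) (P : X -> Y -> F) :
  exists Q : Y -> X -> F, forall x y,
    \sum_y' \sum_x' P x y' * Q y' x' * P x' y = P x y.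
Proof.
pose A : 'M[F]_(#|X|, #|Y|) := \matrix_(i, j) P (enum_val i) (enum_val j).
exists (fun y x => pinvmx A (enum_rank y) (enum_rank x)) => x y.
have := congr1 (fun M : 'M_(_, _) => M (enum_rank x) (enum_rank y))
  (mulmxKpV (submx_refl A)).
rewrite !mxE !enum_rankK => <-; rewrite exchange_big.
rewrite (reindex_onto enum_val enum_rank) => [|i _]; last exact: enum_rankK.
apply: eq_big => [i|i _]; first by rewrite enum_valK eqxx.
rewrite -mulr_suml !mxE !enum_rankK; congr (_ * _).
rewrite (reindex_onto enum_val enum_rank) => [|j _]; last exact: enum_rankK.
apply: eq_big => [j|j _]; first by rewrite enum_valK eqxx.
by rewrite !mxE !enum_valK enum_rankK.
Qed.

(** * Positive operators on l^2 are symmetric *)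

Section SquareSummable.
Variables (R : realType) (C : numClosedFieldType) (emb : {rmorphism R -> C}).
Variables (re im : C -> R) (I : C).
Hypothesis emb_le : forall a b, (emb a <= emb b) = (a <= b).
Hypothesis emb_norm : forall a, `|emb a| = emb `|a|.
Hypothesis emb_re : forall z, 0 <= z -> z = emb (re z).
Hypothesis emb_reim : forall z, z = emb (re z) + I * emb (im z).
Hypothesis re_norm : forall z, emb `|re z| <= `|z|.
Hypothesis im_norm : forall z, emb `|im z| <= `|z|.
Implicit Types (x y z : int -> C) (h : int -> R).

Definition rsum h (N : nat) : R := \sum_(k < N.*2.+1) h (k%:Z - N%:Z).

Lemma rsumS h N :
  rsum h N.+1 = rsum h N + (h (- (N.+1%:Z)) + h N.+1%:Z).
Proof.
rewrite /rsum doubleS big_ord_recl big_ord_recr /= addrCA; congr (_ + (_ + _)).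
- by apply: eq_bigr => k _; congr h; rewrite /bump /=; lia.
- by congr h; lia.
- by congr h; rewrite /bump /=; lia.
Qed.

Lemma rsum_nondecreasing h : (forall k, 0 <= h k) -> nondecreasing_seq (rsum h).
Proof.
by move=> h0; apply/nondecreasing_seqP => N; rewrite rsumS lerDl addr_ge0.
Qed.

(** Absolute convergence: h is the difference of the nonnegative functions h + |h| and |h|, whose
    partial sums increase and are bounded by 2b and b. *)
Lemma rsum_cvg h b : (forall N, rsum (fun k => `|h k|) N <= b) ->
  cvgn (rsum h).
Proof.
move=> hb.
have cvp h' b' : (forall k, 0 <= h' k) -> (forall N, rsum h' N <= b') ->
    cvgn (rsum h').
  move=> h0 hb'; apply: nondecreasing_is_cvgn; first exact: rsum_nondecreasing.
  by exists b' => _ [N _ <-].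
have -> : rsum h = (fun N => rsum (fun k => h k + `|h k|) N - rsum (fun k => `|h k|) N).
  apply/funext => N; rewrite /rsum -sumrB; apply: eq_bigr => k _.
  by rewrite addrK.
apply: is_cvgB; last by apply: (cvp _ b) => // k; exact: normr_ge0.
apply: (cvp _ (b + b)) => [k|N]; first by have := ler_norm (- h k); rewrite normrN; lra.
rewrite /rsum big_split /=; apply: lerD; last exact: hb.
by apply: le_trans (hb N); apply: ler_sum => k _; exact: ler_norm.
Qed.

Lemma emb_cvg (u : nat -> R) (a : R) :
  (u n @[n --> \oo] --> a -> (emb (u n)) @[n --> \oo] --> emb a)%classic.
Proof.
move=> ua; apply/cvgrPdist_lt => e e0.
have e0' : 0 < re e.
  by rewrite lt_def -(inj_eq (fmorph_inj emb)) -emb_le rmorph0 -emb_re ?ltW ?gt_eqF.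
have /cvgrPdist_lt/(_ _ e0') := ua; apply: filterS => n.
rewrite -rmorphB /= emb_norm [e in _ -> _ < e]emb_re ?ltW //.
by rewrite !lt_neqAle emb_le (inj_eq (fmorph_inj emb)).
Qed.

Lemma psum_cvg x b :
  (forall N, psum (fun k => `|x k|) N <= b) -> cvgn (psum x).
Proof.
move=> hb.
have b0 : 0 <= b by apply: le_trans (hb 0); apply: sumr_ge0.
have cvr (f : C -> R) : (forall w, emb `|f w| <= `|w|) -> cvgn (rsum (f \o x)).
  move=> hf; apply: (@rsum_cvg _ (re b)) => N.
  rewrite -emb_le -emb_re //; apply: le_trans (hb N).
  by rewrite rmorph_sum; apply: ler_sum => k _; exact: hf.
have -> : psum x = (fun N => emb (rsum (re \o x) N) + I * emb (rsum (im \o x) N)).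
  apply/funext => N; rewrite /psum /rsum !rmorph_sum mulr_sumr -big_split /=.
  by apply: eq_bigr => k _; exact: emb_reim.
apply/cvg_ex; eexists; apply: cvgD.
  exact: emb_cvg (cvr _ re_norm).
by apply: cvgM; [exact: cvg_cst|exact: emb_cvg (cvr _ im_norm)].
Qed.

(** The sums converge absolutely by ab <= a^2 + b^2, which is 0 <= (a - b)^2 + ab. Since [inner] is
    a total limit with a junk value at divergent sums, its algebraic rules rest on this lemma. *)
Lemma inner_cvg x y : l2 x -> l2 y ->
  (psum (fun k => (x k)^* * y k) N @[N --> \oo] --> inner x y)%classic.
Proof.
move=> [e hx] [e' hy]; apply: (@psum_cvg _ (e + e')) => N.
apply: le_trans (lerD (hx N) (hy N)); rewrite /psum -big_split /=.
apply: ler_sum => k _; rewrite normrM norm_conjC.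
have := normr_ge0 (x (k%:Z - N%:Z)); have := normr_ge0 (y (k%:Z - N%:Z)).
move: `|_| `|_| => a b a0 b0; rewrite -subr_ge0.
have : 0 <= (a - b) ^+ 2 by rewrite -realEsqr rpredB // ger0_real.
move=> h; have : 0 <= a * b by exact: mulr_ge0.
move=> /(addr_ge0 h); rewrite sqrrB.
by congr (_ <= _); ring.
Qed.

Lemma innerC x y : l2 x -> l2 y -> inner y x = (inner x y)^*.
Proof.
move=> hx hy; apply: cvg_lim; first exact: norm_hausdorff.
have /cvgrPdist_lt h := inner_cvg hx hy.
apply/cvgrPdist_lt => e /h; apply: filterS => N.
rewrite -norm_conjC rmorphB; congr (`|_ - _| < e).
rewrite /psum rmorph_sum; apply: eq_bigr => k _.
by rewrite rmorphM /= conjCK mulrC.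
Qed.

Lemma inner_linear c x y z : l2 x -> l2 y -> l2 z ->
  inner z (comb c x y) = c * inner z x + inner z y.
Proof.
move=> hx hy hz; apply: cvg_lim; first exact: norm_hausdorff.
have -> : psum (fun k => (z k)^* * comb c x y k) = (fun N =>
    c * psum (fun k => (z k)^* * x k) N + psum (fun k => (z k)^* * y k) N).
  apply/funext => N; rewrite /psum mulr_sumr -big_split /=.
  by apply: eq_bigr => k _; rewrite /comb mulrDr mulrCA.
apply: cvgD; last exact: inner_cvg.
by apply: cvgM; [exact: cvg_cst|exact: inner_cvg].
Qed.

Lemma inner_definite x : l2 x -> inner x x = 0 -> x = (fun=> 0).
Proof.
move=> hx x0; pose h k := re (`|x k| ^+ 2).
have hE k : emb (h k) = `|x k| ^+ 2 by rewrite -emb_re ?exprn_ge0.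
have h0 k : 0 <= h k by rewrite -emb_le hE rmorph0 exprn_ge0.
have sE : psum (fun k => (x k)^* * x k) = emb \o rsum h.
  apply/funext => N; rewrite /= rmorph_sum; apply: eq_bigr => k _.
  by rewrite hE normCK mulrC.
case: (hx) => e he.
have cv : cvgn (rsum h).
  apply: (@rsum_cvg _ (re e)) => N.
  have e0 : 0 <= e by apply: le_trans (he 0); apply: sumr_ge0 => k _; rewrite exprn_ge0.
  rewrite -emb_le -emb_re //; apply: le_trans (he N); rewrite rmorph_sum.
  by apply: ler_sum => k _; rewrite ger0_norm ?hE.
have l0 : limn (rsum h) = 0.
  apply: (fmorph_inj emb); rewrite rmorph0 -x0 /inner sE.
  by apply/esym/cvg_lim; [exact: norm_hausdorff|exact: emb_cvg].
have s0 N : rsum h N <= 0.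
  by rewrite -l0; apply: nondecreasing_cvgn_le => //; exact: rsum_nondecreasing.
have hz k : h k = 0.
  apply/eqP; rewrite eq_le h0 andbT; apply: le_trans (s0 (absz k)).
  (* The value at k already occurs in the partial sum from -|k| to |k|, at position k + |k|. *)
  have kN : (absz (k + (absz k)%:Z)%R < (absz k).*2.+1)%N by lia.
  rewrite /rsum (bigD1 (Ordinal kN)) //= [X in h X + _](_ : _ = k).
    by rewrite lerDl; apply: sumr_ge0.
  by lia.
apply/funext => k; apply/eqP; rewrite -normr_eq0 -sqrf_eq0 -hE hz.
by rewrite rmorph0.
Qed.

Variables (S : algType C) (star : S -> S) (r : realization star).

(** Nonnegativity makes the diagonal of the form [b] real, and polarization then makes [b] hermitian
    on the whole domain. Hence q and its star have the same matrix elements there, and their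
    difference annihilates the separating vector. *)
Lemma op_ge0_selfadjoint q : op_ge0 r q -> star q = q.
Proof.
move=> q0; have dl x (hx : rdom r x) : l2 x by exact: dom_l2 hx.
pose b x y := inner x (rho r q y).
have rd x (hx : rdom r x) : rdom r (rho r q x) by exact: rho_dom.
have br c x y z : rdom r x -> rdom r y -> rdom r z ->
    b z (comb c x y) = c * b z x + b z y.
  by move=> hx hy hz; rewrite /b rho_linear // inner_linear; auto.
have bl c x y z : rdom r x -> rdom r y -> rdom r z ->
    b (comb c x y) z = c^* * b x z + b y z.
  move=> hx hy hz; rewrite /b innerC; auto; last by apply/dl/dom_comb.
  by rewrite inner_linear; auto; rewrite rmorphD rmorphM /= -!innerC; auto.
have bb x : rdom r x -> (b x x)^* = b x x.
  by move=> /q0 h; apply/CrealP/ger0_real.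
have sym x y : rdom r x -> rdom r y -> b x y = (b y x)^*.
  move=> hx hy.
  have E c : c^* * (b x y - (b y x)^*) = c * ((b x y)^* - b y x).
    have := bb _ (dom_comb c hx hy).
    rewrite bl ?br ?bl //; try exact: dom_comb.
    rewrite !(rmorphD, rmorphM) /= !conjCK !bb //.
    move: (b x x) (b y y) (b x y) (b y x) => p s t u /eqP.
    rewrite -subr_eq0 => /eqP h; apply/eqP; rewrite -subr_eq0; apply/eqP.
    by rewrite -[RHS]oppr0 -h; ring.
  (* For D = b(x, y) - conj b(y, x), the case c = 1 makes D real and the case c = 'i makes D
     imaginary. *)
  have := E 1; have := E 'i; rewrite conjC1 conjCi !mul1r => h1 h2.
  move: h1; rewrite -h2 mulNr => /eqP; rewrite eq_sym -addr_eq0 -mulr2n.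
  rewrite -mulr_natl !mulf_eq0 pnatr_eq0 /= (negPf (neq0Ci C)) /= subr_eq0.
  by move/eqP.
have [x hx sep] := rho_separating r.
apply/eqP; rewrite -subr_eq0 addrC -scaleN1r; apply/eqP/sep.
(* The vector [w] is the image of [x] under the star of q minus q. It stays in the domain, so it can
   be tested against itself. *)
rewrite rhoD //; set w := comb _ _ _.
have hw : rdom r w by apply: dom_comb; exact: rho_dom.
apply: inner_definite; first exact: dl.
have -> : inner w w = -1 * inner w (rho r q x) + inner w (rho r (star q) x).
  by apply: inner_linear; apply: dl => //; exact: rho_dom.
rewrite [inner w (rho r q x)]sym //.
rewrite [inner w (rho r (star q) x)]innerC; try by apply: dl; try exact: rho_dom.
by rewrite rho_star // mulN1r addNr.
Qed.


End SquareSummable.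

(** The preceding section treats C abstractly as a complexification of R, through an embedding and
    real and imaginary parts; these axioms are verified here for [R[i]]. *)
Lemma positive_selfadjoint (R : realType) (S : algType R[i]) (star : S -> S)
  (r : realization star) (q : S) : op_ge0 r q -> star q = q.
Proof.
have reE (z : R[i]) : 0 <= z -> z = (complex.Re z)%:C%C.
  by case: z => a b; rewrite lecE /= => /andP[/eqP -> _].
apply: (@op_ge0_selfadjoint R _ (real_complex R) (@complex.Re R) (@complex.Im R) 'i%C).
- by move=> a b; rewrite lecR.
- by move=> a; rewrite normc_def /= expr0n /= addr0 sqrtr_sqr.
- exact: reE.
- by move=> z; rewrite {1}[z]complexE.
- case=> a b; rewrite normc_def /= lecR -sqrtr_sqr ler_sqrt ?addr_ge0 ?sqr_ge0 //.
  by rewrite lerDl sqr_ge0.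
- case=> a b; rewrite normc_def /= lecR -sqrtr_sqr ler_sqrt ?addr_ge0 ?sqr_ge0 //.
  by rewrite lerDr sqr_ge0.
Qed.

(** * The tensor algebra *)

Section FreeModule.
Variables (R : nzRingType) (K : choiceType).
Local Notation T := {malg R[K]}.
Implicit Types (t : T) (I : K) (q : R).

Lemma malgZU q I : q *: << I >> = << q *g I >> :> T.
Proof.
by apply/malgP => J; rewrite mcoeffZ mcoeffU mcoeffU mulr_natr.
Qed.

Lemma malg_supp_ind (P : T -> Prop) : P 0 -> (forall s t, P s -> P t -> P (s + t)) ->
  forall t, (forall I, I \in msupp t -> P (t@_I *: << I >>)) -> P t.
Proof.
move=> P0 PD t Pt; rewrite [t]monalgE big_seq.
by elim/big_ind: _ => // I It; rewrite -malgZU; exact: Pt.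
Qed.

Lemma malg_ind (P : T -> Prop) : P 0 -> (forall s t, P s -> P t -> P (s + t)) ->
  (forall q I, P (q *: << I >>)) -> forall t, P t.
Proof. by move=> P0 PD PU t; apply: malg_supp_ind. Qed.

Lemma malg_ext (M : zmodType) (f h : T -> M) :
  {morph f : x y / x + y} -> {morph h : x y / x + y} ->
  (forall q I, f (q *: << I >>) = h (q *: << I >>)) -> f =1 h.
Proof.
move=> fD hD fh t; elim/malg_ind: t => // [|s t fs ft].
  have D0 (k : T -> M) : {morph k : x y / x + y} -> k 0 = 0.
    by move=> kD; apply: (addrI (k 0)); rewrite -kD !addr0.
  by rewrite !D0.
by rewrite fD hD fs ft.
Qed.

Lemma malg_linear_ext (M : lmodType R) (f h : T -> M) : linear f -> linear h ->
  (forall I, f << I >> = h << I >>) -> f =1 h.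
Proof.
move=> fL hL fh; apply: malg_ext => [x y|x y|q I]; rewrite ?(linD fL) ?(linD hL) //.
by rewrite (linZ fL) (linZ hL) fh.
Qed.

Variables (M : zmodType) (h : R -> K -> M).
Hypothesis hD : forall I, {morph h^~ I : p q / p + q}.

Definition msum t : M := \sum_(I <- msupp t) h t@_I I.

Lemma msum_h0 I : h 0 I = 0.
Proof. by apply: (addrI (h 0 I)); rewrite -hD !addr0. Qed.

Lemma msum_incl t (D : {fset K}) : (msupp t `<=` D)%fset ->
  msum t = \sum_(I <- D) h t@_I I.
Proof.
move=> tD; apply: (big_fset_incl _ tD) => I _ It.
by rewrite mcoeff_outdom // msum_h0.
Qed.

(** Cancellation may shrink the support of a sum, so all three sums are taken over the union of the
    two supports, where the extra terms vanish. *)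
Lemma msumD : {morph msum : s t / s + t}.
Proof.
move=> s t; pose D := (msupp s `|` msupp t)%fset.
rewrite (@msum_incl _ D) ?msuppD_le // (@msum_incl s D) ?fsubsetUl //.
rewrite (@msum_incl t D) ?fsubsetUr // -big_split /=.
by apply: eq_bigr => I _; rewrite mcoeffD hD.
Qed.

Lemma msumU q I : msum (q *: << I >>) = h q I.
Proof.
rewrite malgZU (@msum_incl _ [fset I]%fset) ?msuppU_le // big_seq_fset1.
by rewrite mcoeffUU.
Qed.

Lemma mcoeff_sum (Y : Type) (r : seq Y) (P : pred Y) (F : Y -> T) I :
  (\sum_(y <- r | P y) F y)@_I = \sum_(y <- r | P y) (F y)@_I.
Proof. exact: raddf_sum. Qed.

Lemma mcoeff_scaled_word q I J : (q *: << I >> : T)@_J = if I == J then q else 0.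
Proof. by rewrite mcoeffZ mcoeffU mulr_natr; case: eqP. Qed.

End FreeModule.

Section TensorAlgebraTheory.
Variables (C : numClosedFieldType) (V : vectType C) (d : nat).
Variables (theta : d.-tuple V) (Sig : algType C).
Local Notation word := (seq 'I_d).
Local Notation T := {malg Sig[seq 'I_d]}.
Local Notation e := (tnth theta).
Implicit Types (q : Sig) (s t u : T) (I J K : word) (i j k l : 'I_d).

Section Lext.
Variables (M : lmodType Sig) (f : word -> M).

Lemma lext_linear : linear (lext f).
Proof.
have hD I : {morph (fun q => q *: f I) : p q / p + q} by move=> p q; rewrite scalerDl.
have fD : {morph lext f : s t / s + t} by exact: (msumD hD).
have fU q I : lext f (q *: << I >>) = q *: f I by exact: (msumU hD).
move=> q s t; rewrite fD; congr (_ + _).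
move: s; apply: malg_ext => [s s'|s s'|p I].
- by rewrite scalerDr fD.
- by rewrite fD scalerDr.
by rewrite scalerA !fU scalerA.
Qed.

Lemma lextE I : lext f << I >> = f I.
Proof.
rewrite -[<< I >>]scale1r [LHS](msumU (h := fun q I => q *: f I)) ?scale1r //.
by move=> J p q; rewrite scalerDl.
Qed.

End Lext.

Lemma homog_ind n (P : T -> Prop) :
  P 0 -> (forall s t, P s -> P t -> P (s + t)) ->
  (forall q I, size I = n -> P (q *: << I >>)) -> forall t, homog n t -> P t.
Proof.
move=> P0 PD PU t ht; apply: malg_supp_ind => // I It.
by apply: PU; exact: ht.
Qed.

Lemma homog0 n : homog n (0 : T).
Proof. by move=> I; rewrite msupp0 in_fset0. Qed.

Lemma homogD n s t : homog n s -> homog n t -> homog n (s + t).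
Proof.
move=> hs ht I; move/(fsubsetP (msuppD_le _ _)); rewrite in_fsetU.
by case/orP; [exact: hs|exact: ht].
Qed.

Lemma homogZ n q t : homog n t -> homog n (q *: t).
Proof. by move=> ht I /(fsubsetP (msuppZ_le _ _)); exact: ht. Qed.

Lemma homogU n I : size I = n -> homog n (<< I >> : T).
Proof. by move=> In J; rewrite msuppU oner_eq0 in_fset1 => /eqP ->. Qed.

Lemma homog_sum n (X : Type) (r : seq X) (P : pred X) (F : X -> T) :
  (forall x, P x -> homog n (F x)) -> homog n (\sum_(x <- r | P x) F x).
Proof. by move=> hF; elim/big_ind: _ => //; [exact: homog0|exact: homogD]. Qed.

Lemma homog_lext n m (f : word -> T) t :
  (forall I, size I = n -> homog m (f I)) -> homog n t -> homog m (lext f t).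
Proof.
move=> hf; move: t; apply: homog_ind => [|s t' hs ht|q I hI].
- by rewrite (lin0 (lext_linear f)); exact: homog0.
- by rewrite (linD (lext_linear f)); exact: homogD.
by rewrite (linZ (lext_linear f)) lextE; apply/homogZ/hf.
Qed.

Lemma degree_part_word n q I :
  degree_part n (q *: << I >> : T) = if size I == n then q *: << I >> else 0.
Proof. by rewrite /degree_part (linZ (lext_linear _)) lextE; case: ifP; rewrite ?scaler0. Qed.

Lemma degree_part_homog n m t :
  homog m t -> degree_part n t = if m == n then t else 0.
Proof.
have DL := lext_linear (fun I => if size I == n then << I >> else 0 : T).
move: t; apply: homog_ind => [|s t' hs ht|q I <-]; last exact: degree_part_word.
  by rewrite [LHS](lin0 DL) if_same.
by rewrite [LHS](linD DL) [X in X + _]hs [X in _ + X]ht; case: ifP; rewrite ?addr0.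
Qed.

Lemma degree_part_is_homog n t : homog n (degree_part n t).
Proof.
have DL := lext_linear (fun I => if size I == n then << I >> else 0 : T).
elim/malg_ind: t => [|s t hs ht|q I].
- rewrite [degree_part _ _](lin0 DL); exact: homog0.
- rewrite [degree_part _ _](linD DL); exact: homogD.
rewrite degree_part_word; case: eqP => [hI|_]; last exact: homog0.
exact/homogZ/homogU.
Qed.

(** The copy of the n-th complex tensor power of V. By [cspanP] every t with [homog n] and
    [complex_coef] is of this form; here the coefficients are exhibited as complex numbers, ready to
    be entries of matrices. *)
Definition cspan n t := exists f : n.-tuple 'I_d -> C,
  t = \sum_(I : n.-tuple 'I_d) (f I)%:A *: << tval I >>.

Lemma cspan_homog n t : cspan n t -> homog n t.
Proof.
by case=> f ->; apply: homog_sum => I _; apply: homogZ; apply: homogU; rewrite size_tuple.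
Qed.

Lemma cspanP n t : homog n t -> complex_coef t -> cspan n t.
Proof.
move=> ht /choice[c hc]; exists (fun I : n.-tuple 'I_d => c I).
apply/malgP => J; rewrite raddf_sum /=.
have [Jt|Jt] := boolP (size J == n).
  rewrite (bigD1 (Tuple Jt)) //= mcoeffZ mcoeffU eqxx mulr1 -hc big1 ?addr0 //.
  move=> I; rewrite -val_eqE /= => IJ.
  by rewrite mcoeffZ mcoeffU (negPf IJ) mulr0.
rewrite mcoeff_outdom; last by apply: contra Jt => /ht ->.
rewrite big1 // => I _; rewrite mcoeffZ mcoeffU; case: eqP => [IJ|]; rewrite ?mulr0 //.
by rewrite -IJ size_tuple eqxx in Jt.
Qed.

Lemma cspan_complex n t : cspan n t -> complex_coef t.
Proof.
case=> f -> J; rewrite raddf_sum /=.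
exists (\sum_(I : n.-tuple 'I_d) f I * (tval I == J)%:R).
rewrite scaler_suml; apply: eq_bigr => I _.
by rewrite mcoeffZ mcoeffU mulr_algl; case: eqP; rewrite ?mulr1 // mulr0 scaler0 scale0r.
Qed.

Lemma cspan_ind n (P : T -> Prop) :
  P 0 -> (forall s t, P s -> P t -> P (s + t)) ->
  (forall (c : C) I, size I = n -> P (c%:A *: << I >>)) ->
  forall t, cspan n t -> P t.
Proof.
move=> P0 PD PU t [f ->]; elim/big_ind: _ => // I _.
by apply: PU; rewrite size_tuple.
Qed.

Lemma cspan0 n : cspan n 0.
Proof. by exists (fun=> 0); rewrite big1 // => I _; rewrite !scale0r. Qed.

Lemma cspanD n s t : cspan n s -> cspan n t -> cspan n (s + t).
Proof.
case=> f -> [g ->]; exists (fun I : n.-tuple 'I_d => f I + g I); rewrite -big_split /=.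
by apply: eq_bigr => I _; rewrite !scalerDl.
Qed.

Lemma cspanZ n (c : C) t : cspan n t -> cspan n (c%:A *: t).
Proof.
case=> f ->; exists (fun I : n.-tuple 'I_d => c * f I); rewrite scaler_sumr.
by apply: eq_bigr => I _; rewrite scalerA mulr_algl scalerA.
Qed.

Lemma cspanU n I : size I = n -> cspan n << I >>.
Proof.
move=> <-; exists (fun J : (size I).-tuple 'I_d => (tval J == I)%:R).
rewrite (bigD1 (in_tuple I)) //= eqxx !scale1r big1 ?addr0 // => J.
by rewrite -val_eqE /= => /negPf ->; rewrite !scale0r.
Qed.

Lemma cspan_sum n (X : Type) (r : seq X) (P : pred X) (F : X -> T) :
  (forall x, P x -> cspan n (F x)) -> cspan n (\sum_(x <- r | P x) F x).
Proof. by move=> hF; elim/big_ind: _ => //; [exact: cspan0|exact: cspanD]. Qed.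

Lemma cspan_lext n m (f : word -> T) t :
  (forall I, size I = n -> cspan m (f I)) -> cspan n t -> cspan m (lext f t).
Proof.
move=> hf; move: t; apply: cspan_ind => [|s t' hs ht|c I hI].
- by rewrite (lin0 (lext_linear f)); exact: cspan0.
- by rewrite (linD (lext_linear f)); exact: cspanD.
by rewrite (linZ (lext_linear f)) lextE; apply/cspanZ/hf.
Qed.

(** * Operators on adjacent tensor factors and the antisymmetrizer *)

Section Operators.
Variable f : tensor V V -> tensor V V.
Local Notation op := (op_at theta f).
Local Notation r := (entry theta f).

Lemma op_at_linear p : linear (op p : T -> T).
Proof. exact: lext_linear. Qed.

Lemma op_atE p I i j K : size I = p ->
  op p << I ++ i :: j :: K >> =
  \sum_k \sum_l (r i j k l)%:A *: << I ++ k :: l :: K >> :> T.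
Proof.
move=> <-; rewrite /op_at lextE drop_size_cat //.
by apply: eq_bigr => k _; apply: eq_bigr => l _; rewrite take_size_cat.
Qed.

Lemma op_at_size p I :
  (size I <= p.+1)%N -> op p << I >> = << I >> :> T.
Proof.
move=> hI; rewrite /op_at lextE.
have : (size (drop p I) <= 1)%N by rewrite size_drop; lia.
by case: (drop p I) => [|i [|j K]].
Qed.

Lemma word_split p I : (p.+1 < size I)%N ->
  exists J i j K, size J = p /\ I = J ++ i :: j :: K.
Proof.
move=> hI; exists (take p I).
have := cat_take_drop p I; have : (1 < size (drop p I))%N by rewrite size_drop; lia.
case: (drop p I) => [|i [|j K]] // _ E; exists i, j, K.
by split; rewrite ?E // size_take; case: ltnP => //; lia.
Qed.

Lemma cspan_op_at n p t : cspan n t -> cspan n (op p t).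
Proof.
apply: cspan_lext => I hI; have [h|h] := leqP (size I) p.+1.
  by have := op_at_size h; rewrite /op_at lextE => ->; exact: cspanU.
have [J [i [j [K [Jp IE]]]]] := word_split h.
have := op_atE i j K Jp; rewrite /op_at lextE -IE => ->.
apply: cspan_sum => k _; apply: cspan_sum => l _; apply: cspanZ; apply: cspanU.
by rewrite -hI IE !size_cat.
Qed.

Lemma antisym_linear : linear (antisym theta f : T -> T).
Proof. exact: lext_linear. Qed.

Lemma cspan_op_word n w t : cspan n t -> cspan n (op_word theta f w t).
Proof. by move=> ht; elim: w => //= p w; exact: cspan_op_at. Qed.

Lemma antisymE I : antisym theta f (<< I >> : T) =
  \sum_(s : 'S_(size I)) (-1) ^+ perm_length s *:
     op_word theta f (some_reduced_word s) << I >>.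
Proof. exact: lextE. Qed.

Lemma cspan_antisym n t : cspan n t -> cspan n (antisym theta f t).
Proof.
apply: cspan_lext => I hI; apply: cspan_sum => s _.
have -> : (-1) ^+ perm_length s = ((-1) ^+ perm_length s : C)%:A :> Sig.
  by rewrite -[in RHS]signr_odd -signr_odd; case: (odd _); rewrite ?expr1 ?expr0 ?scaleN1r ?scale1r.
by apply: cspanZ; apply: cspan_op_word; apply: cspanU.
Qed.

Lemma homog_antisym n t : homog n t -> homog n (antisym theta f t).
Proof.
apply: homog_lext => I hI; have := cspan_homog (cspan_antisym (cspanU hI)).
by rewrite /antisym lextE.
Qed.

End Operators.

(** * Multiplication twisted by [mu] *)

Section Twist.
Variable mu : Sig -> 'M[Sig]_d.
Hypothesis muD : forall (c : C) p q, mu (c *: p + q) = c%:A *: mu p + mu q.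
Hypothesis mu1 : mu 1 = 1%:M.
Hypothesis muM : forall p q, mu (p * q) = mu p *m mu q.

Lemma mu_add : {morph mu : p q / p + q}.
Proof. by move=> p q; rewrite -[p in LHS]scale1r muD !scale1r. Qed.

Lemma mu0 : mu 0 = 0.
Proof. by apply: (addrI (mu 0)); rewrite -mu_add !addr0. Qed.

Lemma muZ (c : C) q : mu (c *: q) = c%:A *: mu q.
Proof. by rewrite -[c *: q]addr0 muD mu0 addr0. Qed.

Lemma mu_alg (c : C) : mu c%:A = c%:A *: 1%:M.
Proof. by rewrite muZ mu1. Qed.

Local Notation lm := (letter_mul mu).

Lemma letter_mulD i : {morph lm i : s t / s + t}.
Proof.
apply: (msumD (h := fun q K => \sum_j mu q i j *: << j :: K >>)) => K p q.
by rewrite mu_add -big_split /=; apply: eq_bigr => j _; rewrite mxE scalerDl.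
Qed.

Lemma letter_mulU i q K : lm i (q *: << K >>) = \sum_j mu q i j *: << j :: K >>.
Proof.
apply: (msumU (h := fun q K => \sum_j mu q i j *: << j :: K >>)) => {}K p {}q.
by rewrite mu_add -big_split /=; apply: eq_bigr => j _; rewrite mxE scalerDl.
Qed.

Lemma letter_mul0 i : lm i 0 = 0.
Proof. by apply: (addrI (lm i 0)); rewrite -letter_mulD !addr0. Qed.

Lemma sum_delta (M : lmodType Sig) i (F : 'I_d -> M) :
  \sum_j (1%:M : 'M[Sig]_d) i j *: F j = F i.
Proof.
rewrite (bigD1 i) //= mxE eqxx scale1r big1 ?addr0 // => j ji.
by rewrite mxE eq_sym (negPf ji) scale0r.
Qed.

Lemma letter_mul_word i K : lm i << K >> = << i :: K >>.
Proof. by rewrite -[<< K >>]scale1r letter_mulU mu1 sum_delta. Qed.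

(** Moving the product of two scalars past a letter is the same as moving them one after the other,
    because [mu] is multiplicative. *)
Lemma letter_mulZ i q t : lm i (q *: t) = \sum_j mu q i j *: lm j t.
Proof.
move: t; apply: malg_ext => [s t|s t|p K].
- by rewrite scalerDr letter_mulD.
- by rewrite -big_split; apply: eq_bigr => j _; rewrite letter_mulD scalerDr.
rewrite scalerA letter_mulU muM; under [RHS]eq_bigr do rewrite letter_mulU scaler_sumr.
rewrite exchange_big; apply: eq_bigr => k _; rewrite mxE scaler_suml.
by apply: eq_bigr => j _; rewrite scalerA.
Qed.

Lemma letter_mulC i (c : C) t : lm i (c%:A *: t) = c%:A *: lm i t.
Proof.
rewrite letter_mulZ mu_alg; under eq_bigr do rewrite mxE -scalerA.
by rewrite -scaler_sumr sum_delta.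
Qed.

Local Notation tm := (tensor_mul mu).

Lemma tensor_mul_linear t : linear (fun s => tm s t).
Proof. exact: lext_linear. Qed.

Lemma tensor_mulE I t : tm << I >> t = foldr lm t I.
Proof. exact: lextE. Qed.

Lemma foldr_letterD I : {morph (fun t => foldr lm t I) : s t / s + t}.
Proof. by move=> s t; elim: I => //= i I ->; exact: letter_mulD. Qed.

Lemma tensor_mulDr s : {morph tm s : t u / t + u}.
Proof.
move=> t u; rewrite /tensor_mul /lext -big_split; apply: eq_bigr => I _.
by rewrite foldr_letterD scalerDr.
Qed.

Lemma tensor_mul_scalar q t : tm (of_scalar d q) t = q *: t.
Proof.
by rewrite /of_scalar -malgZU (linZ (tensor_mul_linear t)) tensor_mulE.
Qed.

Lemma tensor_mul_word I J : tm << I >> << J >> = << I ++ J >>.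
Proof. by rewrite tensor_mulE; elim: I => //= i I ->; exact: letter_mul_word. Qed.

Lemma letter_mul_homog n i t : homog n t -> homog n.+1 (lm i t).
Proof.
move: t; apply: homog_ind => [|s t hs ht|q I In].
- by rewrite letter_mul0; exact: homog0.
- by rewrite letter_mulD; exact: homogD.
by rewrite letter_mulU; apply: homog_sum => j _; apply/homogZ/homogU; rewrite /= In.
Qed.

Lemma tensor_mul_homog n m s t : homog n s -> homog m t -> homog (n + m) (tm s t).
Proof.
move=> hs ht; apply: homog_lext hs => I <-.
by elim: I => //= i I; rewrite addSn; exact: letter_mul_homog.
Qed.

Lemma cspan_tensor_mul n m s t : cspan n s -> cspan m t -> cspan (n + m) (tm s t).
Proof.
move=> hs ht; apply: cspan_lext hs => I <-.
elim: I => //= i I; rewrite addSn; move: (foldr _ _ _).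
apply: cspan_ind => [|u u' hu hu'|c J hJ].
- by rewrite letter_mul0; exact: cspan0.
- by rewrite letter_mulD; exact: cspanD.
by rewrite letter_mulC letter_mul_word; apply/cspanZ/cspanU; rewrite /= hJ.
Qed.

(** * Contraction and the form on tensors *)

Section Form.
Variable g : tensor V V -> Sig.
Local Notation con := (contract theta mu g).
Local Notation gm i j := (g (e i ⊗ e j)).

Let conh i q K : T := if K is j :: K' then
  (\sum_l mu q i l * gm l j) *: << K' >> else 0.

Let conhD i K : {morph (fun q => conh i q K) : p q / p + q}.
Proof.
move=> p q; case: K => [|j K]; rewrite /conh ?addr0 // -scalerDl -big_split /=.
by congr (_ *: _); apply: eq_bigr => l _; rewrite mu_add mxE mulrDl.
Qed.

Lemma contractD i : {morph con i : s t / s + t}.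
Proof. exact: (msumD (h := conh i)). Qed.

Lemma contract0 i : con i 0 = 0.
Proof. by apply: (addrI (con i 0)); rewrite -contractD !addr0. Qed.

Lemma contractU i q j K :
  con i (q *: << j :: K >>) = (\sum_l mu q i l * gm l j) *: << K >>.
Proof. exact: (msumU (h := conh i)). Qed.

Lemma contractU0 i q : con i (q *: << [::] >>) = 0.
Proof. exact: (msumU (h := conh i)). Qed.

Lemma contractZ i q t : con i (q *: t) = \sum_j mu q i j *: con j t.
Proof.
move: t; apply: malg_ext => [s t|s t|p [|k K]].
- by rewrite scalerDr contractD.
- by rewrite -big_split; apply: eq_bigr => j _; rewrite contractD scalerDr.
- by rewrite scalerA contractU0 big1 // => j _; rewrite contractU0 scaler0.
rewrite scalerA contractU; under [RHS]eq_bigr do rewrite contractU scalerA.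
rewrite -scaler_suml; congr (_ *: _); under [RHS]eq_bigr do rewrite mulr_sumr.
rewrite exchange_big; apply: eq_bigr => l _; rewrite muM mxE mulr_suml.
by apply: eq_bigr => j _; rewrite mulrA.
Qed.

Lemma contract_word i j K : con i << j :: K >> = gm i j *: << K >>.
Proof.
rewrite -[<< _ >>]scale1r contractU mu1; congr (_ *: _).
exact: (@sum_delta (Sig^o) i (fun l => gm l j)).
Qed.

Lemma contractC i (c : C) t : con i (c%:A *: t) = c%:A *: con i t.
Proof.
rewrite contractZ mu_alg; under eq_bigr do rewrite mxE -scalerA.
by rewrite -scaler_sumr sum_delta.
Qed.

(** The result of contracting [s] into [u] before the coefficient of the empty word is read off. In
    this form contraction is an action of the tensor algebra on itself ([contracts_mul]), which
    [tensor_met] alone does not show. *)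
Definition contracts s u : T := lext (fun I => foldr con u I) s.

Lemma contracts_linear u : linear (contracts^~ u).
Proof. exact: lext_linear. Qed.

Lemma contracts_word I u : contracts << I >> u = foldr con u I.
Proof. exact: lextE. Qed.

Lemma tensor_metE s u : tensor_met theta mu g s u = (contracts s u)@_[::].
Proof.
rewrite /contracts /lext raddf_sum; apply: eq_bigr => I _.
by rewrite /= mcoeffZ.
Qed.

Lemma contracts_letter i s u : contracts (lm i s) u = con i (contracts s u).
Proof.
move: s; apply: malg_ext => [s t|s t|q K].
- by rewrite letter_mulD (linD (contracts_linear u)).
- by rewrite (linD (contracts_linear u)) contractD.
rewrite letter_mulU (lin_sum (contracts_linear u)) (linZ (contracts_linear u)).
rewrite contractZ; apply: eq_bigr => j _.
by rewrite (linZ (contracts_linear u)) !contracts_word.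
Qed.

Lemma contracts_mul s t u : contracts (tm s t) u = contracts s (contracts t u).
Proof.
move: s; apply: malg_linear_ext => [q s s'|q s s'|I].
- by rewrite (tensor_mul_linear t q) (contracts_linear u q).
- exact: contracts_linear.
rewrite tensor_mulE contracts_word.
by elim: I => //= i I IH; rewrite contracts_letter IH.
Qed.

Local Notation met := (tensor_met theta mu g).

Lemma foldr_contractD I : {morph (fun u => foldr con u I) : s t / s + t}.
Proof. by move=> s t; elim: I => //= i I ->; exact: contractD. Qed.

Lemma foldr_contractC I (c : C) u : foldr con (c%:A *: u) I = c%:A *: foldr con u I.
Proof. by elim: I => //= i I ->; exact: contractC. Qed.

Lemma tensor_metDl u : {morph met^~ u : s t / s + t}.
Proof. by move=> s t; rewrite !tensor_metE (linD (contracts_linear u)) mcoeffD. Qed.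

Lemma tensor_metZl q s u : met (q *: s) u = q * met s u.
Proof. by rewrite !tensor_metE (linZ (contracts_linear u)) mcoeffZ. Qed.

Lemma tensor_metDr s : {morph met s : t u / t + u}.
Proof.
move=> t u; rewrite /tensor_met -big_split; apply: eq_bigr => I _.
by rewrite foldr_contractD mcoeffD mulrDr.
Qed.

Lemma tensor_metCr s (c : C) u : met s (c%:A *: u) = c *: met s u.
Proof.
rewrite /tensor_met scaler_sumr; apply: eq_bigr => I _.
by rewrite foldr_contractC mcoeffZ mulr_algl scalerAr.
Qed.

Lemma tensor_met0r s : met s 0 = 0.
Proof. by apply: (addrI (met s 0)); rewrite -tensor_metDr !addr0. Qed.

Lemma tensor_met_balanced s q u : met (tm s (of_scalar d q)) u = met s (q *: u).
Proof.
rewrite !tensor_metE contracts_mul; congr ((contracts s _)@_[::]).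
by rewrite /of_scalar -malgZU (linZ (contracts_linear u)) contracts_word.
Qed.

Lemma contract_homog n i u : homog n.+1 u -> homog n (con i u).
Proof.
move: u; apply: homog_ind => [|s t hs ht|q [//|j K] [Kn]].
- by rewrite contract0; exact: homog0.
- by rewrite contractD; exact: homogD.
by rewrite contractU; apply/homogZ/homogU.
Qed.

Lemma contract_homog0 i u : homog 0 u -> con i u = 0.
Proof.
move: u; apply: homog_ind => [|s t hs ht|q [|//] _].
- exact: contract0.
- by rewrite contractD hs ht addr0.
exact: contractU0.
Qed.

(** The truncated difference [n - size I] is 0 for words that are too long, so the vanishing in that
    range is carried along as a second claim. *)
Lemma foldr_contract_homog n I u : homog n u ->
  homog (n - size I) (foldr con u I) /\ ((n < size I)%N -> foldr con u I = 0).
Proof.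
move=> hu; elim: I => [|i I [IH IH0]] /=; first by rewrite subn0.
have [nI|In] := ltnP n (size I).
  by rewrite (IH0 nI) (contract0 i); split; [exact: homog0|].
move: In; rewrite leq_eqVlt => /predU1P[In|In].
  move: IH; rewrite In subnn => /(contract_homog0 i) ->.
  by split=> //; exact: homog0.
split=> [|]; last by rewrite ltnS leqNgt In.
by apply: contract_homog; rewrite -subSn // subSS.
Qed.

Lemma tensor_met_degree n m s u : homog n s -> homog m u -> n != m -> met s u = 0.
Proof.
move=> hs hu nm; move: s hs; apply: homog_ind => [|s t hs ht|q I In].
- by rewrite tensor_metE (lin0 (contracts_linear u)) mcoeff0.
- by rewrite tensor_metDl hs ht addr0.
rewrite tensor_metZl tensor_metE contracts_word.
have [h h0] := foldr_contract_homog I hu.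
have [mI|Im] := ltnP m (size I); first by rewrite h0 // mcoeff0 mulr0.
rewrite mcoeff_outdom ?mulr0 //; apply/negP => /h /= /esym/eqP.
by rewrite subn_eq0 => mI; case/eqP: nm; rewrite -In; apply/eqP; rewrite eqn_leq Im mI.
Qed.

Variable gV : 'M[Sig]_d.
Hypothesis gVl : gV *m (\matrix_(i, j) gm i j) = 1%:M.

(** Tensors dual to the words, built from the inverse metric. The last letter of the left argument
    meets the first letter of the right one, so the dual of [i :: I] is the dual of [I] followed on
    the right by row i of [gV]. *)
Lemma dual_word I : exists s : T, forall n u, cspan n u -> met s u = u@_I.
Proof.

suff [s sE] : exists s : T, forall J, met s << J >> = (J == I)%:R.
  exists s => n u; move: u; apply: cspan_ind => [|u u' hu hu'|c J _].
  - by rewrite tensor_met0r mcoeff0.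
  - by rewrite tensor_metDr mcoeffD hu hu'.
  by rewrite tensor_metCr mcoeffZ mcoeffU sE mulr_algl.
elim: I => [|i I [s sE]].
  exists << [::] >> => J; rewrite tensor_metE contracts_word /=.
  by rewrite mcoeffU eq_sym.
exists (tm s (\sum_j gV i j *: << [:: j] >>)) => J.
rewrite tensor_metE contracts_mul -tensor_metE (lin_sum (contracts_linear _)).
under eq_bigr do rewrite (linZ (contracts_linear _)) contracts_word /=.
case: J => [|k K].
  rewrite big1 ?tensor_met0r // => j _.
  by rewrite -[<< _ >>]scale1r contractU0 scaler0.
under eq_bigr do rewrite contract_word scalerA.
rewrite -scaler_suml (_ : \sum_j _ = (k == i)%:R).
  rewrite eqseq_cons; case: eqP => _; rewrite ?scale1r ?sE //.
  by rewrite scale0r tensor_met0r.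
have := congr1 (fun M : 'M_d => M i k) gVl; rewrite !mxE eq_sym => <-.
by apply: eq_bigr => j _; rewrite mxE.
Qed.

End Form.
End Twist.
End TensorAlgebraTheory.

(** * The exterior algebra *)

Section ConjugateModule.
Variables (C : numClosedFieldType) (W : lmodType C).

(** A map antilinear in both variables with values in W is a bilinear map into this module, so the
    rules for [tlift] cover the star structures. *)
Definition conj_module : Type := W.
HB.instance Definition _ := GRing.Zmodule.on conj_module.

Definition conj_scale (c : C) (x : conj_module) : conj_module :=
  c^* *: (x : W).

Lemma conj_scaleA a b x : conj_scale a (conj_scale b x) = conj_scale (a * b) x.
Proof. by rewrite /conj_scale scalerA rmorphM. Qed.
Lemma conj_scale1 : left_id 1 conj_scale.
Proof. by move=> x; rewrite /conj_scale conjC1 scale1r. Qed.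
Lemma conj_scaleDr : right_distributive conj_scale +%R.
Proof. by move=> c x y; rewrite /conj_scale scalerDr. Qed.
Lemma conj_scaleDl x : {morph conj_scale^~ x : a b / a + b}.
Proof. by move=> a b; rewrite /conj_scale rmorphD scalerDl. Qed.

HB.instance Definition _ := GRing.Zmodule_isLmodule.Build C conj_module
  conj_scaleA conj_scale1 conj_scaleDr conj_scaleDl.

End ConjugateModule.

Section Antilinear.
Variables (C : numClosedFieldType) (U V W : lmodType C) (b : U -> V -> W).
Hypothesis bl : forall v (c : C) x y, b (c *: x + y) v = c^* *: b x v + b y v.
Hypothesis br : forall u (c : C) x y, b u (c *: x + y) = c^* *: b u x + b u y.

Lemma antibilinear : bilinear_map (b : U -> V -> conj_module W).
Proof. by split=> z c x y; [exact: (bl z c x y)|exact: (br z c x y)]. Qed.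

Lemma tlift_antiD : {morph tlift b : x y / x + y}.
Proof. exact: (linD (tlift_linear antibilinear)). Qed.

Lemma tlift_antiE u v : tlift b (u ⊗ v) = b u v.
Proof. exact: (tliftE _ _ antibilinear). Qed.

End Antilinear.

Fact word_key : unit. Proof. exact: tt. Qed.
Fact vector_key : unit. Proof. exact: tt. Qed.
Fact scalar_key : unit. Proof. exact: tt. Qed.

Section Exterior.
Variables (C : numClosedFieldType) (A : algType C) (G : hopf_star A).
Variables (V : vectType C) (E : coord_space G V) (d : nat).
Variables (theta : d.-tuple V) (theta_basis : basis_of fullv theta).
Variables (Sig : algType C) (M : quantum_metric E theta Sig).
Variables (W : algType C) (X : exterior M W).
Local Notation T := {malg Sig[seq 'I_d]}.
Local Notation e := (tnth theta).
Local Notation p := (pr X).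
Local Notation star := (vstar E).
Local Notation g i j := (met M (e i ⊗ e j)).

(* Locked, as comparing two such elements by unfolding is very slow.          *)
Definition scalarW (q : Sig) : W := locked_with scalar_key (of_sigma X) q.
Definition wordW (I : seq 'I_d) : W :=
  locked_with word_key (fun J => p << J >>) I.
Definition vecW (x : V) : W :=
  locked_with vector_key (fun y => p (of_vec theta Sig y)) x.
Local Notation sg := scalarW.
Local Notation th i := (wordW [:: i]).

Lemma scalarWE q : sg q = of_sigma X q.
Proof. by rewrite /scalarW unlock. Qed.
Lemma wordWE I : wordW I = p << I >>.
Proof. by rewrite /wordW unlock. Qed.

Lemma pr_add : {morph p : s t / s + t}.
Proof. by move=> s t; have := prD X 1 s t; rewrite !scale1r. Qed.

Lemma pr0 : p 0 = 0.
Proof. by apply: (addrI (p 0)); rewrite -pr_add !addr0. Qed.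

Lemma pr_sum (Y : Type) (r : seq Y) (P : pred Y) (F : Y -> T) :
  p (\sum_(x <- r | P x) F x) = \sum_(x <- r | P x) p (F x).
Proof. exact: (big_morph _ pr_add pr0). Qed.

Lemma prZ q t : p (q *: t) = sg q * p t.
Proof. by rewrite scalarWE -(tensor_mul_scalar (mu M)) prM. Qed.

Lemma prC (c : C) t : p (c%:A *: t) = c *: p t.
Proof. by have := prD X c t 0; rewrite pr0 !addr0. Qed.

Lemma sgE q : sg q = p (q *: << [::] >>).
Proof. by rewrite scalarWE /of_sigma /of_scalar malgZU. Qed.

Lemma sg1 : sg 1 = 1. Proof. by rewrite sgE scale1r pr1. Qed.

Lemma sgM q q' : sg (q * q') = sg q * sg q'.
Proof. by rewrite sgE -scalerA prZ -sgE. Qed.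

Lemma sg_linear : linear sg.
Proof.
move=> c q q'; rewrite !sgE scalerDl pr_add -mulr_algl -scalerA.
by rewrite prC.
Qed.

Lemma sgD : {morph sg : q q' / q + q'}. Proof. exact: (linD sg_linear). Qed.
Lemma sg0 : sg 0 = 0. Proof. exact: (lin0 sg_linear). Qed.
Lemma sg_alg (c : C) : sg c%:A = c%:A.
Proof. by rewrite (linZ sg_linear) sg1. Qed.

Lemma wordW0 : wordW [::] = 1. Proof. by rewrite wordWE pr1. Qed.

Lemma wordW_cat I J : wordW (I ++ J) = wordW I * wordW J.
Proof. rewrite !wordWE -prM /mulT tensor_mul_word //; [exact: muD|exact: mu1]. Qed.

Lemma wordW_cons i I : wordW (i :: I) = th i * wordW I.
Proof. exact: (wordW_cat [:: i]). Qed.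

Lemma letter_scalar i q : th i * sg q = \sum_j sg (mu M q i j) * th j.
Proof.
rewrite wordWE scalarWE -[LHS](prM X) [mulT _ _ _]tensor_mulE [foldr _ _ _]/= /of_scalar -malgZU.
rewrite (letter_mulU (muD M)) pr_sum; by apply: eq_bigr => j _; rewrite prZ wordWE.
Qed.

Lemma W_ind (P : W -> Prop) : P 0 -> (forall x y, P x -> P y -> P (x + y)) ->
  (forall q I, P (sg q * wordW I)) -> forall x, P x.
Proof.
move=> P0 PD PU x; have [t <-] := pr_surj X x.
elim/malg_ind: t => [|s t hs ht|q I].
- by rewrite pr0.
- by rewrite pr_add; exact: PD.
by rewrite prZ -wordWE; exact: PU.
Qed.

Lemma W_ext (Z : zmodType) (f h : W -> Z) :
  {morph f : x y / x + y} -> {morph h : x y / x + y} ->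
  (forall q I, f (sg q * wordW I) = h (sg q * wordW I)) -> f =1 h.
Proof.
have D0 (k : W -> Z) : {morph k : x y / x + y} -> k 0 = 0.
  by move=> kD; apply: (addrI (k 0)); rewrite -kD !addr0.
move=> fD hD fh; apply: W_ind => // [|x y fx fy]; first by rewrite !D0.
by rewrite fD hD fx fy.
Qed.

Lemma basis_expand x : x = \sum_k coord theta k x *: e k.
Proof.
rewrite {1}(coord_basis theta_basis (memvf x)).
by apply: eq_bigr => k _; rewrite -tnth_nth.
Qed.

Lemma coord_delta i k : coord theta k (e i) = (i == k)%:R.
Proof.
rewrite (tnth_nth 0) coord_free; last exact: basis_free theta_basis.
by [].
Qed.

Lemma vecWE x : vecW x = \sum_k coord theta k x *: th k.
Proof.
rewrite /vecW unlock /of_vec pr_sum.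
by apply: eq_bigr => k _; rewrite prC wordWE.
Qed.

Lemma vecW_linear : linear vecW.
Proof.
move=> c x y; rewrite !vecWE scaler_sumr -big_split /=.
by apply: eq_bigr => k _; rewrite linearP scalerDl scalerA.
Qed.

Lemma vecW_basis i : vecW (e i) = th i.
Proof.
rewrite vecWE (bigD1 i) //= coord_delta eqxx scale1r big1 ?addr0 // => k ki.
by rewrite coord_delta eq_sym (negPf ki) scale0r.
Qed.

Lemma tensor_basis (t : tensor V V) : t = \sum_k \sum_l
  tlift (fun x y => coord theta k x * coord theta l y) t *: (e k ⊗ e l).
Proof.
have bb k l : bilinear_map (fun x y => coord theta k x * coord theta l y : C^o).
  split=> z c x y /=; rewrite linearP ?mulrDl ?mulrDr -?scalerAl //.
  by rewrite -scalerAr.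
elim/tensor_ind: t => [|t t' ht ht'|x y].
- by rewrite big1 // => k _; rewrite big1 // => l _;
    rewrite (lin0 (tlift_linear (bb k l))) scale0r.
- rewrite {1}ht {1}ht' -big_split; apply: eq_bigr => k _.
  rewrite -big_split; apply: eq_bigr => l _.
  by rewrite (linD (tlift_linear (bb k l))) scalerDl.
rewrite {1}(basis_expand x) {1}(basis_expand y) tens_suml.
apply: eq_bigr => k _; rewrite tens_sumr; apply: eq_bigr => l _.
by rewrite (tliftE _ _ (bb k l)) tensZl tensZr scalerA.
Qed.

(** * Scalars g(x, y) moving past a vector *)

Local Notation Rb := (entry theta (braid M)).
Local Notation Rv := (entry theta (braidV M)).

Lemma met12_word q i j K :
  met12 theta (met M) (q *: << i :: j :: K >>) = q *: (g i j *: << K >>).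
Proof. by rewrite /met12 (linZ (lext_linear _)) lextE. Qed.

(** Both sides of [mu_met] have degree 1; this is the coefficient of theta_l. *)
Lemma mu_entry i j k l : mu M (g j k) i l =
  \sum_a \sum_b \sum_c (Rv i j a b * Rb b k c l) *: g a c.
Proof.
have op1 a b : op_at theta (braid M) 1 << [:: a; b; k] >> =
    \sum_c \sum_l (Rb b k c l)%:A *: << [:: a; c; l] >> :> T.
  exact: (op_atE _ _ _ (I := [:: a])).
have op0 : op_at theta (braidV M) 0 << [:: i; j; k] >> =
    \sum_a \sum_b (Rv i j a b)%:A *: << [:: a; b; k] >> :> T.
  exact: (op_atE _ _ _ (I := [::])).
have := mu_met M i j k; rewrite op0 /of_scalar -malgZU letter_mulU; last exact: muD.
move/(congr1 (fun t : T => t@_[:: l])); rewrite [LHS]mcoeff_sum [LHS](bigD1 l) //=.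
rewrite [X in X + _]mcoeff_scaled_word eqxx [X in _ + X]big1 ?addr0; last first.
  by move=> j0 hj; rewrite mcoeff_scaled_word eqseq_cons (negPf hj).
move=> ->; rewrite (lin_sum (op_at_linear _ _ _)) /met12 [X in X@__](lin_sum (lext_linear _)) mcoeff_sum.
apply: eq_bigr => a _.
rewrite (lin_sum (op_at_linear _ _ _)) (lin_sum (lext_linear _)) mcoeff_sum.
apply: eq_bigr => b _; rewrite (linZ (op_at_linear _ _ _)) op1 scaler_sumr.
rewrite (lin_sum (lext_linear _)) mcoeff_sum; apply: eq_bigr => c _.
rewrite scaler_sumr (lin_sum (lext_linear _)) mcoeff_sum (bigD1 l) //= big1 ?addr0.
  rewrite scalerA [X in X@__]met12_word scalerA mcoeff_scaled_word eqxx.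
  by rewrite -mulrA !mulr_algl scalerA.
move=> l' ll'; rewrite scalerA [X in X@__]met12_word scalerA mcoeff_scaled_word.
by rewrite eqseq_cons (negPf ll').
Qed.

(** Composition with an operator on V (x) V, written as a function of two vectors again: nesting it
    expresses braidings on three factors without triple tensor products. *)
Definition precomp (f : tensor V V -> tensor V V) (b : V -> V -> W)
  (x y : V) : W := tlift b (f (x ⊗ y)).

Lemma precomp_bilinear (f : {linear tensor V V -> tensor V V}) b :
  bilinear_map b -> bilinear_map (precomp f b).
Proof.
move=> hb; split=> z c x y; rewrite /precomp.
  by rewrite (tens_bilinear _ _).1 linearP (tlift_linear hb).
by rewrite (tens_bilinear _ _).2 linearP (tlift_linear hb).
Qed.

Lemma precomp_param (f : tensor V V -> tensor V V) (b : V -> V -> V -> W) x y :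
  (forall u v, linear (fun z => b z u v)) -> linear (fun z => precomp f (b z) x y).
Proof. exact: tlift_param. Qed.

Lemma precomp_comp (f h : {linear tensor V V -> tensor V V}) b x y :
  bilinear_map b -> precomp f (precomp h b) x y = tlift b (h (f (x ⊗ y))).
Proof.
move=> hb; rewrite {1}/precomp; move: (f _).
apply: tensor_ext => [t t'|t t'|u v]; last by rewrite tliftE //; exact: precomp_bilinear.
  by rewrite (linD (tlift_linear (precomp_bilinear _ hb))).
by rewrite linearD (linD (tlift_linear hb)).
Qed.

Lemma eq_precomp f b b' x y : (forall u v, b u v = b' u v) ->
  precomp f b x y = precomp f b' x y.
Proof. exact: eq_tlift. Qed.

Lemma precomp_basis (f : {linear tensor V V -> tensor V V}) b i j :
  bilinear_map b -> precomp f b (e i) (e j) =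
  \sum_k \sum_l entry theta f i j k l *: b (e k) (e l).
Proof.
move=> hb; rewrite /precomp [f _]tensor_basis (lin_sum (tlift_linear hb)).
apply: eq_bigr => k _; rewrite (lin_sum (tlift_linear hb)).
by apply: eq_bigr => l _; rewrite (linZ (tlift_linear hb)) tliftE.
Qed.

Definition gv x y z : W := sg (met M (x ⊗ y)) * vecW z.
Definition vg x y z : W := vecW x * sg (met M (y ⊗ z)).

Lemma met_linl y : linear (fun x => met M (x ⊗ y)).
Proof. by move=> c x x'; rewrite (tens_bilinear _ _).1 linearP. Qed.
Lemma met_linr x : linear (fun y => met M (x ⊗ y)).
Proof. by move=> c y y'; rewrite (tens_bilinear _ _).2 linearP. Qed.

Lemma gv_lin1 y z : linear (fun x => gv x y z).
Proof. by move=> c x x'; rewrite /gv (met_linl y) sg_linear mulrDl scalerAl. Qed.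
Lemma gv_lin2 x z : linear (fun y => gv x y z).
Proof. by move=> c y y'; rewrite /gv (met_linr x) sg_linear mulrDl scalerAl. Qed.
Lemma gv_lin3 x y : linear (gv x y).
Proof. by move=> c z z'; rewrite /gv vecW_linear mulrDr scalerAr. Qed.
Lemma vg_lin1 y z : linear (fun x => vg x y z).
Proof. by move=> c x x'; rewrite /vg vecW_linear mulrDl scalerAl. Qed.
Lemma vg_lin2 x z : linear (fun y => vg x y z).
Proof. by move=> c y y'; rewrite /vg (met_linl z) sg_linear mulrDr scalerAr. Qed.
Lemma vg_lin3 x y : linear (vg x y).
Proof. by move=> c z z'; rewrite /vg (met_linr y) sg_linear mulrDr scalerAr. Qed.

Lemma gv_bil23 x : bilinear_map (gv x).
Proof. by split=> z; [exact: gv_lin2|exact: gv_lin3]. Qed.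
Lemma vg_bil12 z : bilinear_map (fun x y => vg x y z).
Proof. by split=> y; [exact: vg_lin1|exact: vg_lin2]. Qed.
Lemma gv_braid_bil z : bilinear_map (fun a b => precomp (braid M) (gv a) b z).
Proof.
split=> [b|a]; first by apply: precomp_param => u v; exact: gv_lin1.
exact: (precomp_bilinear _ (gv_bil23 a)).1.
Qed.
Lemma vg_braid_bil x :
  bilinear_map (fun b c => precomp (braid M) (fun a a' => vg a a' c) x b).
Proof.
split=> [c|b]; first exact: (precomp_bilinear _ (vg_bil12 c)).2.
by apply: precomp_param => u v; exact: vg_lin3.
Qed.

Lemma trilinear_ext (f h : V -> V -> V -> W) :
  (forall y z, linear (fun x => f x y z)) -> (forall x z, linear (fun y => f x y z)) ->
  (forall x y, linear (f x y)) ->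
  (forall y z, linear (fun x => h x y z)) -> (forall x z, linear (fun y => h x y z)) ->
  (forall x y, linear (h x y)) ->
  (forall i j k, f (e i) (e j) (e k) = h (e i) (e j) (e k)) ->
  forall x y z, f x y z = h x y z.
Proof.
move=> f1 f2 f3 h1 h2 h3 fh x y z.
rewrite (basis_expand x) (lin_sum (f1 _ _)) (lin_sum (h1 _ _)).
apply: eq_bigr => i _; rewrite (linZ (f1 _ _)) (linZ (h1 _ _)); congr (_ *: _).
rewrite (basis_expand y) (lin_sum (f2 _ _)) (lin_sum (h2 _ _)).
apply: eq_bigr => j _; rewrite (linZ (f2 _ _)) (linZ (h2 _ _)); congr (_ *: _).
rewrite (basis_expand z) (lin_sum (f3 _ _)) (lin_sum (h3 _ _)).
by apply: eq_bigr => k _; rewrite (linZ (f3 _ _)) (linZ (h3 _ _)) fh.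
Qed.

Lemma vg_braid x y z : vg x y z =
  precomp (braidV M) (fun a b => precomp (braid M) (gv a) b z) x y.
Proof.
move: x y z; apply: trilinear_ext => [y z|x z|x y|y z|x z|x y|i j k].
- exact: vg_lin1.
- exact: vg_lin2.
- exact: vg_lin3.
- exact: (precomp_bilinear _ (gv_braid_bil z)).1.
- exact: (precomp_bilinear _ (gv_braid_bil z)).2.
- by apply: precomp_param => u v; exact: (precomp_bilinear _ (gv_bil23 u)).2.
rewrite (precomp_basis _ _ _ (gv_braid_bil _)) /vg vecW_basis letter_scalar.
under eq_bigr => l _ do rewrite mu_entry (lin_sum sg_linear) mulr_suml.
rewrite exchange_big; apply: eq_bigr => a _.
under eq_bigr => l _ do rewrite (lin_sum sg_linear) mulr_suml.
rewrite exchange_big; apply: eq_bigr => b _.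
rewrite (precomp_basis _ _ _ (gv_bil23 _)) scaler_sumr.
under eq_bigr => l _ do rewrite (lin_sum sg_linear) mulr_suml.
rewrite exchange_big; apply: eq_bigr => c _; rewrite scaler_sumr.
apply: eq_bigr => l _.
by rewrite (linZ sg_linear) -scalerAl scalerA /gv vecW_basis.
Qed.

(** Solves [vg_braid] for the side with the scalar on the left: g (x) id = (id (x) g)(sigma (x)
    id)(id (x) sigma^-1), by cancelling the two braidings one at a time. The star structure
    exchanges the two formulas. *)
Lemma gv_braid x y z : gv x y z =
  precomp (braidV M) (fun b c => precomp (braid M) (fun a a' => vg a a' c) x b) y z.
Proof.
transitivity (precomp (braidV M) (precomp (braid M) (gv x)) y z).
  by rewrite precomp_comp ?braidVK ?tliftE //; exact: gv_bil23.
apply: eq_precomp => b c.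
transitivity (precomp (braid M) (precomp (braidV M)
  (fun a b => precomp (braid M) (gv a) b c)) x b).
  by rewrite precomp_comp ?braidK ?tliftE //; exact: gv_braid_bil.
by apply: eq_precomp => a a'; rewrite vg_braid.
Qed.

(** * The star structure on the exterior algebra *)

Local Notation wst := (wstar X).
Local Notation sst := (sstar M).

Lemma sst_add : {morph sst : q q' / q + q'}.
Proof.
case: (sstarP M) => h _ _ q q'; have := h 1 q q'.
by rewrite conjC1 !scale1r.
Qed.
Lemma sstZ c q : sst (c *: q) = c^* *: sst q.
Proof.
have s0 : sst 0 = 0 by apply: (addrI (sst 0)); rewrite -sst_add !addr0.
by case: (sstarP M) => h _ _; have := h c q 0; rewrite s0 !addr0.
Qed.
Lemma sstM q q' : sst (q * q') = sst q' * sst q.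
Proof. by case: (sstarP M). Qed.
Lemma sstK : involutive sst. Proof. by case: (sstarP M). Qed.
Lemma sst1 : sst 1 = 1.
Proof. by rewrite -[LHS]mulr1 -{2}[1]sstK -sstM mulr1 sstK. Qed.

Lemma starT_add : {morph starT M : s t / s + t}.
Proof.
apply: (msumD (h := fun q I => tensor_mul (mu M) (word_star theta (mu M) star I) (of_scalar d (sst q)))).
move=> I q q'; rewrite sst_add /of_scalar monalgUD.
exact: tensor_mulDr (muD M) _ _ _.
Qed.

Lemma starTU q I : starT M (q *: << I >>) =
  tensor_mul (mu M) (word_star theta (mu M) star I) (of_scalar d (sst q)).
Proof.
apply: (msumU (h := fun q I => tensor_mul (mu M) (word_star theta (mu M) star I) (of_scalar d (sst q)))).
move=> J q' q''; rewrite sst_add /of_scalar monalgUD.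
exact: tensor_mulDr (muD M) _ _ _.
Qed.

Lemma wst_add : {morph wst : x y / x + y}.
Proof.
move=> x y; have [s <-] := pr_surj X x; have [t <-] := pr_surj X y.
by rewrite -pr_add !wstarE starT_add pr_add.
Qed.

Lemma wst0 : wst 0 = 0.
Proof. by apply: (addrI (wst 0)); rewrite -wst_add !addr0. Qed.

Lemma wst_sum (Y : Type) (r : seq Y) (P : pred Y) (F : Y -> W) :
  wst (\sum_(x <- r | P x) F x) = \sum_(x <- r | P x) wst (F x).
Proof. exact: (big_morph _ wst_add wst0). Qed.

Lemma wst_word q I :
  wst (sg q * wordW I) = p (word_star theta (mu M) star I) * sg (sst q).
Proof.
rewrite wordWE -prZ wstarE starTU prM; congr (_ * _).
by rewrite scalarWE.
Qed.

Lemma wst_scalar_word q I : wst (sg q * wordW I) = wst (wordW I) * sg (sst q).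
Proof. by rewrite -[wordW I in RHS]mul1r -sg1 !wst_word sst1 sg1 mulr1. Qed.

Lemma wst_wordE I : wst (wordW I) = p (word_star theta (mu M) star I).
Proof. by rewrite -[wordW I]mul1r -sg1 wst_word sst1 sg1 mulr1. Qed.

Lemma wst_scalarl q x : wst (sg q * x) = wst x * sg (sst q).
Proof.
move: x; apply: W_ext => [x y|x y|q' I].
- by rewrite mulrDr wst_add.
- by rewrite wst_add mulrDl.
by rewrite mulrA -sgM !wst_scalar_word -mulrA -sgM sstM.
Qed.

Lemma wst1 : wst 1 = 1.
Proof. by rewrite -wordW0 wst_wordE pr1 wordW0. Qed.

Lemma wst_scalar q : wst (sg q) = sg (sst q).
Proof. by rewrite -[sg q]mulr1 wst_scalarl wst1 mul1r. Qed.

Lemma wstZ c x : wst (c *: x) = c^* *: wst x.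
Proof.
rewrite -mulr_algl -sg_alg wst_scalarl sstZ sst1 sg_alg.
by rewrite mulr_algr.
Qed.

Lemma wst_letter_word i I : wst (wordW (i :: I)) = wst (wordW I) * vecW (star (e i)).
Proof.
by rewrite !wst_wordE [word_star _ _ _ _]/= [LHS]prM /vecW unlock.
Qed.

Lemma wst_letter i : wst (th i) = vecW (star (e i)).
Proof. by rewrite wst_letter_word wordW0 wst1 mul1r. Qed.

Lemma star_antilin c x y : star (c *: x + y) = c^* *: star x + star y.
Proof. exact: vstar_antilinear. Qed.
Lemma star_add : {morph star : x y / x + y}.
Proof. by move=> x y; have := star_antilin 1 x y; rewrite conjC1 !scale1r. Qed.
Lemma star0 : star 0 = 0.
Proof. by apply: (addrI (star 0)); rewrite -star_add !addr0. Qed.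
Lemma starZ c x : star (c *: x) = c^* *: star x.
Proof. by rewrite -[c *: x]addr0 star_antilin star0 addr0. Qed.

Lemma wst_vec x : wst (vecW x) = vecW (star x).
Proof.
rewrite vecWE wst_sum {2}(basis_expand x) (big_morph _ star_add star0).
rewrite (lin_sum vecW_linear); apply: eq_bigr => k _.
by rewrite wstZ wst_letter starZ (linZ vecW_linear).
Qed.

Lemma star2_add : {morph star2 E : t t' / t + t'}.
Proof.
apply: tlift_antiD => [v c x y|u c x y]; rewrite star_antilin.
  exact: (tens_bilinear _ _).2.
exact: (tens_bilinear _ _).1.
Qed.

Lemma star2E x y : star2 E (x ⊗ y) = star y ⊗ star x.
Proof.
apply: tlift_antiE => [v c x' y'|u c x' y']; rewrite star_antilin.
  exact: (tens_bilinear _ _).2.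
exact: (tens_bilinear _ _).1.
Qed.

Lemma braidV_star t : star2 E (braidV M t) = braidV M (star2 E t).
Proof. by rewrite -[in RHS](braidVK M t) braid_star braidK. Qed.

Lemma wst_precomp (f : {linear tensor V V -> tensor V V}) b b' x y :
  (forall t, star2 E (f t) = f (star2 E t)) ->
  bilinear_map b -> bilinear_map b' ->
  (forall u v, wst (b u v) = b' (star v) (star u)) ->
  wst (precomp f b x y) = precomp f b' (star y) (star x).
Proof.
move=> fs hb hb' bb'; rewrite /precomp -star2E -fs; move: (f _).
apply: tensor_ext => [t t'|t t'|u v].
- by rewrite (linD (tlift_linear hb)) wst_add.
- by rewrite star2_add (linD (tlift_linear hb')).
by rewrite star2E !tliftE.
Qed.

Lemma wst_gv x y z : wst (gv x y z) = vg (star z) (star y) (star x).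
Proof. by rewrite wst_scalarl wst_vec /vg -met_star. Qed.

(** The star reverses three factors and commutes with sigma and its inverse, so it carries the right
    side of [vg_braid] to that of [gv_braid]; what remains inside is [wst_gv], an instance of the
    definition of the star. *)
Lemma wst_vg x y z : wst (vg x y z) = gv (star z) (star y) (star x).
Proof.
rewrite vg_braid gv_braid; apply: wst_precomp => [||| a b].
- exact: braidV_star.
- exact: gv_braid_bil.
- exact: vg_braid_bil.
apply: wst_precomp => [||| c l].
- exact: braid_star.
- exact: gv_bil23.
- exact: vg_bil12.
exact: wst_gv.
Qed.

Lemma metV_mull j l : \sum_k metV M j k * g k l = (j == l)%:R.
Proof.
have := congr1 (fun B : 'M_d => B j l) (metVl M); rewrite !mxE => <-.
by apply: eq_bigr => k _; rewrite mxE.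
Qed.

Lemma metV_mulr j l : \sum_k g j k * metV M k l = (j == l)%:R.
Proof.
have := congr1 (fun B : 'M_d => B j l) (metVr M); rewrite !mxE => <-.
by apply: eq_bigr => k _; rewrite mxE.
Qed.

Lemma sst_sum (Y : Type) (r : seq Y) (P : pred Y) (F : Y -> Sig) :
  sst (\sum_(x <- r | P x) F x) = \sum_(x <- r | P x) sst (F x).
Proof.
apply: (big_morph _ sst_add).
by apply: (addrI (sst 0)); rewrite -sst_add !addr0.
Qed.

Lemma wst_letter_scalarE i q :
  wst (th i * sg q) = \sum_j wst (th j) * sg (sst (mu M q i j)).
Proof.
by rewrite letter_scalar wst_sum; apply: eq_bigr => j _; rewrite wst_scalarl.
Qed.

(** The star is defined with the scalar on the left of a word. For a scalar on the right of a
    letter, reversal is a compatibility between [mu] and the star, proved on the generators of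
    Sigma: [wst_vg] for the entries of the metric, and a matrix inversion for those of [metV]. *)
Lemma wst_letter_scalar i q : wst (th i * sg q) = sg (sst q) * wst (th i).
Proof.
pose P q := forall i, wst (th i * sg q) = sg (sst q) * wst (th i).
(* Only the right factor has to satisfy the claim. This asymmetry allows products of an entry of
   [metV] with an entry of the metric while nothing is known about the former. *)
have PM q1 q2 i' : P q2 -> wst (th i' * sg (q1 * q2)) = sg (sst q2) * wst (th i' * sg q1).
  move=> P2; rewrite (wst_letter_scalarE i' q1) mulr_sumr (sgM q1 q2).
  rewrite [th i' * _]mulrA [X in X * _]letter_scalar mulr_suml wst_sum; apply: eq_bigr => j _.
  by rewrite -mulrA wst_scalarl P2 mulrA.
have Pg j k : P (g j k).
  move=> i'; rewrite -vecW_basis -/(vg _ _ _) wst_vg /gv -met_star.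
  by rewrite wst_vec.
suff PA : P q by exact: PA.
clear i.
apply: (met_generated (q0 := M) (P := P)) => [i|c q1 q2 P1 P2 i|q1 q2 P1 P2 i|_ [j [k [->|->]]] //].
- by rewrite sst1 !sg1 mulr1 mul1r.
- rewrite sg_linear mulrDr wst_add sst_add sgD mulrDl P2; congr (_ + _).
  by rewrite -scalerAr wstZ P1 sstZ (linZ sg_linear) scalerAl.
- by rewrite PM // P1 mulrA -sgM sstM.
move=> i.
(* The relation [metV] g = 1, multiplied by theta_i on the left and starred: a linear system for the
   unknown elements [wst (th i * sg (metV M j r))]. *)
have step l : \sum_r sg (sst (g r l)) * wst (th i * sg (metV M j r)) =
    (j == l)%:R *: wst (th i).
  under eq_bigr => r _ do rewrite -PM //.
  rewrite -wst_sum -mulr_sumr -(lin_sum sg_linear) metV_mull.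
  by case: eqP => _; rewrite ?sg1 ?mulr1 ?scale1r // sg0 mulr0 wst0 scale0r.
(* The system is solved by multiplying with the stars of the entries of [metV], since the star of g
   [metV] = 1 is again the identity matrix. *)
transitivity (\sum_l sg (sst (metV M l k)) * ((j == l)%:R *: wst (th i))).
  under eq_bigr => l _ do rewrite -step mulr_sumr.
  rewrite exchange_big /=; under eq_bigr => r _.
    under eq_bigr => l _ do rewrite mulrA -sgM -sstM.
    rewrite -mulr_suml -(lin_sum sg_linear) -sst_sum metV_mulr.
    over.
  rewrite (bigD1 k) //= eqxx sst1 sg1 mul1r big1 ?addr0 // => r rk.
  by rewrite (negPf rk) -[sst _]/(sst 0) -(scale0r 0) sstZ conjC0 scale0r sg0 mul0r.
rewrite (bigD1 j) //= eqxx scale1r big1 ?addr0 // => l lj.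
by rewrite eq_sym (negPf lj) scale0r mulr0.
Qed.

Lemma wst_letterl i x : wst (th i * x) = wst x * wst (th i).
Proof.
move: x; apply: W_ext => [x y|x y|q I].
- by rewrite mulrDr wst_add.
- by rewrite wst_add mulrDl.
rewrite mulrA letter_scalar mulr_suml wst_sum.
transitivity (wst (wordW I) * wst (th i * sg q)).
  rewrite wst_letter_scalarE mulr_sumr; apply: eq_bigr => j _.
  by rewrite -mulrA wst_scalarl -wordW_cons wst_letter_word -wst_letter mulrA.
by rewrite wst_letter_scalar wst_scalarl mulrA.
Qed.

Lemma wstM x y : wst (x * y) = wst y * wst x.
Proof.
move: x; apply: W_ext => [x x'|x x'|q I].
- by rewrite mulrDl wst_add.
- by rewrite wst_add mulrDr.
rewrite -mulrA !wst_scalarl mulrA; congr (_ * _).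
elim: I => [|i I IH]; first by rewrite wordW0 mul1r wst1 mulr1.
by rewrite wordW_cons -mulrA !wst_letterl IH mulrA.
Qed.

Lemma wstK : involutive wst.
Proof.
apply: W_ext => [x y|//|q I]; first by rewrite !wst_add.
rewrite !wstM !wst_scalar sstK; congr (_ * _).
elim: I => [|i I IH]; first by rewrite wordW0 !wst1.
by rewrite wordW_cons !wstM IH wst_letter wst_vec vstarK vecW_basis.
Qed.

(** * Homogeneous and complex elements *)

Lemma wdeg_word q I : wdeg X (size I) (sg q * wordW I).
Proof. by exists (q *: << I >>); rewrite ?prZ ?wordWE //; apply/homogZ/homogU. Qed.

Lemma wdeg0 n : wdeg X n 0.
Proof. by exists 0; rewrite ?pr0 //; exact: homog0. Qed.

Lemma wdegD n x y : wdeg X n x -> wdeg X n y -> wdeg X n (x + y).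
Proof.
by case=> s hs -> [t ht ->]; exists (s + t); rewrite ?pr_add //; exact: homogD.
Qed.

Lemma wdegM n k x y : wdeg X n x -> wdeg X k y -> wdeg X (n + k) (x * y).
Proof.
case=> s hs -> [t ht ->]; exists (mulT M s t); rewrite ?prM //.
by apply: (tensor_mul_homog (muD M)).
Qed.

Lemma wdeg_scalarr n x q : wdeg X n x -> wdeg X n (x * sg q).
Proof.
move=> hx; rewrite -[n]addn0; apply: wdegM hx _.
by have := wdeg_word q [::]; rewrite wordW0 mulr1.
Qed.

Lemma wdeg_sum n (Y : Type) (r : seq Y) (P : pred Y) (F : Y -> W) :
  (forall x, P x -> wdeg X n (F x)) -> wdeg X n (\sum_(x <- r | P x) F x).
Proof. by move=> hF; elim/big_ind: _ => //; [exact: wdeg0|exact: wdegD]. Qed.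

Lemma wdeg_ind n (P : W -> Prop) : P 0 -> (forall x y, P x -> P y -> P (x + y)) ->
  (forall q I, size I = n -> P (sg q * wordW I)) -> forall x, wdeg X n x -> P x.
Proof.
move=> P0 PD PU _ [t ht ->]; move: t ht; apply: homog_ind => [|s t hs ht|q I hI].
- by rewrite pr0.
- by rewrite pr_add; exact: PD.
by rewrite prZ -wordWE; exact: PU.
Qed.

Definition cdeg n (x : W) := exists2 t, cspan n t & x = p t.

Lemma vdegE n x : vdeg X n x <-> cdeg n x.
Proof.
split=> [[t [ht ct ->]]|[t ct ->]]; exists t => //; first exact: cspanP.
by split=> //; [exact: cspan_homog ct|exact: cspan_complex ct].
Qed.

Lemma cdeg_wdeg n x : cdeg n x -> wdeg X n x.
Proof. by case=> t /cspan_homog ht ->; exists t. Qed.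

Lemma cdeg_word I : cdeg (size I) (wordW I).
Proof. by exists << I >>; rewrite ?wordWE //; exact: cspanU. Qed.

Lemma cdeg0 n : cdeg n 0.
Proof. by exists 0; rewrite ?pr0 //; exact: cspan0. Qed.

Lemma cdegD n x y : cdeg n x -> cdeg n y -> cdeg n (x + y).
Proof.
by case=> s hs -> [t ht ->]; exists (s + t); rewrite ?pr_add //; exact: cspanD.
Qed.

Lemma cdegZ n c x : cdeg n x -> cdeg n (c *: x).
Proof. by case=> t ht ->; exists (c%:A *: t); rewrite ?prC //; exact: cspanZ. Qed.

Lemma cdeg_sum n (Y : Type) (r : seq Y) (P : pred Y) (F : Y -> W) :
  (forall x, P x -> cdeg n (F x)) -> cdeg n (\sum_(x <- r | P x) F x).
Proof. by move=> hF; elim/big_ind: _ => //; [exact: cdeg0|exact: cdegD]. Qed.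

Lemma cdegM n k x y : cdeg n x -> cdeg k y -> cdeg (n + k) (x * y).
Proof.
case=> s hs -> [t ht ->]; exists (mulT M s t); rewrite ?prM //.
exact: (cspan_tensor_mul (muD M) (mu1 M) (muM M) hs ht).
Qed.

Lemma cdeg_vec x : cdeg 1 (vecW x).
Proof.
rewrite vecWE; apply: cdeg_sum => k _; apply: cdegZ.
exact: (cdeg_word [:: k]).
Qed.

Lemma cdeg_ind n (P : W -> Prop) : P 0 -> (forall x y, P x -> P y -> P (x + y)) ->
  (forall c I, size I = n -> P (c *: wordW I)) -> forall x, cdeg n x -> P x.
Proof.
move=> P0 PD PU _ [t ht ->]; move: t ht; apply: cspan_ind => [|s t hs ht|c I hI].
- by rewrite pr0.
- by rewrite pr_add; exact: PD.
by rewrite prC -wordWE; exact: PU.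
Qed.

Lemma cdeg_wst_word I : cdeg (size I) (wst (wordW I)).
Proof.
elim: I => [|i I IH].
  by rewrite wordW0 wst1; have := cdeg_word [::]; rewrite wordW0.
rewrite wst_letter_word /= -addn1; apply: cdegM IH _; exact: cdeg_vec.
Qed.

Lemma W_rind (P : W -> Prop) : P 0 -> (forall x y, P x -> P y -> P (x + y)) ->
  (forall I q, P (wordW I * sg q)) -> forall x, P x.
Proof.
move=> P0 PD PU x; rewrite -(wstK x); move: (wst x).
apply: W_ind => [|y z hy hz|q I]; rewrite ?wst0 ?wst_add //; first exact: PD.
(* The star of a word is a complex combination of words, so after the reflection the scalar remains
   on the right. *)
rewrite wst_scalarl; move: (wst _) (cdeg_wst_word I).
apply: cdeg_ind => [|y z hy hz|c J _].
- by rewrite mul0r.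
- by rewrite mulrDl; exact: PD.
by rewrite -scalerAl scalerAr -(linZ sg_linear).
Qed.

Lemma W_rext (Z : zmodType) (f h : W -> Z) :
  {morph f : x y / x + y} -> {morph h : x y / x + y} ->
  (forall I q, f (wordW I * sg q) = h (wordW I * sg q)) -> f =1 h.
Proof.
have D0 (k : W -> Z) : {morph k : x y / x + y} -> k 0 = 0.
  by move=> kD; apply: (addrI (k 0)); rewrite -kD !addr0.
move=> fD hD fh; apply: W_rind => // [|x y fx fy]; first by rewrite !D0.
by rewrite fD hD fx fy.
Qed.

(** * The form on the exterior algebra *)

Local Notation wm := (wmet X).

Lemma asig_linear : linear (asig M). Proof. exact: antisym_linear. Qed.

Lemma wm_addl y : {morph wm^~ y : x x' / x + x'}.
Proof.
move=> x x'; have [s <-] := pr_surj X x; have [s' <-] := pr_surj X x'.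
have [t <-] := pr_surj X y; rewrite -pr_add !wmetE; exact: tensor_metDl.
Qed.

Lemma wm_addr x : {morph wm x : y y' / y + y'}.
Proof.
move=> y y'; have [s <-] := pr_surj X x; have [t <-] := pr_surj X y.
have [t' <-] := pr_surj X y'; rewrite -pr_add !wmetE (linD asig_linear).
exact: tensor_metDr (muD M) _ _ _ _.
Qed.

Lemma wm_scalarl q x y : wm (sg q * x) y = q * wm x y.
Proof.
have [s <-] := pr_surj X x; have [t <-] := pr_surj X y.
by rewrite -prZ !wmetE; exact: tensor_metZl.
Qed.

Lemma wm_balanced x q y : wm (x * sg q) y = wm x (sg q * y).
Proof.
have [s <-] := pr_surj X x; have [t <-] := pr_surj X y.
rewrite -prZ scalarWE -prM !wmetE (linZ asig_linear).
exact: tensor_met_balanced (muD M) (muM M) _ _ _ _.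
Qed.

Lemma wmZr x c y : wm x (c *: y) = c *: wm x y.
Proof.
have [s <-] := pr_surj X x; have [t <-] := pr_surj X y.
rewrite -prC !wmetE (linZ asig_linear).
by apply: tensor_metCr; [exact: muD|exact: mu1|exact: muM].
Qed.

Lemma wmZl c x y : wm (c *: x) y = c *: wm x y.
Proof. by rewrite -mulr_algl -sg_alg wm_scalarl mulr_algl. Qed.

Lemma wm_linearr x : linear (wm x).
Proof. by move=> c y y'; rewrite wm_addr wmZr. Qed.

Lemma wm0l y : wm 0 y = 0.
Proof. by rewrite -[0](scale0r 0) wmZl scale0r. Qed.

Lemma wm_degree n k x y : wdeg X n x -> wdeg X k y -> n != k -> wm x y = 0.
Proof.
case=> s hs -> [t ht ->] nk; rewrite wmetE.
by apply: tensor_met_degree nk => //; [exact: muD|exact: homog_antisym].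
Qed.

Lemma wdeg_wst n x : wdeg X n x -> wdeg X n (wst x).
Proof.
move: x; apply: wdeg_ind => [|x y hx hy|q I <-].
- by rewrite wst0; exact: wdeg0.
- by rewrite wst_add; exact: wdegD.
rewrite wst_scalarl; apply/wdeg_scalarr/cdeg_wdeg; exact: cdeg_wst_word.
Qed.

Hypothesis positive_selfadj : forall q, op_ge0 (real M) q -> sst q = q.
Hypothesis asig_pos : asig_positive M.

(* Positivity of the form x, y |-> wm (wst x) y makes it hermitian, by        *)
(* polarization in degree n.                                                  *)
Lemma wm_hermitian_deg n x y : wdeg X n x -> wdeg X n y ->
  sst (wm (wst x) y) = wm (wst y) x.
Proof.
pose b x y := wm (wst x) y.
have bb z : wdeg X n z -> sst (b z z) = b z z.
  by case=> t ht ->; rewrite /b wstarE wmetE; exact: (positive_selfadj (asig_pos ht)).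
move=> hx hy; have hZ c : wdeg X n (c *: x).
  by rewrite -mulr_algl -sg_alg; apply: (@wdegM 0) hx; have := wdeg_word c%:A [::];
    rewrite wordW0 mulr1.
have polar c : c^* *: (b x y - sst (b y x)) = c *: (sst (b x y) - b y x).
  have := bb _ (wdegD (hZ c) hy).
  have -> : b (c *: x + y) (c *: x + y) =
      (c^* *: (c *: b x x) + b y y) + (c^* *: b x y + c *: b y x).
    rewrite /b wst_add wstZ wm_addl !wm_addr !wmZl !wmZr -!addrA.
    by congr (_ + _); rewrite [RHS]addrC addrA.
  rewrite !sst_add !sstZ !bb // conjCK !scalerA [c^* * c]mulrC => /addrI h.
  apply/eqP; rewrite !scalerBr subr_eq -(inj_eq (addIr (c *: b y x))) -h.
  by rewrite addrAC subrK.
have := polar 1; have := polar 'i; rewrite conjC1 conjCi !scale1r => h1 h2.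
move: h1; rewrite -h2 => /eqP; rewrite scaleNr eq_sym -addr_eq0 -scalerDl.
rewrite scaler_eq0 -mulr2n -mulr_natl mulf_eq0 pnatr_eq0 /= (negPf (neq0Ci C)) /=.
by rewrite h2 subr_eq0 => /eqP.
Qed.

Lemma wm_hermitian x y : sst (wm (wst x) y) = wm (wst y) x.
Proof.
move: x; apply: W_ext => [x x'|x x'|q I].
- by rewrite wst_add wm_addl sst_add.
- by rewrite wm_addr.
move: y; apply: W_ext => [y y'|y y'|q' J].
- by rewrite wm_addr sst_add.
- by rewrite wst_add wm_addl.
have hI := wdeg_word q I; have hJ := wdeg_word q' J.
have [IJ|IJ] := eqVneq (size I) (size J).
  by apply: (@wm_hermitian_deg (size J)) => //; rewrite -IJ.
rewrite (wm_degree (wdeg_wst hI) hJ IJ) (wm_degree (wdeg_wst hJ) hI) 1?eq_sym //.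
by rewrite -[0 in LHS](scale0r 0) sstZ conjC0 scale0r.
Qed.

Lemma wm_scalarr x y q : wm x (y * sg q) = wm x y * q.
Proof.
rewrite -[x]wstK -[LHS]sstK wm_hermitian wstM wst_scalar wm_scalarl sstM sstK.
by rewrite wm_hermitian.
Qed.

(** * The volume element and the star operator *)

Variable v : volume X.
Local Notation m := (vtop v).
Local Notation w := (vol v).
Local Notation cm := (wcomp X m).

(** Antisymmetrizing a complex representative of w gives a nonzero complex tensor. If q w = 0, then
    q times each of its coefficients vanishes, and one of these is a nonzero complex number. *)
Lemma scalar_vol_inj q : sg q * w = 0 -> q = 0.
Proof.
have /vdegE [t ht wt] := vol_deg v; have w0 := vol_neq0 v.
rewrite wt -prZ => /pr_ker; rewrite (linZ asig_linear) => qt0.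
have ct : cspan m (asig M t) by exact: cspan_antisym.
have [J tJ] : exists J, (asig M t)@_J != 0.
  apply: contrapT => /forallNP h; case/eqP: w0; rewrite wt; apply/pr_ker/malgP => J.
  by rewrite mcoeff0; apply/eqP/negPn/negP/h.
have := congr1 (fun t : T => t@_J) qt0; rewrite mcoeffZ mcoeff0.
have [c cE] := cspan_complex ct J; rewrite cE in tJ *.
rewrite mulr_algr => /eqP; rewrite scaler_eq0 => /orP[/eqP c0|/eqP //].
by rewrite c0 scale0r eqxx in tJ.
Qed.

Lemma scalar_vol_cancel q q' : sg q * w = sg q' * w -> q = q'.
Proof.
move=> /eqP; rewrite -subr_eq0 -mulrBl => /eqP h; apply/eqP; rewrite -subr_eq0.
by apply/eqP/scalar_vol_inj; rewrite (linB sg_linear).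
Qed.

Lemma comp_add : {morph cm : x y / x + y}.
Proof.
move=> x y; have [s <-] := pr_surj X x; have [t <-] := pr_surj X y.
by rewrite -pr_add !wcompE [degree_part _ _](linD (lext_linear _)) pr_add.
Qed.

Lemma comp_degree n x : wdeg X n x -> cm x = if n == m then x else 0.
Proof.
by case=> t ht ->; rewrite wcompE (degree_part_homog _ ht); case: ifP; rewrite ?pr0.
Qed.

Lemma comp_scalarl q x : cm (sg q * x) = sg q * cm x.
Proof.
have [s <-] := pr_surj X x.
by rewrite -prZ !wcompE [degree_part _ _](linZ (lext_linear _)) prZ.
Qed.

Lemma comp_scalarr q x : cm (x * sg q) = cm x * sg q.
Proof.
move: x; apply: W_ext => [x y|x y|q' I]; rewrite ?mulrDl ?comp_add ?mulrDl //.
have hI := wdeg_word q' I.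
rewrite (comp_degree (wdeg_scalarr q hI)) (comp_degree hI).
by case: ifP; rewrite ?mul0r.
Qed.

(* The coefficient along the volume element of the top degree part.           *)
Definition top_coef (x : W) : Sig := jpair v 1 x.

Lemma top_coefE x : sg (top_coef x) * w = cm x.
Proof. by rewrite scalarWE jpairE mul1r. Qed.

Lemma top_coefP q x : cm x = sg q * w -> top_coef x = q.
Proof. by move=> h; apply: scalar_vol_cancel; rewrite top_coefE. Qed.

Lemma jpair_top x y : jpair v x y = top_coef (x * y).
Proof.
by apply: scalar_vol_cancel; rewrite top_coefE scalarWE jpairE.
Qed.

Lemma top_add : {morph top_coef : x y / x + y}.
Proof.
move=> x y; apply: top_coefP.
by rewrite comp_add -!top_coefE -mulrDl sgD.
Qed.

Lemma top0 : top_coef 0 = 0.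
Proof. by apply: (addrI (top_coef 0)); rewrite -top_add !addr0. Qed.

Lemma top_scalarl q x : top_coef (sg q * x) = q * top_coef x.
Proof. by apply: top_coefP; rewrite comp_scalarl -top_coefE mulrA -sgM. Qed.

(** A scalar on the right has to pass w before it joins the coefficient; this is the origin of S in
    all formulas for the star operator. *)
Lemma top_scalarr x q : top_coef (x * sg q) = top_coef x * twist v q.
Proof.
apply: top_coefP; rewrite comp_scalarr -top_coefE -mulrA sgM -mulrA.
by congr (_ * _); rewrite !scalarWE vol_twist.
Qed.

Lemma top_linear : linear top_coef.
Proof.
by move=> c x y; rewrite top_add -[c *: x]mulr_algl -sg_alg top_scalarl mulr_algl.
Qed.

Lemma top_vol : top_coef w = 1.
Proof.
apply: top_coefP; have /vdegE/cdeg_wdeg hw := vol_deg v.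
by rewrite (comp_degree hw) eqxx sg1 mul1r.
Qed.

Lemma top_degree n x : wdeg X n x -> n != m -> top_coef x = 0.
Proof.
move=> hx nm; apply: top_coefP.
by rewrite (comp_degree hx) (negPf nm) sg0 mul0r.
Qed.

Lemma word_gt I : (m < size I)%N -> wordW I = 0.
Proof.
by move=> hI; apply: (vdeg_gt hI); apply/vdegE; exact: cdeg_word.
Qed.

Lemma twistV_linear : linear (twistV v).
Proof.
move=> c x y; apply: (can_inj (twistK v)).
rewrite [RHS](linearP (twist v)) [LHS]twistVK.
by congr (_ *: _ + _); apply/esym/twistVK.
Qed.

(* A generalized inverse of the matrix of the pairing plays the role of dual  *)
(* bases of the exterior powers of V.                                         *)
Lemma pairing_frame k : (k <= m)%N -> exists f : seq 'I_d -> W,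
  [/\ forall I, size I = k -> cdeg (m - k) (f I),
      forall y, cdeg (m - k) y ->
        y = \sum_(I : k.-tuple 'I_d) f I * sg (top_coef (wordW I * y))
    & forall x, cdeg k x ->
        x = \sum_(I : k.-tuple 'I_d) sg (top_coef (x * f I)) * wordW I].
Proof.
move=> km.
have : forall IJ : k.-tuple 'I_d * (m - k).-tuple 'I_d,
    exists c, wordW IJ.1 * wordW IJ.2 = c *: w.
  move=> [I J]; apply: vol_gen; apply/vdegE; rewrite -wordW_cat.
  have := cdeg_word (I ++ J); rewrite size_cat !size_tuple subnKC //.
case/choice => P0 PE; pose P I J := P0 (I, J).
have {}PE I J : wordW (tval I) * wordW (tval J) = P I J *: w by exact: (PE (I, J)).
have [Q PQP] := generalized_inverse P.
have topP I J : top_coef (wordW (tval I) * wordW (tval J)) = (P I J)%:A.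
  by rewrite PE (linZ top_linear) top_vol.
pose F (I : k.-tuple 'I_d) : W := \sum_J Q J I *: wordW (tval J).
have FE I' I : wordW (tval I') * F I = (\sum_J P I' J * Q J I) *: w.
  rewrite mulr_sumr scaler_suml; apply: eq_bigr => J _.
  by rewrite -scalerAr PE scalerA mulrC.
pose f I := if insub I : option (k.-tuple 'I_d) is Some I' then F I' else 0.
have fE (I : k.-tuple 'I_d) : f I = F I by rewrite /f valK.
have degF I : cdeg (m - k) (F I).
  apply: cdeg_sum => J _; apply: cdegZ.
  by have := cdeg_word J; rewrite size_tuple.
exists f; split=> [I|y hy|x hx].
- move/eqP => hI; have -> : f I = F (Tuple hI) by rewrite -fE.
  exact: degF.
- pose y' y := \sum_(I : k.-tuple 'I_d) F I * sg (top_coef (wordW I * y)).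
  have y'D : {morph y' : y z / y + z}.
    move=> y1 y2; rewrite /y' -big_split; apply: eq_bigr => I _ /=.
    by rewrite mulrDr top_add sgD mulrDr.
  have -> : \sum_(I : k.-tuple 'I_d) f I * sg (top_coef (wordW I * y)) = y' y.
    by apply: eq_bigr => I _; rewrite fE.
  have degy' : cdeg (m - k) (y' y).
    move: y hy; apply: cdeg_ind => [|y1 y2 h1 h2|c J hJ].
    + rewrite /y' big1 => [|I _]; first exact: cdeg0.
      by rewrite mulr0 top0 sg0 mulr0.
    + by rewrite y'D; exact: cdegD.
    apply: cdeg_sum => I _; move/eqP: hJ => hJ.
    rewrite -scalerAr (linZ top_linear) (topP I (Tuple hJ)) scalerA -/(_%:A) sg_alg mulr_algr.
    exact: cdegZ.
  (* By P Q P = P the element [y' y] has the same products with all words as y, and nondegeneracy of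
     the pairing identifies the two. The third claim is proved in the same way on the other side. *)
  apply/eqP; rewrite -subr_eq0; apply/eqP.
  apply: (pairing_nondegr km).
    apply/vdegE; apply: (cdegD hy); rewrite -scaleN1r; exact: cdegZ.
  move=> x /vdegE; move: x; apply: cdeg_ind => [|x1 x2 h1 h2|c I0 hI0].
  + by rewrite mul0r.
  + by rewrite mulrDl h1 h2 addr0.
  move/eqP: hI0 => hI0; rewrite -scalerAl; apply/eqP; rewrite scaler_eq0; apply/orP; right.
  rewrite mulrBr subr_eq0; apply/eqP.
  have -> : I0 = tval (Tuple hI0) by [].
  move: (Tuple hI0) => {hI0}I0; clear degy'; move: y hy.
  apply: cdeg_ind => [|y1 y2 h1 h2|c' J0 hJ0].
  + by rewrite /y' big1 ?mulr0 // => I _; rewrite mulr0 top0 sg0 mulr0.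
  + by rewrite y'D !mulrDr h1 h2.
  move/eqP: hJ0 => hJ0; have -> : J0 = tval (Tuple hJ0) by [].
  move: (Tuple hJ0) => {hJ0}J0.
  have -> : y' (c' *: wordW J0) = c' *: y' (wordW J0).
    rewrite /y' scaler_sumr; apply: eq_bigr => I _.
    by rewrite -scalerAr (linZ top_linear) (linZ sg_linear) -scalerAr.
  rewrite -!scalerAr; congr (_ *: _).
  rewrite PE -PQP exchange_big /y' mulr_sumr scaler_suml; apply: eq_bigr => I _.
  by rewrite topP sg_alg mulr_algr -scalerAr FE scalerA -mulr_suml mulrC.
- pose x' x := \sum_(I : k.-tuple 'I_d) sg (top_coef (x * F I)) * wordW I.
  have x'D : {morph x' : y z / y + z}.
    move=> y1 y2; rewrite /x' -big_split; apply: eq_bigr => I _ /=.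
    by rewrite mulrDl top_add sgD mulrDl.
  have x'Z c y : x' (c *: y) = c *: x' y.
    rewrite /x' scaler_sumr; apply: eq_bigr => I _.
    by rewrite -scalerAl (linZ top_linear) (linZ sg_linear) -scalerAl.
  have x'0 : x' 0 = 0 by have := x'Z 0 0; rewrite !scale0r.
  have -> : \sum_(I : k.-tuple 'I_d) sg (top_coef (x * f I)) * wordW I = x' x.
    by apply: eq_bigr => I _; rewrite fE.
  have x'E (I0 : k.-tuple 'I_d) :
      x' (wordW I0) = \sum_I (\sum_J P I0 J * Q J I) *: wordW (tval I).
    apply: eq_bigr => I _.
    by rewrite FE (linZ top_linear) top_vol sg_alg mulr_algl.
  apply/eqP; rewrite -subr_eq0; apply/eqP.
  apply: (pairing_nondegl km).
    apply/vdegE; apply: (cdegD hx); rewrite -scaleN1r; apply: cdegZ.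
    move: x hx; apply: cdeg_ind => [|x1 x2 h1 h2|c J hJ].
    + rewrite x'0; exact: cdeg0.
    + by rewrite x'D; exact: cdegD.
    rewrite x'Z; apply: cdegZ; move/eqP: hJ => hJ; rewrite (x'E (Tuple hJ)).
    apply: cdeg_sum => I _; apply: cdegZ.
    by have := cdeg_word I; rewrite size_tuple.
  move=> y /vdegE; move: y; apply: cdeg_ind => [|y1 y2 h1 h2|c J0 hJ0].
  + by rewrite mulr0.
  + by rewrite mulrDr h1 h2 addr0.
  move/eqP: hJ0 => hJ0; rewrite -scalerAr; apply/eqP; rewrite scaler_eq0; apply/orP; right.
  rewrite mulrBl subr_eq0; apply/eqP.
  have -> : J0 = tval (Tuple hJ0) by [].
  move: (Tuple hJ0) => {hJ0}J0; move: x hx.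
  apply: cdeg_ind => [|y1 y2 h1 h2|c' I0 hI0].
  + by rewrite x'0 !mul0r.
  + by rewrite x'D !mulrDl h1 h2.
  move/eqP: hI0 => hI0; have -> : I0 = tval (Tuple hI0) by [].
  move: (Tuple hI0) => {hI0}I0; rewrite x'Z -!scalerAl; congr (_ *: _).
  rewrite x'E PE -PQP exchange_big mulr_suml scaler_suml; apply: eq_bigr => I _.
  by rewrite -scalerAl PE scalerA -mulr_suml.
Qed.

Lemma complex_top x : cdeg m x -> exists c : C, x = c *: w.
Proof. by move/vdegE; exact: vol_gen. Qed.

Lemma twistV0 : twistV v 0 = 0.
Proof. exact: (lin0 twistV_linear). Qed.

Lemma twistVM q q' : twistV v (q * q') = twistV v q * twistV v q'.
Proof.
apply: (can_inj (twistK v)); rewrite twistVK rmorphM.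
by congr (_ * _); apply/esym/twistVK.
Qed.

Lemma twistV_alg (c : C) : twistV v c%:A = c%:A.
Proof.
rewrite (linZ twistV_linear) -[in LHS](rmorph1 (twist v)).
by congr (_ *: _); exact: twistK.
Qed.

(** Longer words vanish in W, so the bound m loses nothing. *)
Definition word_sum (F : seq 'I_d -> W) : W :=
  \sum_(k < m.+1) \sum_(I : k.-tuple 'I_d) F (tval I).

Lemma word_sum_degree (n : nat) F : (n <= m)%N ->
  (forall I, size I != n -> F I = 0) ->
  word_sum F = \sum_(I : n.-tuple 'I_d) F (tval I).
Proof.
rewrite -ltnS => nm F0; rewrite /word_sum (bigD1 (Ordinal nm)) //= [X in _ + X]big1 ?addr0 //.
move=> k kn; apply: big1 => I _; apply: F0; rewrite size_tuple.
by apply: contra kn => /eqP kn; apply/eqP/val_inj.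
Qed.

Lemma word_sum_add F H : word_sum (fun I => F I + H I) = word_sum F + word_sum H.
Proof.
rewrite /word_sum -big_split; apply: eq_bigr => k _.
exact: big_split.
Qed.

Lemma eq_word_sum F H : (forall I, F I = H I) -> word_sum F = word_sum H.
Proof. by move=> FH; apply: eq_bigr => k _; apply: eq_bigr => I _. Qed.

Lemma word_sum0 F : (forall I, (size I <= m)%N -> F I = 0) -> word_sum F = 0.
Proof.
move=> F0; apply: big1 => k _; apply: big1 => I _; apply: F0.
by rewrite size_tuple -ltnS.
Qed.

Lemma word_sum_morph (f : W -> W) F : {morph f : x y / x + y} ->
  f (word_sum F) = word_sum (fun I => f (F I)).
Proof.
move=> fD; have f0 : f 0 = 0 by apply: (addrI (f 0)); rewrite -fD !addr0.
rewrite /word_sum (big_morph _ fD f0); apply: eq_bigr => k _.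
exact: (big_morph _ fD f0).
Qed.

(** Merges the frames of all degrees into one function that reads the degree off the length of the
    word; the value 0 beyond degree m is a placeholder. *)
Lemma exists_frame : exists f : seq 'I_d -> W,
  [/\ forall I, (size I <= m)%N -> cdeg (m - size I) (f I),
      forall k y, (k <= m)%N -> cdeg (m - k) y ->
        y = \sum_(I : k.-tuple 'I_d) f I * sg (top_coef (wordW I * y))
    & forall k x, (k <= m)%N -> cdeg k x ->
        x = \sum_(I : k.-tuple 'I_d) sg (top_coef (x * f I)) * wordW I].
Proof.
have : forall k, exists f : seq 'I_d -> W, (k <= m)%N ->
    [/\ forall I, size I = k -> cdeg (m - k) (f I),
      forall y, cdeg (m - k) y ->
        y = \sum_(I : k.-tuple 'I_d) f I * sg (top_coef (wordW I * y))
    & forall x, cdeg k x ->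
        x = \sum_(I : k.-tuple 'I_d) sg (top_coef (x * f I)) * wordW I].
  move=> k; have [/pairing_frame[f hf]|h] := leqP k m; first by exists f.
  by exists (fun=> 0).
case/choice => f hf; exists (fun I => f (size I) I); split=> [I hI|k y km hy|k x km hx].
- by case: (hf _ hI) => h _ _; exact: h.
- case: (hf _ km) => _ h _; rewrite {1}(h y hy); apply: eq_bigr => I _.
  by rewrite size_tuple.
- case: (hf _ km) => _ _ h; rewrite {1}(h x hx); apply: eq_bigr => I _.
  by rewrite size_tuple.
Qed.

(* [wm (x J)] reads off a coordinate of the antisymmetrized tensor, from      *)
(* which a generalized inverse of the matrix of the antisymmetrizer           *)
(* reconstructs [y].                                                          *)
Lemma form_frame : exists h x : seq 'I_d -> W,
  forall y, y = word_sum (fun J => h J * sg (wm (x J) y)).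
Proof.
have /choice[s sE] : forall J, exists s : T, forall n u, cspan n u ->
    metT M s u = u@_J.
  move=> J; apply: (dual_word (muD M) (mu1 M) (muM M)); exact: metVl.
have : forall k, exists h : seq 'I_d -> W, forall I : k.-tuple 'I_d,
    wordW I = \sum_(J : k.-tuple 'I_d) h J * sg ((asig M << tval I >>)@_(tval J)).
  move=> k.
  have ct (I : k.-tuple 'I_d) : cspan k (asig M << tval I >>).
    by apply/cspan_antisym/cspanU; rewrite size_tuple.
  have /choice[a aE] := ct.
  have [Q aQa] := generalized_inverse a.
  have coefE (I J : k.-tuple 'I_d) : (asig M << tval I >>)@_(tval J) = (a I J)%:A.
    rewrite aE mcoeff_sum (bigD1 J) //= mcoeff_scaled_word eqxx big1 ?addr0 //.
    by move=> K; rewrite -val_eqE mcoeff_scaled_word => /negPf ->.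
  pose H (J : k.-tuple 'I_d) : T := \sum_I (Q J I)%:A *: << tval I >>.
  exists (fun J => if insub J : option (k.-tuple 'I_d) is Some J' then p (H J') else 0).
  move=> I; under eq_bigr => J _ do rewrite valK coefE sg_alg mulr_algr -prC.
  rewrite -pr_sum wordWE; apply/eqP; rewrite -subr_eq0; apply/eqP.
  have -> z z' : p z - p z' = p (z - z').
    by apply/eqP; rewrite subr_eq -pr_add subrK.
  (* Equality in the quotient is equality after antisymmetrization, where it becomes the matrix
     identity a Q a = a. *)
  apply/pr_ker; rewrite (linB asig_linear); apply/eqP; rewrite subr_eq0; apply/eqP.
  rewrite (lin_sum asig_linear) [LHS]aE.
  transitivity (\sum_K \sum_J \sum_I' (a I J * Q J I' * a I' K)%:A *: << tval K >> : T).
    apply: eq_bigr => K _; rewrite -aQa !scaler_suml.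
    by apply: eq_bigr => J _; rewrite !scaler_suml.
  rewrite exchange_big; apply: eq_bigr => J _.
  rewrite (linZ asig_linear) (lin_sum asig_linear) scaler_sumr exchange_big.
  apply: eq_bigr => I' _; rewrite (linZ asig_linear) aE.
  rewrite [RHS]scalerA [RHS]scaler_sumr; apply: eq_bigr => K _.
  rewrite [RHS]scalerA; congr (_ *: _).
  by rewrite -[RHS]mulrA !mulr_algl !scalerA.
case/choice => h hE; exists (fun J => h (size J) J), (fun J => p (s J)).
apply: W_rext => [//|y z|I q].
  rewrite -word_sum_add; apply: eq_word_sum => J.
  by rewrite wm_addr sgD mulrDr.
have wmE J : wm (p (s J)) (wordW I) = (asig M << I >>)@_J.
  by rewrite wordWE wmetE; apply: (sE _ (size I)); apply/cspan_antisym/cspanU.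
have [Im|Im] := leqP (size I) m; last first.
  by rewrite (word_gt Im) mul0r word_sum0 // => J _; rewrite (lin0 (wm_linearr _)) sg0 mulr0.
rewrite (word_sum_degree Im) => [|J JI].
  rewrite {1}(hE _ (in_tuple I)) mulr_suml; apply: eq_bigr => J _.
  by rewrite wm_scalarr wmE size_tuple sgM mulrA.
rewrite wm_scalarr wmE mcoeff_outdom ?mul0r ?sg0 ?mulr0 //.
apply: contra JI => JI; apply/eqP.
by apply: (homog_antisym (f := braid M) (theta := theta) (t := << I >>)) JI; exact: homogU.
Qed.

(** * The star operator and its algebraic properties *)

Variable fr : seq 'I_d -> W.
Hypothesis fr_deg : forall I, (size I <= m)%N -> cdeg (m - size I) (fr I).
Hypothesis frR : forall k y, (k <= m)%N -> cdeg (m - k) y ->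
  y = \sum_(I : k.-tuple 'I_d) fr I * sg (top_coef (wordW I * y)).
Hypothesis frL : forall k x, (k <= m)%N -> cdeg k x ->
  x = \sum_(I : k.-tuple 'I_d) sg (top_coef (x * fr I)) * wordW I.

Definition hodge (y : W) : W :=
  word_sum (fun I => fr I * sg (twistV v (wm (wordW I) y))).

Lemma hodge_linear : linear hodge.
Proof.
have hD : {morph hodge : y y' / y + y'}.
  move=> y y'; rewrite /hodge -word_sum_add; apply: eq_word_sum => I.
  by rewrite wm_addr (linD twistV_linear) sgD mulrDr.
move=> c y y'; rewrite hD; congr (_ + _).
rewrite /hodge [RHS](@word_sum_morph (fun x => c *: x)) => [|x x']; last exact: scalerDr.
apply: eq_word_sum => I.
by rewrite wmZr (linZ twistV_linear) (linZ sg_linear) -scalerAr.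
Qed.

Lemma top_word_frame I K : (size I <= m)%N -> size I != size K ->
  top_coef (wordW K * fr I) = 0.
Proof.
move=> Im IK; apply: (@top_degree (size K + (m - size I))).
  by apply: wdegM; apply: cdeg_wdeg; [exact: cdeg_word|exact: fr_deg].
by apply: contra IK => /eqP h; apply/eqP; lia.
Qed.

Lemma top_sum (F : seq 'I_d -> W) : top_coef (word_sum F) =
  \sum_(k < m.+1) \sum_(I : k.-tuple 'I_d) top_coef (F I).
Proof.
rewrite /word_sum (big_morph _ top_add top0); apply: eq_bigr => k _.
exact: (big_morph _ top_add top0).
Qed.

Lemma hodgeP x y : top_coef (x * hodge y) = wm x y.
Proof.
move: x; apply: W_ext => [x x'|x x'|q K]; first by rewrite mulrDl top_add.
  exact: wm_addl.
rewrite wm_scalarl -mulrA top_scalarl; congr (_ * _).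
have [Km|Km] := leqP (size K) m; last by rewrite (word_gt Km) mul0r top0 wm0l.
rewrite /hodge (@word_sum_morph (fun x => wordW K * x)) => [|x x']; last exact: mulrDr.
rewrite top_sum; have Km' : (size K < m.+1)%N by [].
rewrite (bigD1 (Ordinal Km')) //= [X in _ + X]big1 ?addr0.
  (* Only words of the length of K survive by degree, and the left frame expands [wordW K] in
     exactly these; S and S^-1 cancel. *)
  rewrite [in RHS](frL Km (cdeg_word K)) (big_morph _ (wm_addl y) (wm0l y)).
  apply: eq_bigr => I _.
  by rewrite mulrA top_scalarr twistVK wm_scalarl.
move=> k kK; apply: big1 => I _; rewrite mulrA top_scalarr.
rewrite top_word_frame ?mul0r // size_tuple; first by rewrite -ltnS.
by apply: contra kK => /eqP kK; apply/eqP/val_inj.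
Qed.

(** An element is determined by its pairings j(x, z). With z written as words times scalars on the
    right, each scalar leaves [top_coef] twisted by S, and [twistV] undoes this. *)
Lemma hodge_recover z :
  z = word_sum (fun I => fr I * sg (twistV v (top_coef (wordW I * z)))).
Proof.
move: z; apply: W_rext => [//|z z'|J q].
  rewrite -word_sum_add; apply: eq_word_sum => I.
  by rewrite mulrDr top_add (linD twistV_linear) sgD mulrDr.
have [Jm|Jm] := leqP (size J) m; last first.
  rewrite (word_gt Jm) mul0r word_sum0 // => I _.
  by rewrite mulr0 top0 twistV0 sg0 mulr0.
have Jm' : (m - size J <= m)%N by exact: leq_subr.
(* Two complex words pair to a complex number, which S^-1 fixes; this reconciles the formula with
   [frR], where no twist occurs. *)
have IJE (I : seq 'I_d) : size I = (m - size J)%N ->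
    exists c : C, top_coef (wordW I * wordW J) = c%:A.
  move=> hI; have [c cE] : exists c : C, wordW I * wordW J = c *: w.
    apply: complex_top; rewrite -(subnK Jm) -hI; apply: cdegM; exact: cdeg_word.
  by exists c; rewrite cE (linZ top_linear) top_vol.
rewrite (word_sum_degree Jm') => [|I hI]; last first.
  have IJ0 : top_coef (wordW I * wordW J) = 0.
    apply: (@top_degree (size I + size J)).
      by apply: wdegM; apply: cdeg_wdeg; exact: cdeg_word.
    by apply: contra hI => /eqP h; apply/eqP; lia.
  by rewrite mulrA top_scalarr IJ0 mul0r twistV0 sg0 mulr0.
have hJ : cdeg (m - (m - size J)) (wordW J) by rewrite subKn //; exact: cdeg_word.
rewrite {1}(frR Jm' hJ) mulr_suml; apply: eq_bigr => I _.
rewrite mulrA top_scalarr twistVM twistK sgM mulrA.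
have [|c cE] := IJE I; first exact: size_tuple.
by rewrite cE twistV_alg.
Qed.

Lemma hodge_unique z z' : (forall x, top_coef (x * z) = top_coef (x * z')) -> z = z'.
Proof.
move=> h; rewrite (hodge_recover z) (hodge_recover z').
by apply: eq_word_sum => I; rewrite h.
Qed.

Lemma hodge_scalarl q x : hodge (sg q * x) = sg q * hodge x.
Proof.
by apply: hodge_unique => z; rewrite hodgeP mulrA hodgeP wm_balanced.
Qed.

Lemma hodge_scalarr x q : hodge (x * sg q) = hodge x * sg (twistV v q).
Proof.
apply: hodge_unique => z.
by rewrite hodgeP mulrA top_scalarr hodgeP twistVK wm_scalarr.
Qed.

Lemma hodge_degree n x : wdeg X n x ->
  if (n <= m)%N then wdeg X (m - n) (hodge x) else hodge x = 0.
Proof.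
move=> hx; case: leqP => nm.
  rewrite /hodge (word_sum_degree nm) => [|I hI].
    apply: wdeg_sum => I _; apply: wdeg_scalarr; apply: cdeg_wdeg.
    by have := @fr_deg I; rewrite size_tuple; apply.
  have := wdeg_word 1 I; rewrite sg1 mul1r => hI'.
  by rewrite (wm_degree hI' hx hI) twistV0 sg0 mulr0.
rewrite /hodge word_sum0 // => I Im.
have := wdeg_word 1 I; rewrite sg1 mul1r => hI'.
rewrite (wm_degree hI' hx) ?twistV0 ?sg0 ?mulr0 //.
by apply/eqP => hI; rewrite hI leqNgt nm in Im.
Qed.

Lemma hodge_bijective : bijective hodge.
Proof.
have [h [x hx]] := form_frame.
have inj : injective hodge.
  move=> y y' yy'; rewrite (hx y) (hx y'); apply: eq_word_sum => J.
  by rewrite -!hodgeP yy'.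
have surj z : exists y, hodge y = z.
  (* The witness is chosen so that its form with y is the sum of g(y, x_J') j(h_J', z), where ' is
     the star; by the conjugated reconstruction [yE] this is j(y, z). *)
  exists (word_sum (fun J => wst (x J) * sg (top_coef (wst (h J) * z)))).
  apply: hodge_unique => y; rewrite hodgeP.
  have yE : y = word_sum (fun J => sg (wm y (wst (x J))) * wst (h J)).
    rewrite -[LHS]wstK {1}(hx (wst y)) (word_sum_morph _ wst_add).
    apply: eq_word_sum => J; rewrite wstM wst_scalar.
    by rewrite -{1}(wstK (x J)) wm_hermitian wstK.
  rewrite {2}yE (@word_sum_morph (fun u => u * z)) => [|u u']; last exact: mulrDl.
  rewrite top_sum /word_sum; have wmD := wm_addr y; have wm0 := lin0 (wm_linearr y).
  rewrite (big_morph _ wmD wm0); apply: eq_bigr => k _.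
  rewrite (big_morph _ wmD wm0); apply: eq_bigr => J _.
  by rewrite wm_scalarr -mulrA top_scalarl.
have /choice[f fE] := surj.
by exists f => // y; apply: inj; rewrite fE.
Qed.

(** * Covariance *)

(* Coaction and action are treated at once.  [B] is W (x) A with [Phi] the    *)
(* coaction, or the convolution algebra Hom(A, W) with [Phi x] = (a |-> x o a). *)
(* [D] is the copy of A, respectively of the dual of A, in [B]; [lift f] is   *)
(* f (x) id, respectively the composition with f; [u] is the matrix with      *)
(* Phi(theta_i) = \sum_j theta_j u_ji, and [u'] inverts its transpose.        *)
Section Covariance.

Section WordSums.
Variable Z : zmodType.

(** A sum over the words of length n, nested letter by letter instead of indexed by tuples, so that
    it unfolds along [::] and splits along [++]. *)
Fixpoint wsum n (F : seq 'I_d -> Z) : Z :=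
  if n is k.+1 then \sum_i wsum k (fun I => F (i :: I)) else F [::].

Lemma eq_wsum n F H : (forall I, size I = n -> F I = H I) -> wsum n F = wsum n H.
Proof.
elim: n F H => [|n IH] F H FH /=; first exact: FH.
by apply: eq_bigr => i _; apply: IH => I hI; apply: FH; rewrite /= hI.
Qed.

Lemma wsum_add n F H : wsum n (fun I => F I + H I) = wsum n F + wsum n H.
Proof.
elim: n F H => //= n IH F H.
by rewrite -big_split; apply: eq_bigr => i _; rewrite IH.
Qed.

Lemma wsum0 n F : (forall I, size I = n -> F I = 0) -> wsum n F = 0.
Proof.
elim: n F => [|n IH] F F0 /=; first exact: F0.
by apply: big1 => i _; apply: IH => I hI; apply: F0; rewrite /= hI.
Qed.

Lemma wsum_sum n (Y : Type) (r : seq Y) (P : pred Y) (F : Y -> seq 'I_d -> Z) :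
  wsum n (fun I => \sum_(y <- r | P y) F y I) = \sum_(y <- r | P y) wsum n (F y).
Proof.
elim: n F => //= n IH F; rewrite exchange_big; apply: eq_bigr => i _.
exact: IH.
Qed.

Lemma wsum_cat n k F : wsum (n + k) F = wsum n (fun I => wsum k (fun J => F (I ++ J))).
Proof. by elim: n F => //= n IH F; apply: eq_bigr => i _; rewrite IH. Qed.

End WordSums.

Lemma wsum_morph (Z Z' : zmodType) (f : Z -> Z') n F : {morph f : x y / x + y} ->
  f (wsum n F) = wsum n (fun I => f (F I)).
Proof.
move=> fD; have f0 : f 0 = 0 by apply: (addrI (f 0)); rewrite -fD !addr0.
elim: n F => //= n IH F; rewrite (big_morph _ fD f0).
by apply: eq_bigr => i _; rewrite IH.
Qed.

Variables (B : pzRingType) (iota : W -> B) (lift : (W -> W) -> B -> B).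
Variables (D : B -> Prop) (Phi : W -> B) (u u' : 'I_d -> 'I_d -> B) (lamB : B).
Hypothesis iotaD : {morph iota : x y / x + y}.
Hypothesis iotaM : {morph iota : x y / x * y}.
Hypothesis iota1 : iota 1 = 1.
Hypothesis D1 : D 1.
Hypothesis DM : forall a b, D a -> D b -> D (a * b).
Hypothesis D_comm : forall a x, D a -> a * iota x = iota x * a.
Hypothesis lift_add : forall f, linear f -> {morph lift f : a b / a + b}.
Hypothesis lift_comp : forall f h b, linear f -> linear h ->
  lift (fun z => f (h z)) b = lift f (lift h b).
Hypothesis lift_mull : forall x b, lift (fun z => x * z) b = iota x * b.
Hypothesis lift_mulr : forall x b, lift (fun z => z * x) b = b * iota x.
Hypothesis lift_D : forall f a b, linear f -> D a ->
  lift f (a * b) = a * lift f b /\ lift f (b * a) = lift f b * a.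
Hypothesis lift_fun0 : forall b, lift (fun=> 0) b = 0.
Hypothesis lift_funD : forall f h b, linear f -> linear h ->
  lift (fun z => f z + h z) b = lift f b + lift h b.
Hypothesis PhiD : {morph Phi : x y / x + y}.
Hypothesis PhiM : {morph Phi : x y / x * y}.
Hypothesis Phi1 : Phi 1 = 1.
(** Expresses that [Phi] of a scalar has its W-part in Sigma, by means of the projection onto degree
    0. *)
Hypothesis Phi_scalar : forall q, lift (wcomp X 0) (Phi (sg q)) = Phi (sg q).
Hypothesis u_D : forall i j, D (u i j).
Hypothesis Phi_letter : forall i, Phi (th i) = \sum_j iota (th j) * u j i.
Hypothesis Phi_met : forall i j,
  Phi (sg (g i j)) = \sum_k \sum_l iota (sg (g k l)) * (u k i * u l j).
Hypothesis Phi_alg : forall c : C, Phi c%:A = iota c%:A.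
(** The matrix form of equivariance of f on V (x) V: the coefficient at theta_a (x) theta_b of f
    followed by the transformation, and of the transformation followed by f. *)
Definition commutes_braiding (f : tensor V V -> tensor V V) := forall i j a b,
  \sum_k \sum_l iota (entry theta f i j k l)%:A * (u a k * u b l) =
  \sum_k \sum_l iota (entry theta f k l a b)%:A * (u k i * u l j).
Hypothesis u_braid : commutes_braiding (braid M).
Hypothesis u_braidV : commutes_braiding (braidV M).
Hypothesis u'_inv : forall k k', \sum_i u' i k * u k' i = (k' == k)%:R.
Hypothesis Phi_vol : Phi w = iota w * lamB.
Hypothesis lam_D : D lamB.

Lemma iota0 : iota 0 = 0.
Proof. by apply: (addrI (iota 0)); rewrite -iotaD !addr0. Qed.
Lemma iotaZ (c : C) x : iota (c *: x) = iota c%:A * iota x.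
Proof. by rewrite -iotaM mulr_algl. Qed.
Lemma iota_sum (Y : Type) (r : seq Y) (P : pred Y) (F : Y -> W) :
  iota (\sum_(x <- r | P x) F x) = \sum_(x <- r | P x) iota (F x).
Proof. exact: (big_morph _ iotaD iota0). Qed.
Lemma Phi0 : Phi 0 = 0.
Proof. by apply: (addrI (Phi 0)); rewrite -PhiD !addr0. Qed.
Lemma Phi_sum (Y : Type) (r : seq Y) (P : pred Y) (F : Y -> W) :
  Phi (\sum_(x <- r | P x) F x) = \sum_(x <- r | P x) Phi (F x).
Proof. exact: (big_morph _ PhiD Phi0). Qed.
Lemma PhiZ (c : C) x : Phi (c *: x) = iota c%:A * Phi x.
Proof. by rewrite -[c *: x]mulr_algl PhiM Phi_alg. Qed.
Lemma iota_algC (c : C) x : iota c%:A * iota x = iota x * iota c%:A.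
Proof. by rewrite -!iotaM mulr_algl mulr_algr. Qed.
Lemma lift_funsum (Y : Type) (r : seq Y) (P : pred Y) (F : Y -> W -> W) b :
  (forall y, linear (F y)) -> lift (fun z => \sum_(y <- r | P y) F y z) b = \sum_(y <- r | P y) lift (F y) b.
Proof.
move=> FL; elim: r => [|y r IH].
  by rewrite big_nil -(lift_fun0 b); congr (lift _ b); apply/funext => z; rewrite big_nil.
rewrite big_cons -IH; case Py: (P y).
  rewrite -lift_funD //.
    by congr (lift _ b); apply/funext => z; rewrite big_cons Py.
  move=> c x y'; rewrite scaler_sumr -big_split /=.
  by apply: eq_bigr => i _; rewrite FL.
by congr (lift _ b); apply/funext => z; rewrite big_cons Py.
Qed.

Lemma lift0 f : linear f -> lift f 0 = 0.
Proof. by move=> fL; apply: (addrI (lift f 0)); rewrite -lift_add // !addr0. Qed.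

(** * Equivariant functions of words *)

Fixpoint uw (J I : seq 'I_d) : B := match J, I with
  | j :: J1, i :: I1 => u j i * uw J1 I1
  | [::], [::] => 1
  | _, _ => 0
  end.

Lemma uw_D I' I : size I' = size I -> D (uw I' I).
Proof.
elim: I' I => [|i' I' IH] [|i I] //= [hI].
by apply: DM; [exact: u_D|exact: IH].
Qed.

Lemma uw_cat I' J' I J : size I' = size I ->
  uw (I' ++ J') (I ++ J) = uw I' I * uw J' J.
Proof.
elim: I' I => [|i' I' IH] [|i I] // hI; first by rewrite /= mul1r.
by case: hI => hI; rewrite /= IH // mulrA.
Qed.

(** F stands for a complex linear map from the n-th tensor power of V to W, given on words; the
    condition says that it intertwines the tensor power of [u] with [Phi]. *)
Definition covariant n (F : seq 'I_d -> W) := forall I, size I = n ->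
  Phi (F I) = wsum n (fun I' => iota (F I') * uw I' I).

Lemma eq_covariant n F H : (forall I, size I = n -> F I = H I) ->
  covariant n F -> covariant n H.
Proof.
move=> FH hF I hI; rewrite -FH // hF //.
by apply: eq_wsum => J hJ; rewrite FH.
Qed.

Lemma covariantM n k F H : covariant n F -> covariant k H ->
  covariant (n + k) (fun I => F (take n I) * H (drop n I)).
Proof.
move=> hF hH I hI; have hT : size (take n I) = n by rewrite size_takel // hI leq_addr.
have hR : size (drop n I) = k by rewrite size_drop hI addKn.
rewrite /= PhiM (hF _ hT) (hH _ hR) wsum_cat.
rewrite (wsum_morph (f := fun x => x * _)) => [|x y]; last exact: mulrDl.
apply: eq_wsum => I' hI'; rewrite (wsum_morph (f := *%R _)) => [|x y]; last exact: mulrDr.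
apply: eq_wsum => J' hJ'; rewrite take_size_cat // drop_size_cat //.
rewrite -{3}(cat_take_drop n I) uw_cat ?hT ?hI' // iotaM !mulrA; congr (_ * _).
by rewrite -!mulrA D_comm //; apply: uw_D; rewrite hT.
Qed.

Lemma covariant_word n : covariant n wordW.
Proof.
elim: n => [|n IH] I; first by move/size0nil => -> /=; rewrite wordW0 Phi1 iota1 mulr1.
case: I => // i I [hI]; rewrite wordW_cons PhiM Phi_letter IH // mulr_suml /=.
apply: eq_bigr => j _; rewrite (wsum_morph (f := *%R _)) => [|x y]; last exact: mulrDr.
apply: eq_wsum => I' _; rewrite (wordW_cons j I') iotaM -!mulrA; congr (_ * _).
by rewrite !mulrA D_comm.
Qed.

Lemma covariant_sum n (Y : Type) (r : seq Y) (P : pred Y) (F : Y -> seq 'I_d -> W) :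
  (forall y, P y -> covariant n (F y)) ->
  covariant n (fun I => \sum_(y <- r | P y) F y I).
Proof.
move=> hF I hI /=; rewrite Phi_sum.
under eq_bigr => y Py do rewrite hF //.
rewrite -wsum_sum; apply: eq_wsum => I' _.
by rewrite iota_sum mulr_suml.
Qed.

Lemma covariantZ n (c : C) F : covariant n F -> covariant n (fun I => c *: F I).
Proof.
move=> hF I hI /=; rewrite PhiZ hF // (wsum_morph (f := *%R _)) => [|x y]; last exact: mulrDr.
by apply: eq_wsum => I' _; rewrite iotaZ mulrA.
Qed.

(** The counterpart of [lext] for values in W, where Sigma acts through [scalarW] instead of a
    module structure. *)
Definition extW (F : seq 'I_d -> W) : T -> W :=
  msum (fun q I => sg q * F I).

Lemma extWD F : {morph extW F : s t / s + t}.
Proof. by apply: msumD => I p q; rewrite sgD mulrDl. Qed.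

Lemma extW0 F : extW F 0 = 0.
Proof. by apply: (addrI (extW F 0)); rewrite -extWD !addr0. Qed.

Lemma extW_sum F (Y : Type) (r : seq Y) (P : pred Y) (H : Y -> T) :
  extW F (\sum_(x <- r | P x) H x) = \sum_(x <- r | P x) extW F (H x).
Proof. exact: (big_morph _ (extWD F) (extW0 F)). Qed.

Lemma extWU F q I : extW F (q *: << I >>) = sg q * F I.
Proof. by apply: msumU => J p r; rewrite sgD mulrDl. Qed.

Lemma extW_word F I : extW F << I >> = F I.
Proof. by rewrite -[<< I >>]scale1r extWU sg1 mul1r. Qed.

Lemma extWZ F q t : extW F (q *: t) = sg q * extW F t.
Proof.
move: t; apply: malg_ext => [s t|s t|r I].
- by rewrite scalerDr extWD.
- by rewrite extWD mulrDr.
by rewrite scalerA !extWU sgM mulrA.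
Qed.

Lemma extWC F (c : C) t : extW F (c%:A *: t) = c *: extW F t.
Proof. by rewrite extWZ sg_alg mulr_algl. Qed.

Lemma extW_op F f p t :
  extW F (op_at theta f p t) = extW (fun I => extW F (op_at theta f p << I >>)) t.
Proof.
move: t; apply: malg_ext => [s t|s t|q I].
- by rewrite (linD (op_at_linear _ _ _)) extWD.
- exact: extWD.
by rewrite (linZ (op_at_linear _ _ _)) extWZ extWU.
Qed.

(** Equivariant maps compose. A word splits around the places p and p + 1 as [I ++ i :: j :: K]; the
    coefficients of I and K commute with W, so the sums can be rearranged until [uf] applies to the
    two middle letters. *)
Lemma covariant_op n F f p : commutes_braiding f -> covariant n F ->
  covariant n (fun I => extW F (op_at theta f p << I >>)).
Proof.
move=> uf hF; have [np|pn] := leqP n p.+1.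
  apply: eq_covariant hF => I hI; rewrite op_at_size ?hI //.
  by rewrite extW_word.
have [r nE] : exists r, n = (p + r.+2)%N by exists (n - p - 2)%N; lia.
have opE I i j K : size I = p -> extW F (op_at theta f p << I ++ i :: j :: K >>) =
    \sum_k \sum_l entry theta f i j k l *: F (I ++ k :: l :: K).
  move=> hI; rewrite op_atE // extW_sum; apply: eq_bigr => k _.
  by rewrite extW_sum; apply: eq_bigr => l _; rewrite extWC extW_word.
move=> L hL; have pL : (p.+1 < size L)%N by rewrite hL.
have [I [i [j [K [hI LE]]]]] := word_split pL.
have hK : size K = r by move: hL; rewrite LE size_cat /= hI nE; lia.
rewrite LE opE // Phi_sum.
(* The part of [Phi (F (I ++ k :: l :: K))] that comes from words with the letters a, b at the two
   places. *)
pose S a b k l := wsum p (fun I' => wsum r (fun K' =>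
  iota (F (I' ++ a :: b :: K')) * (uw I' I * (u a k * u b l) * uw K' K))).
have PhiF k l : Phi (F (I ++ k :: l :: K)) = \sum_a \sum_b S a b k l.
  rewrite hF ?size_cat /= ?hI ?hK // nE wsum_cat /=.
  under eq_wsum => I' _ do rewrite /=.
  rewrite wsum_sum; apply: eq_bigr => a _; rewrite wsum_sum; apply: eq_bigr => b _.
  apply: eq_wsum => I' hI'; apply: eq_wsum => K' hK'.
  by rewrite uw_cat ?hI' ?hI //= !mulrA.
have scalS (c : C) a b k l : iota c%:A * S a b k l = wsum p (fun I' => wsum r (fun K' =>
  iota (F (I' ++ a :: b :: K')) * (uw I' I * (iota c%:A * (u a k * u b l)) * uw K' K))).
  rewrite /S (wsum_morph (f := *%R _)) => [|x y]; last exact: mulrDr.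
  apply: eq_wsum => I' hI'; rewrite (wsum_morph (f := *%R _)) => [|x y]; last exact: mulrDr.
  apply: eq_wsum => K' hK'; rewrite mulrA iota_algC -!mulrA; congr (_ * _).
  by rewrite !mulrA D_comm //; apply: uw_D; rewrite hI' hI.
transitivity (\sum_a \sum_b \sum_k \sum_l iota (entry theta f i j k l)%:A * S a b k l).
  under eq_bigr => k _ do rewrite Phi_sum.
  under eq_bigr => k _ do under eq_bigr => l _ do rewrite PhiZ PhiF mulr_sumr.
  under eq_bigr => k _ do rewrite exchange_big.
  rewrite exchange_big; apply: eq_bigr => a _.
  under eq_bigr => k _ do under eq_bigr => l _ do rewrite mulr_sumr.
  under eq_bigr => k _ do rewrite exchange_big.
  by rewrite exchange_big.
rewrite nE wsum_cat /=.
transitivity (\sum_a \sum_b wsum p (fun I' => wsum r (fun K' =>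
    iota (F (I' ++ a :: b :: K')) * (uw I' I * (\sum_k \sum_l
      iota (entry theta f k l a b)%:A * (u k i * u l j)) * uw K' K)))).
  apply: eq_bigr => a _; apply: eq_bigr => b _.
  under eq_bigr => k _ do under eq_bigr => l _ do rewrite scalS.
  under eq_bigr => k _ do rewrite -wsum_sum.
  rewrite -wsum_sum; apply: eq_wsum => I' _.
  under eq_bigr => k _ do rewrite -wsum_sum.
  rewrite -wsum_sum; apply: eq_wsum => K' _.
  rewrite -uf mulr_sumr mulr_suml mulr_sumr; apply: eq_bigr => k _.
  by rewrite mulr_sumr mulr_suml mulr_sumr.
under [LHS]eq_bigr => a _ do rewrite -wsum_sum.
rewrite -wsum_sum; apply: eq_wsum => I' hI'.
under [LHS]eq_bigr => a _ do rewrite -wsum_sum.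
rewrite -wsum_sum.
under [RHS]eq_bigr => k _ do rewrite -wsum_sum.
rewrite -wsum_sum; apply: eq_wsum => K' hK'.
under [RHS]eq_bigr => k _ do under eq_bigr => l _ do
  rewrite opE // iota_sum mulr_suml.
under [RHS]eq_bigr => k _ do rewrite exchange_big.
rewrite [RHS]exchange_big; apply: eq_bigr => a _.
under [RHS]eq_bigr => k _ do under eq_bigr => l _ do rewrite iota_sum mulr_suml.
under [RHS]eq_bigr => k _ do rewrite exchange_big.
rewrite [RHS]exchange_big; apply: eq_bigr => b _.
rewrite mulr_sumr mulr_suml mulr_sumr; apply: eq_bigr => k _.
rewrite mulr_sumr mulr_suml mulr_sumr; apply: eq_bigr => l _.
rewrite uw_cat ?hI' ?hI //= iotaZ !mulrA; congr (_ * _ * _ * _).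
rewrite iota_algC -!mulrA; congr (_ * _).
by rewrite D_comm //; apply: uw_D; rewrite hI' hI.
Qed.

Lemma covariant_op_word n F ws : covariant n F ->
  covariant n (fun I => extW F (op_word theta (braid M) ws << I >>)).
Proof.
elim: ws F => [|p ws IH] F hF.
  by apply: eq_covariant hF => I _; rewrite extW_word.
apply: eq_covariant (IH _ (covariant_op p u_braid hF)) => I _.
exact: esym (extW_op _ _ _ _).
Qed.

(** On complex tensors this is multiplication by the word on the left; it leaves scalars in place
    instead of moving them through the word by [mu]. *)
Definition prefix_word I : T -> T := lext (fun J => << I ++ J >>).

Lemma prefix_word_linear I : linear (prefix_word I). Proof. exact: lext_linear. Qed.
Lemma prefix_wordE I J : prefix_word I << J >> = << I ++ J >>.
Proof. exact: lextE. Qed.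

Lemma op_at_prefix f p I t :
  op_at theta f (size I + p) (prefix_word I t) = prefix_word I (op_at theta f p t).
Proof.
move: t; apply: malg_linear_ext => [q s t|q s t|J].
- by rewrite (prefix_word_linear I q) (op_at_linear _ _ _ q).
- by rewrite (op_at_linear _ _ _ q) (prefix_word_linear I q).
rewrite prefix_wordE; have [h|h] := leqP (size J) p.+1.
  rewrite [in RHS]op_at_size // prefix_wordE op_at_size //.
  by rewrite size_cat -addnS leq_add2l.
have [K [i [j [L [hK ->]]]]] := word_split h.
rewrite op_atE // catA op_atE; last by rewrite size_cat hK.
rewrite (lin_sum (prefix_word_linear I)); apply: eq_bigr => k _.
rewrite (lin_sum (prefix_word_linear I)); apply: eq_bigr => l _.
by rewrite (linZ (prefix_word_linear I)) prefix_wordE catA.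
Qed.

Lemma op_word_prefix ws I t :
  op_word theta (braid M) [seq size I + p | p <- ws] (prefix_word I t) =
  prefix_word I (op_word theta (braid M) ws t).
Proof.
elim: ws => //= p ws IH.
by rewrite -op_at_prefix -[in RHS]IH.
Qed.

(** * Covariance of the form *)

Local Notation met_words I J := (metT M << I >> << J >>).

Definition met_split n L : W := sg (met_words (take n L) (drop n L)).

Lemma metT_word I t :
  metT M << I >> t = (foldr (contract theta (mu M) (met M)) t I)@_[::].
Proof. by rewrite /metT tensor_metE contracts_word. Qed.

Lemma metT_scalarl q s t : metT M (q *: s) t = q * metT M s t.
Proof. exact: tensor_metZl. Qed.

Lemma metT_addl t : {morph (metT M)^~ t : s s' / s + s'}.
Proof. exact: tensor_metDl. Qed.

Lemma metT_add s : {morph metT M s : t t' / t + t'}.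
Proof. by apply: tensor_metDr; exact: muD. Qed.

Lemma metTC s (c : C) t : metT M s (c%:A *: t) = c *: metT M s t.
Proof. by apply: tensor_metCr; [exact: muD|exact: mu1|exact: muM]. Qed.

Lemma met_splitE n I t k : size I = n -> cspan k t ->
  sg (metT M << I >> t) = extW (met_split n) (prefix_word I t).
Proof.
move=> hI; move: t; apply: cspan_ind => [|t t' ht ht'|c J _].
- have := metTC << I >> 0 0; rewrite !scale0r => ->.
  by rewrite (lin0 (prefix_word_linear I)) extW0 sg0.
- by rewrite metT_add sgD ht ht' (linD (prefix_word_linear I)) extWD.
rewrite metTC (linZ sg_linear) (linZ (prefix_word_linear I)) extWC prefix_wordE.
by rewrite extW_word /met_split take_size_cat // drop_size_cat.
Qed.

Lemma asig_word n I : size I = n -> asig M << I >> =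
  \sum_(s : 'S_n) ((-1) ^+ perm_length s : C)%:A *:
     op_word theta (braid M) (some_reduced_word s) << I >>.
Proof.
move=> <-; rewrite [LHS]antisymE; apply: eq_bigr => s _; congr (_ *: _).
by rewrite -[in RHS]signr_odd -signr_odd; case: (odd _);
  rewrite ?expr1 ?expr0 ?scaleN1r ?scale1r.
Qed.

(** Antisymmetrizing the second argument is a signed sum of braid words acting on the last n
    letters, that is, of braid words shifted by n, and these preserve covariance. For n different
    from k both sides vanish. *)
Lemma covariant_form n k : covariant (n + n) (met_split n) ->
  covariant (n + k) (fun L => sg (wm (wordW (take n L)) (wordW (drop n L)))).
Proof.
move=> hG; have [<-|nk] := eqVneq n k; last first.
  have F0 L : size L = (n + k)%N -> wm (wordW (take n L)) (wordW (drop n L)) = 0.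
    move=> hL; have h I : wdeg X (size I) (wordW I) by apply/cdeg_wdeg/cdeg_word.
    apply: (wm_degree (h _) (h _)).
    by rewrite size_takel ?hL ?leq_addr // size_drop hL addKn.
  move=> L hL; rewrite F0 // sg0 Phi0 wsum0 // => L' hL'.
  by rewrite F0 // sg0 iota0 mul0r.
have h1 (s : 'S_n) := covariantZ ((-1) ^+ perm_length s)
  (covariant_op_word [seq n + p | p <- some_reduced_word s] hG).
have := @covariant_sum (n + n) _ (index_enum _) xpredT _ (fun s _ => h1 s).
apply: eq_covariant => L hL.
have hT : size (take n L) = n by rewrite size_takel // hL leq_addr.
have hR : size (drop n L) = n by rewrite size_drop hL addKn.
rewrite !wordWE wmetE (asig_word hR).
have sumE (F : 'S_n -> T) (z : T) : metT M z (\sum_s F s) = \sum_s metT M z (F s).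
  apply: (big_morph _ (metT_add z)).
  by have := metTC z 0 0; rewrite !scale0r.
rewrite sumE (lin_sum sg_linear); apply: eq_bigr => s _.
rewrite metTC (linZ sg_linear); congr (_ *: _).
rewrite (@met_splitE n (take n L) _ n) //; last by apply/cspan_op_word/cspanU.
by rewrite -op_word_prefix hT prefix_wordE cat_take_drop.
Qed.

(* The pairing of [theta_I g(a, b) theta_K] with [theta_J], as a function of  *)
(* the word [I ++ a :: b :: K ++ J] with [I] of size [r] and [K] of size [s]. *)
Definition met_moved r s L : W :=
  if drop r L is a :: b :: L' then
    sg (metT M (mulT M << take r L >> (g a b *: << take s L' >>)) << drop s L' >>)
  else 0.

Lemma met_movedE r s I a b K J : size I = r -> size K = s ->
  met_moved r s (I ++ a :: b :: K ++ J) =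
  sg (metT M (mulT M << I >> (g a b *: << K >>)) << J >>).
Proof.
move=> hI hK; rewrite /met_moved drop_size_cat // take_size_cat //.
by rewrite take_size_cat // drop_size_cat.
Qed.

Lemma mulT_word_sum I (Y : Type) (r : seq Y) (P : pred Y) (F : Y -> T) :
  mulT M << I >> (\sum_(y <- r | P y) F y) = \sum_(y <- r | P y) mulT M << I >> (F y).
Proof.
have hD : {morph mulT M << I >> : t t' / t + t'}.
  by apply: tensor_mulDr; exact: muD.
by apply: (big_morph _ hD); apply: (addrI (mulT M << I >> 0)); rewrite -hD !addr0.
Qed.

Lemma mulT_wordC I (c : C) t : mulT M << I >> (c%:A *: t) = c%:A *: mulT M << I >> t.
Proof.
rewrite /mulT !tensor_mulE; elim: I => //= i I ->.
by apply: letter_mulC; [exact: muD|exact: mu1|exact: muM].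
Qed.

Lemma metT_suml (Y : Type) (r : seq Y) (P : pred Y) (F : Y -> T) t :
  metT M (\sum_(y <- r | P y) F y) t = \sum_(y <- r | P y) metT M (F y) t.
Proof.
apply: (big_morph _ (metT_addl t)).
by apply: (addrI (metT M 0 t)); rewrite -metT_addl !addr0.
Qed.

(** The scalar moves left past one letter i, at the cost of sigma^-1 at the place r and sigma at r +
    1. Read as a statement on functions of words, this is precomposition with two braidings, the
    shape that [covariant_op] accepts. *)
Lemma met_moved_step r s L : (r.+3 + s <= size L)%N ->
  met_moved r.+1 s L = extW (fun L1 =>
    extW (met_moved r s.+1) (op_at theta (braid M) r.+1 << L1 >>))
    (op_at theta (braidV M) r << L >>).
Proof.
move=> hL; pose I := take r L.
have hI : size I = r by rewrite size_takel //; lia.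
have [i [a [b [L' LE]]]] : exists i a b L', L = I ++ i :: a :: b :: L'.
  have : (2 < size (drop r L))%N by rewrite size_drop; lia.
  rewrite -{2}(cat_take_drop r L) -/I.
  by case: (drop r L) => [|i [|a [|b L']]] // _; exists i, a, b, L'.
have hL' : (s <= size L')%N.
  by move: hL; rewrite LE size_cat /= hI; lia.
have hK : size (take s L') = s by rewrite size_takel.
rewrite LE op_atE // extW_sum.
have -> : I ++ i :: a :: b :: L' = (I ++ [:: i]) ++ a :: b :: take s L' ++ drop s L'.
  by rewrite cat_take_drop -catA.
rewrite met_movedE //; last by rewrite size_cat hI addn1.
rewrite /mulT tensor_mulE foldr_cat /= (letter_mulU (muD M)) -tensor_mulE -/(mulT M _ _).
under [X in metT M (mulT M _ X) _]eq_bigr => l _ do rewrite mu_entry scaler_suml.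
rewrite [X in metT M (mulT M _ X) _]exchange_big mulT_word_sum metT_suml (lin_sum sg_linear).
apply: eq_bigr => a' _; rewrite extW_sum.
under [X in metT M (mulT M _ X) _]eq_bigr => l _ do rewrite scaler_suml.
rewrite [X in metT M (mulT M _ X) _]exchange_big mulT_word_sum metT_suml (lin_sum sg_linear).
apply: eq_bigr => b' _; rewrite extWC extW_word.
have -> : I ++ a' :: b' :: b :: L' = (I ++ [:: a']) ++ b' :: b :: L' by rewrite -catA.
rewrite op_atE; last by rewrite size_cat hI addn1.
rewrite extW_sum scaler_sumr.
under [X in metT M (mulT M _ X) _]eq_bigr => l _ do rewrite scaler_suml.
rewrite [X in metT M (mulT M _ X) _]exchange_big mulT_word_sum metT_suml (lin_sum sg_linear).
apply: eq_bigr => c _; rewrite extW_sum scaler_sumr.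
rewrite mulT_word_sum metT_suml (lin_sum sg_linear); apply: eq_bigr => l _.
rewrite extWC extW_word.
have -> : (I ++ [:: a']) ++ c :: l :: L' =
    I ++ a' :: c :: (l :: take s L') ++ drop s L' by rewrite -catA /= cat_take_drop.
rewrite met_movedE //=; last by rewrite hK.
have -> (b0 : C) q (t : T) : (b0 *: q) *: t = b0%:A *: (q *: t).
  by rewrite scalerA mulr_algl.
by rewrite mulT_wordC metT_scalarl mulr_algl (linZ sg_linear) scalerA.
Qed.

Lemma metT_balanced s q t : metT M (mulT M s (of_scalar d q)) t = metT M s (q *: t).
Proof. exact: (tensor_met_balanced _ (muD M) (muM M)). Qed.

(** Induction on the number of contractions: the innermost one gives g(theta_I a, b theta_J) =
    g(theta_I g(a, b), theta_J), and with g(a, b) in front the form splits into two factors already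
    known to be covariant. *)
Lemma covariant_met n : covariant (n + n) (met_split n).
Proof.
elim: n => [|n IH].
  move=> I /size0nil -> /=; rewrite /met_split /= mulr1.
  have -> : met_words [::] [::] = 1.
    by rewrite metT_word /= mcoeffU eqxx.
  by rewrite sg1 Phi1 iota1.
(* The scalar at the far left, where it factors out by left linearity. *)
have base : covariant (2 + (n + n)) (met_moved 0 n).
  have h2 : covariant 2 (fun I => if I is [:: i; j] then sg (g i j) else 0).
    move=> [|i [|j [|//]]] // _; rewrite Phi_met /=.
    by apply: eq_bigr => k _; apply: eq_bigr => l _; rewrite mulr1.
  apply: eq_covariant (covariantM h2 IH) => -[|a [|b L]] // _.
  rewrite /= drop0 /met_split /met_moved /=.
  have -> t : mulT M << [::] >> t = t by rewrite /mulT tensor_mulE.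
  by rewrite take0 metT_scalarl sgM.
(* The scalar is carried back to the right, one letter of I at a time, until at r = n it stands
   where the contraction creates it. *)
have moved r : (r <= n)%N -> covariant (2 + (n + n)) (met_moved r (n - r)).
  elim: r => [_|r IHr rn]; first by rewrite subn0.
  have h := covariant_op r u_braidV (covariant_op r.+1 u_braid (IHr (ltnW rn))).
  apply: eq_covariant h => L hL; rewrite met_moved_step ?subnSK //.
  by rewrite hL; lia.
have := moved n (leqnn n); rewrite subnn (_ : 2 + (n + n) = n.+1 + n.+1)%N; last by lia.
apply: eq_covariant => L hL.
have hI : size (take n L) = n by rewrite size_takel //; lia.
have [a [b [J LE]]] : exists a b J, L = take n L ++ a :: b :: J.
  have : (1 < size (drop n L))%N by rewrite size_drop; lia.
  rewrite -{2}(cat_take_drop n L).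
  by case: (drop n L) => [|a [|b J]] // _; exists a, b, J.
move: (take n L) hI LE => I hI ->.
rewrite -[a :: b :: J]/(a :: b :: [::] ++ J) met_movedE //=.
rewrite /met_split -cat_rcons take_size_cat ?size_rcons ?hI // drop_size_cat ?size_rcons ?hI //.
congr (sg _).
have -> : g a b *: << [::] >> = of_scalar d (g a b) by rewrite /of_scalar malgZU.
rewrite metT_balanced !metT_word -cats1 foldr_cat /=.
by rewrite (contract_word _ (muD M) (mu1 M)).
Qed.

(** * From words to the whole exterior algebra *)

Lemma comp_linear k : linear (wcomp X k).
Proof.
move=> c x x'; have [s <-] := pr_surj X x; have [t <-] := pr_surj X x'.
rewrite -prC -pr_add !wcompE [degree_part _ _](lext_linear _ c%:A s t).
by rewrite pr_add prC.
Qed.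

Lemma comp_degree0 z : wdeg X 0 (wcomp X 0 z).
Proof.
have [t <-] := pr_surj X z; rewrite wcompE; exists (degree_part 0 t) => //.
exact: degree_part_is_homog.
Qed.

Lemma mull_linear x : linear (fun z : W => x * z).
Proof. by move=> c z z'; rewrite mulrDr scalerAr. Qed.

Lemma mulr_linear x : linear (fun z : W => z * x).
Proof. by move=> c z z'; rewrite mulrDl scalerAl. Qed.

(** Extends [covariant_form] to arbitrary second arguments. For a word times q, right linearity of
    the form takes q out, and [Phi] of q can be taken out of [lift] in the same way because it is
    scalar. *)
Lemma form_covariant I y : Phi (sg (wm (wordW I) y)) = wsum (size I)
  (fun J => uw J I * lift (fun z => sg (wm (wordW J) z)) (Phi y)).
Proof.
have gL J : linear (fun z => sg (wm (wordW J) z)).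
  by move=> c z z'; rewrite (wm_linearr _ c) sg_linear.
move: y; apply: W_rext => [y y'|y y'|K q].
- by rewrite wm_addr sgD PhiD.
- rewrite -wsum_add; apply: eq_wsum => J _.
  by rewrite PhiD lift_add // mulrDr.
have cov := @covariant_form (size I) (size K) (@covariant_met (size I)) (I ++ K).
rewrite size_cat take_size_cat // drop_size_cat // in cov.
rewrite wm_scalarr sgM PhiM cov // wsum_cat.
rewrite (wsum_morph (f := fun x => x * _)) => [|x y]; last exact: mulrDl.
apply: eq_wsum => J hJ; rewrite PhiM (@covariant_word (size K) K erefl).
rewrite [in RHS](wsum_morph (f := fun x => x * Phi (sg q))) => [|x y]; last exact: mulrDl.
rewrite [in RHS](wsum_morph (f := lift _)); last exact: lift_add.
rewrite [in RHS](wsum_morph (f := *%R _)) => [|x y]; last exact: mulrDr.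
rewrite (wsum_morph (f := fun x => x * _)) => [|x y]; last exact: mulrDl.
apply: eq_wsum => L hL; rewrite take_size_cat // drop_size_cat // uw_cat //.
have DJ : D (uw J I) by exact: uw_D.
have DL : D (uw L K) by exact: uw_D.
(* The projection onto degree 0 is inserted by [Phi_scalar]; on its image the form is right linear,
   and the two linear maps under [lift] agree. *)
have step : lift (fun z => sg (wm (wordW J) z)) (iota (wordW L) * Phi (sg q)) =
    iota (sg (wm (wordW J) (wordW L))) * Phi (sg q).
  have c0L := comp_linear 0.
  have cL x : linear (fun z => x * wcomp X 0 z).
    by move=> c z z'; rewrite c0L (mull_linear _ c).
  have liftE x : lift (fun z => x * wcomp X 0 z) (Phi (sg q)) = iota x * Phi (sg q).
    by rewrite (lift_comp _ (mull_linear x) c0L) Phi_scalar lift_mull.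
  rewrite -!liftE -(lift_comp _ (gL J) (cL _)).
  congr (lift _ _); apply/funext => z.
  move: (wcomp X 0 z) (comp_degree0 z).
  apply: wdeg_ind => [|z1 z2 h1 h2|q' N /size0nil ->].
  + by rewrite !mulr0 (lin0 (wm_linearr _)) sg0.
  + by rewrite !mulrDr wm_addr sgD h1 h2.
  by rewrite wordW0 mulr1 wm_scalarr sgM.
have -> : iota (wordW L) * uw L K * Phi (sg q) =
    uw L K * (iota (wordW L) * Phi (sg q)) by rewrite -D_comm // mulrA.
by rewrite (lift_D _ (gL J) DL).1 step -(D_comm _ (DM DJ DL)) !mulrA.
Qed.

Lemma comp_covariant x : lift cm (Phi x) = Phi (cm x).
Proof.
have cmL := comp_linear m; have c0L := comp_linear 0.
move: x; apply: W_ext => [x y|x y|q I].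
- by rewrite PhiD lift_add.
- by rewrite comp_add PhiD.
rewrite (comp_degree (wdeg_word q I)) PhiM (@covariant_word (size I) I erefl).
rewrite (wsum_morph (f := *%R _)) => [|x y]; last exact: mulrDr.
rewrite (wsum_morph (f := lift cm)); last exact: lift_add.
have step J : size J = size I -> lift cm (Phi (sg q) * (iota (wordW J) * uw J I)) =
    if size I == m then Phi (sg q) * (iota (wordW J) * uw J I) else 0.
  move=> hJ; rewrite mulrA (lift_D _ cmL (uw_D hJ)).2.
  have rL : linear (fun z => wcomp X 0 z * wordW J).
    by move=> c z z'; rewrite c0L (mulr_linear _ c).
  have -> : Phi (sg q) * iota (wordW J) =
      lift (fun z => wcomp X 0 z * wordW J) (Phi (sg q)).
    by rewrite (lift_comp _ (mulr_linear _) c0L) Phi_scalar lift_mulr.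
  rewrite -(lift_comp _ cmL rL).
  have cmE z : cm (wcomp X 0 z * wordW J) =
      if size I == m then wcomp X 0 z * wordW J else 0.
    by apply: comp_degree; rewrite -hJ -[size J]add0n; apply: wdegM;
      [exact: comp_degree0|exact/cdeg_wdeg/cdeg_word].
  case: ifP cmE => _ cmE.
    by congr (lift _ _ * _); apply/funext.
  rewrite (_ : (fun _ => _) = fun=> 0) ?lift_fun0 ?mul0r //.
  exact/funext.
rewrite (eq_wsum (H := fun J => if size I == m then
  Phi (sg q) * (iota (wordW J) * uw J I) else 0)) //.
case: ifP => _; last by rewrite Phi0 wsum0.
rewrite PhiM (@covariant_word (size I) I erefl).
by rewrite [RHS](wsum_morph (f := *%R _)) // => x y; exact: mulrDr.
Qed.

(** The matrix [uw] can be cancelled because [u] can: multiplying by [u'] and summing isolates the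
    first letter, and induction treats the rest of the word. *)
Lemma wsum_inverse n (b : seq 'I_d -> B) :
  (forall I, size I = n -> wsum n (fun J => uw J I * b J) = 0) ->
  forall I, size I = n -> b I = 0.
Proof.
elim: n b => [|n IH] b hb.
  by move=> I /size0nil ->; have := hb [::] erefl; rewrite /= mul1r.
move=> [//|k K] [hK]; apply: (IH (fun K' => b (k :: K'))) hK => {}K hK.
pose c k' := wsum n (fun J => uw J K * b (k' :: J)).
have hc i : \sum_k' u k' i * c k' = 0.
  transitivity (wsum n.+1 (fun J => uw J (i :: K) * b J)); last first.
    by apply: hb; rewrite /= hK.
  apply: eq_bigr => k' _.
  rewrite (wsum_morph (f := *%R _)) => [|x y]; last exact: mulrDr.
  by apply: eq_wsum => J _; rewrite mulrA.
transitivity (\sum_k' (k' == k)%:R * c k').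
  rewrite (bigD1 k) //= eqxx mul1r big1 ?addr0 // => k' /negPf ->.
  by rewrite mul0r.
under eq_bigr => k' _ do rewrite -u'_inv mulr_suml.
rewrite exchange_big; apply: big1 => i _ /=.
under eq_bigr => k' _ do rewrite -mulrA.
by rewrite -mulr_sumr hc mulr0.
Qed.

(** Applying [Phi] to j(x, star y) w = g(x, y) w for words x shows that both sides have the same
    pairings up to the matrix [uw], which [wsum_inverse] removes. The factor [lamB] enters with
    [Phi] of w. *)
Lemma hodge_covariant y : Phi (hodge y) = lift hodge (Phi y) * lamB.
Proof.
have cmL := comp_linear m; have hL := hodge_linear.
have gL J : linear (fun z => sg (wm (wordW J) z)).
  by move=> c z z'; rewrite (wm_linearr _ c) sg_linear.
apply/eqP; rewrite -subr_eq0; apply/eqP; set Z := _ - _.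
have ZE I : lift cm (iota (wordW I) * Z) = 0.
  have [n hI] : exists n, size I = n by exists (size I).
  move: I hI; apply: wsum_inverse => I hI.
  have cmE x : cm (x * hodge y) = sg (wm x y) * w by rewrite -top_coefE hodgeP.
  have PE : lift cm (Phi (wordW I) * Phi (hodge y)) =
      Phi (sg (wm (wordW I) y)) * (iota w * lamB).
    by rewrite -PhiM comp_covariant cmE PhiM Phi_vol.
  have IE J : lift cm (iota (wordW J) * (lift hodge (Phi y) * lamB)) =
      lift (fun z => sg (wm (wordW J) z)) (Phi y) * (iota w * lamB).
    rewrite mulrA (lift_D _ cmL lam_D).2 mulrA; congr (_ * _).
    rewrite -lift_mull -(lift_comp _ (mull_linear _) hL).
    rewrite -lift_mulr -(lift_comp _ (mulr_linear _) (gL J)) -lift_comp //.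
      by congr (lift _ _); apply/funext => z; rewrite -top_coefE hodgeP.
    by move=> c z z'; rewrite hL (mull_linear _ c).
  have sE (b : B) : lift cm (Phi (wordW I) * b) =
      wsum n (fun J => uw J I * lift cm (iota (wordW J) * b)).
    rewrite (covariant_word hI) (wsum_morph (f := fun x => x * b)) => [|x z]; last exact: mulrDl.
    rewrite (wsum_morph (f := lift cm)); last exact: lift_add.
    apply: eq_wsum => J hJ; have DJ : D (uw J I) by apply: uw_D; rewrite hI.
    by rewrite -D_comm // -mulrA (lift_D _ cmL DJ).1.
  have lB : {morph lift cm : a b / a - b}.
    move=> a b; apply/eqP; rewrite eq_sym subr_eq; apply/eqP.
    by rewrite -lift_add // subrK.
  rewrite -sE /Z mulrBr lB PE sE; apply/eqP; rewrite subr_eq0; apply/eqP.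
  rewrite form_covariant hI (wsum_morph (f := fun x => x * _)) => [|x z]; last exact: mulrDl.
  by apply: eq_wsum => J _; rewrite IE -[LHS]mulrA.
have cm_idem z : cm (cm z) = cm z.
  rewrite -(top_coefE z) comp_scalarl; congr (_ * _).
  by have /vdegE/cdeg_wdeg hw := vol_deg v; rewrite (comp_degree hw) eqxx.
pose F I z := fr I * sg (twistV v (top_coef z)).
have FL I : linear (F I).
  by move=> c z z'; rewrite /F top_linear (twistV_linear c) sg_linear mulrDr scalerAr.
have -> : Z = lift (fun z => 1 * z) Z by rewrite lift_mull iota1 mul1r.
(* [hodge_recover] read as a decomposition of the identity operator, each term of which factors
   through a pairing with a word; under [lift] all of them annihilate [Z] by [ZE]. *)
have -> : (fun z : W => 1 * z) = fun z => \sum_(k < m.+1) \sum_(I : k.-tuple 'I_d)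
    F I (cm (wordW I * z)).
  apply/funext => z; rewrite mul1r [LHS]hodge_recover; apply: eq_bigr => k _.
  apply: eq_bigr => I _; rewrite /F; congr (_ * sg (twistV v _)).
  by apply: scalar_vol_cancel; rewrite !top_coefE cm_idem.
have FmL I : linear (fun z => F I (cm (wordW I * z))).
  by move=> c z z'; rewrite (mull_linear _ c) cmL FL.
rewrite lift_funsum => [|k c x x']; last first.
  by rewrite scaler_sumr -big_split; apply: eq_bigr => I _; rewrite (FmL _ c).
rewrite big1 // => k _; rewrite lift_funsum => [|I]; last exact: FmL.
rewrite big1 // => I _.
rewrite (lift_comp (f := F I)) //; last by move=> c z z'; rewrite (mull_linear _ c) cmL.
by rewrite (lift_comp _ cmL (mull_linear _)) lift_mull ZE lift0.
Qed.

End Covariance.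

End Exterior.

(** * The coaction and the action *)

Section Convolution.
Variables (C : numClosedFieldType) (A : algType C) (G : hopf_star A).

Lemma sw_comp (U U' : lmodType C) (f : U -> U') (F : A -> A -> U) a : linear f ->
  f (sw G a F) = sw G a (fun a1 a2 => f (F a1 a2)).
Proof. exact: tlift_comp. Qed.

Lemma eq_sw (U : zmodType) (F F' : A -> A -> U) a :
  (forall a1 a2, F a1 a2 = F' a1 a2) -> sw G a F = sw G a F'.
Proof. exact: eq_tlift. Qed.

Lemma sw_sum (U : zmodType) (Y : Type) (r : seq Y) (P : pred Y)
    (F : Y -> A -> A -> U) a :
  sw G a (fun a1 a2 => \sum_(y <- r | P y) F y a1 a2) =
  \sum_(y <- r | P y) sw G a (F y).
Proof. exact: exchange_big. Qed.

Lemma sw_linear (U : lmodType C) (F : A -> A -> U) :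
  bilinear_map F -> linear (fun a => sw G a F).
Proof.
by move=> hF c a b; rewrite /sw linearP (tlift_linear hF).
Qed.

Lemma sw_epsl (U : lmodType C) (f : A -> U) a : linear f ->
  sw G a (fun a1 a2 => eps G a1 *: f a2) = f a.
Proof.
move=> fL; rewrite -[a in RHS](cop_epsl G) (tlift_comp _ _ fL).
by apply: eq_tlift => a1 a2; rewrite (linZ fL).
Qed.

Lemma sw_epsr (U : lmodType C) (f : A -> U) a : linear f ->
  sw G a (fun a1 a2 => eps G a2 *: f a1) = f a.
Proof.
move=> fL; rewrite -[a in RHS](cop_epsr G) (tlift_comp _ _ fL).
by apply: eq_tlift => a1 a2; rewrite (linZ fL).
Qed.

Lemma sw_coassoc (U : lmodType C) (F : A -> A -> A -> U) a :
  (forall a2 a3, linear (fun a1 => F a1 a2 a3)) ->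
  (forall a1 a3, linear (fun a2 => F a1 a2 a3)) ->
  (forall a1 a2, linear (F a1 a2)) ->
  sw G a (fun b a3 => sw G b (fun a1 a2 => F a1 a2 a3)) =
  sw G a (fun a1 b => sw G b (F a1)).
Proof.
move=> F1 F2 F3.
have bF a1 : bilinear_map (F a1) by split.
have bF12 a3 : bilinear_map (fun a1 a2 => F a1 a2 a3) by split.
pose L a1 t := tlift (F a1) t.
have bL : bilinear_map L.
  split=> [t|a1]; last exact: tlift_linear.
  exact: tlift_param.
have b3 a3 : bilinear_map (fun a1 a2 : A => a1 ⊗ (a2 ⊗ a3)).
  split=> z c x y; first exact: (tens_bilinear _ _).1.
  by rewrite (tens_bilinear _ _).1 (tens_bilinear _ _).2.
have copL : linear (cop G) by move=> c x y; rewrite linearP.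
have idL : linear (@id A) by [].
have bassoc : bilinear_map (fun (uv : tensor A A) (w : A) =>
    tlift (fun u v : A => u ⊗ (v ⊗ w)) uv).
  split=> [w|uv]; first exact: tlift_linear.
  apply: tlift_param => u v c x y.
  by rewrite !(tens_bilinear _ _).2.
have := congr1 (tlift L) (cop_coassoc G a); rewrite /sw.
have -> : tlift L (tassoc (tmap (cop G) id (cop G a))) =
    tlift (fun b a3 => tlift (fun a1 a2 => F a1 a2 a3) (cop G b)) (cop G a).
  rewrite /tmap /tassoc (tlift_comp _ _ (tlift_linear bassoc)).
  rewrite (tlift_comp _ _ (tlift_linear bL)); apply: eq_tlift => b a3.
  rewrite tliftE // (tlift_comp _ _ (tlift_linear bL)); apply: eq_tlift => a1 a2.
  by rewrite tliftE // /L tliftE.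
have -> : tlift L (tmap id (cop G) (cop G a)) =
    tlift (fun a1 b => tlift (F a1) (cop G b)) (cop G a).
  rewrite /tmap (tlift_comp _ _ (tlift_linear bL)); apply: eq_tlift => a1 b.
  by rewrite tliftE.
by [].
Qed.

(* This is the inverse of the antipode.                                       *)
Definition antipV (a : A) : A := hstar G (antip G (hstar G a)).

Lemma hstar_add : {morph hstar G : a b / a + b}.
Proof.
case: (hstarP G) => h _ _ a b; have := h 1 a b.
by rewrite conjC1 !scale1r.
Qed.

Lemma hstarZ c a : hstar G (c *: a) = c^* *: hstar G a.
Proof.
have h0 : hstar G 0 = 0 by apply: (addrI (hstar G 0)); rewrite -hstar_add !addr0.
by case: (hstarP G) => h _ _; have := h c a 0; rewrite h0 !addr0.
Qed.

Lemma hstarM a b : hstar G (a * b) = hstar G b * hstar G a.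
Proof. by case: (hstarP G). Qed.

Lemma hstarK : involutive (hstar G). Proof. by case: (hstarP G). Qed.

Lemma hstar1 : hstar G 1 = 1.
Proof. by rewrite -[LHS]mulr1 -{2}[1]hstarK -hstarM mulr1 hstarK. Qed.

Lemma antipV_linear : linear antipV.
Proof.
move=> c a b; rewrite /antipV hstar_add hstarZ linearP hstar_add hstarZ.
by rewrite conjCK.
Qed.

(** The star of the antipode identity [antipr] at the element [hstar G a]; the star reverses the
    product. *)
Lemma antipVl a : sw G a (fun a1 a2 => antipV a2 * a1) = eps G a *: 1.
Proof.
have bT : bilinear_map (fun a1 a2 => antipV a2 * a1).
  split=> z c x y; first by rewrite mulrDr scalerAr.
  by rewrite antipV_linear mulrDl scalerAl.
have bS : bilinear_map (fun a1 a2 : A => a1 * antip G a2).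
  split=> z c x y; first by rewrite mulrDl scalerAl.
  by rewrite linearP mulrDr scalerAr.
have tstarD : {morph tmap (hstar G) (hstar G) : x y / x + y}.
  apply: tlift_antiD => [z c x y|z c x y]; rewrite hstar_add hstarZ.
    exact: (tens_bilinear _ _).1.
  exact: (tens_bilinear _ _).2.
have tstarE x y : tmap (hstar G) (hstar G) (x ⊗ y) = hstar G x ⊗ hstar G y.
  apply: (@tlift_antiE _ _ _ _ (fun x y => hstar G x ⊗ hstar G y)) => [z c x' y'|z c x' y'];
    rewrite hstar_add hstarZ; [exact: (tens_bilinear _ _).1|exact: (tens_bilinear _ _).2].
have := congr1 (hstar G) (antipr G (hstar G a)).
rewrite hstarZ hstar1 eps_star conjCK => <-; rewrite /sw cop_star.
move: (cop G a); apply: tensor_ext => [x y|x y|x y].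
- exact: (linD (tlift_linear bT)).
- by rewrite tstarD (linD (tlift_linear bS)) hstar_add.
by rewrite tstarE !tliftE // hstarM hstarK.
Qed.

(** * The convolution algebra *)

Variable W : algType C.

Record linear_fun := Conv { cfun : A -> W; cfun_linear : linear cfun }.

(* The algebra Hom(A, W) with the convolution product of the coalgebra [H].   *)
Definition conv_alg (H : hopf_star A) : Type := linear_fun.
Local Notation conv := (conv_alg G).

HB.instance Definition _ := gen_eqMixin conv.
HB.instance Definition _ := gen_choiceMixin conv.

Lemma conv_ext (f h : conv) : (forall a, cfun f a = cfun h a) -> f = h.
Proof.
case: f h => [f fL] [h hL] /= /funext fh; move: fL hL; rewrite fh => fL hL.
by congr Conv; exact: Prop_irrelevance.
Qed.

Lemma conv_zero_linear : linear (fun _ : A => 0 : W).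
Proof. by move=> c x y; rewrite scaler0 addr0. Qed.
Lemma conv_add_linear (f h : conv) : linear (fun a => cfun f a + cfun h a).
Proof.
by move=> c x y; rewrite !(cfun_linear _ c) scalerDr addrACA.
Qed.
Lemma conv_opp_linear (f : conv) : linear (fun a => - cfun f a).
Proof. by move=> c x y; rewrite (cfun_linear _ c) opprD scalerN. Qed.
Lemma conv_one_linear : linear (fun a => eps G a *: 1 : W).
Proof. by move=> c x y; rewrite linearP scalerDl scalerA. Qed.
Lemma conv_mul_bilinear (f h : conv) : bilinear_map (fun a1 a2 => cfun f a1 * cfun h a2).
Proof.
split=> z c x y; first by rewrite (cfun_linear f c) mulrDl scalerAl.
by rewrite (cfun_linear h c) mulrDr scalerAr.
Qed.

Definition conv_zero : conv := Conv conv_zero_linear.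
Definition conv_add (f h : conv) : conv := Conv (conv_add_linear f h).
Definition conv_opp (f : conv) : conv := Conv (conv_opp_linear f).
Definition conv_one : conv := Conv conv_one_linear.
Definition conv_mul (f h : conv) : conv := Conv (sw_linear (conv_mul_bilinear f h)).

Lemma conv_addA : associative conv_add.
Proof. by move=> f h k; apply: conv_ext => a; rewrite /= addrA. Qed.
Lemma conv_addC : commutative conv_add.
Proof. by move=> f h; apply: conv_ext => a; rewrite /= addrC. Qed.
Lemma conv_add0 : left_id conv_zero conv_add.
Proof. by move=> f; apply: conv_ext => a; rewrite /= add0r. Qed.
Lemma conv_addN : left_inverse conv_zero conv_opp conv_add.
Proof. by move=> f; apply: conv_ext => a; rewrite /= addNr. Qed.

HB.instance Definition _ :=
  GRing.isZmodule.Build conv conv_addA conv_addC conv_add0 conv_addN.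

Lemma conv_mulA : associative conv_mul.
Proof.
move=> f h k; apply: conv_ext => a /=.
transitivity (sw G a (fun a1 b => sw G b (fun a2 a3 =>
    cfun f a1 * (cfun h a2 * cfun k a3)))).
  apply: eq_sw => a1 b; rewrite (sw_comp (f := *%R (cfun f a1))) // => c x y.
  by rewrite mulrDr scalerAr.
rewrite -(@sw_coassoc _ (fun a1 a2 a3 => cfun f a1 * (cfun h a2 * cfun k a3))).
- apply: eq_sw => b a3; rewrite (sw_comp (f := fun x => x * cfun k a3)) => [|c x y].
    by apply: eq_sw => a1 a2; rewrite mulrA.
  by rewrite mulrDl scalerAl.
- by move=> a2 a3 c x y; rewrite (cfun_linear f c) mulrDl scalerAl.
- by move=> a1 a3 c x y; rewrite (cfun_linear h c) mulrDl mulrDr -scalerAl -scalerAr.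
- by move=> a1 a2 c x y; rewrite (cfun_linear k c) !mulrDr -!scalerAr.
Qed.

Lemma conv_mul1l : left_id conv_one conv_mul.
Proof.
move=> f; apply: conv_ext => a; rewrite /= -[RHS](sw_epsl _ (cfun_linear f)).
by apply: eq_sw => a1 a2; rewrite mulr_algl.
Qed.

Lemma conv_mul1r : right_id conv_one conv_mul.
Proof.
move=> f; apply: conv_ext => a; rewrite /= -[RHS](sw_epsr _ (cfun_linear f)).
by apply: eq_sw => a1 a2; rewrite mulr_algr.
Qed.

Lemma conv_mulDl : left_distributive conv_mul conv_add.
Proof.
move=> f h k; apply: conv_ext => a; rewrite /= /sw /tlift /tsum -big_split.
by apply: eq_bigr => q _ /=; rewrite mulrDl.
Qed.

Lemma conv_mulDr : right_distributive conv_mul conv_add.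
Proof.
move=> f h k; apply: conv_ext => a; rewrite /= /sw /tlift /tsum -big_split.
by apply: eq_bigr => q _ /=; rewrite mulrDr.
Qed.

HB.instance Definition _ := GRing.Zmodule_isPzRing.Build conv
  conv_mulA conv_mul1l conv_mul1r conv_mulDl conv_mulDr.

Lemma conv_sumE (Y : Type) (r : seq Y) (P : pred Y) (F : Y -> conv) a :
  cfun (\sum_(y <- r | P y) F y) a = \sum_(y <- r | P y) cfun (F y) a.
Proof. by elim/big_ind2: _ => // f x h y <- <-. Qed.

End Convolution.

(** * The general covariance applied to the coaction and the action *)

Section Covariances.
Variables (C : numClosedFieldType) (A : algType C) (G : hopf_star A).
Variables (V : vectType C) (E : coord_space G V) (d : nat).
Variables (theta : d.-tuple V) (theta_basis : basis_of fullv theta).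
Variables (Sig : algType C) (M : quantum_metric E theta Sig).
Variables (W : algType C) (X : exterior M W) (v : volume X).
Hypothesis positive_selfadj : forall q, op_ge0 (real M) q -> sstar M q = q.
Hypothesis asig_pos : asig_positive M.
Variable fr : seq 'I_d -> W.
Local Notation e := (tnth theta).
Local Notation m := (vtop v).
Local Notation sg := (scalarW X).
Local Notation th i := (wordW X [:: i]).
Hypothesis fr_deg : forall I, (size I <= m)%N -> cdeg X (m - size I) (fr I).
Hypothesis frR : forall k y, (k <= m)%N -> cdeg X (m - k) y ->
  y = \sum_(I : k.-tuple 'I_d) fr I * sg (top_coef v (wordW X I * y)).
Hypothesis frL : forall k x, (k <= m)%N -> cdeg X k x ->
  x = \sum_(I : k.-tuple 'I_d) sg (top_coef v (x * fr I)) * wordW X I.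

Lemma comp0_scalar q : wcomp X 0 (sg q) = sg q.
Proof.
have := wcompE X 0 (q *: << [::] >>); rewrite -sgE degree_part_word /= => ->.
by rewrite -sgE.
Qed.

(* Matrix elements of the coaction, kappa(e_i) = \sum_j e_j (x) u_ji.         *)
Definition coact_entry j i : A :=
  tlift (fun x c => coord theta j x *: c) (vcoact E (e i)).

Lemma coord_bilinear (U : lmodType C) j :
  bilinear_map (fun (x : V) (c : U) => coord theta j x *: c).
Proof.
split=> z c x y; first by rewrite linearP scalerDl scalerA.
by rewrite scalerDr !scalerA mulrC.
Qed.

Lemma tensorV_basis (U : lmodType C) (t : tensor V U) :
  t = \sum_j e j ⊗ tlift (fun x c => coord theta j x *: c) t.
Proof.
elim/tensor_ind: t => [|t t' ht ht'|x c].
- rewrite big1 // => j _; rewrite (lin0 (tlift_linear (coord_bilinear U j))).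
  by rewrite (lin0 ((tens_bilinear _ _).2 _)).
- rewrite {1}ht {1}ht' -big_split; apply: eq_bigr => j _.
  rewrite (linD (tlift_linear (coord_bilinear U j))).
  by rewrite (linD ((tens_bilinear _ _).2 _)).
rewrite {1}(basis_expand theta_basis x) tens_suml; apply: eq_bigr => j _.
by rewrite tliftE ?tensZr ?tensZl //; exact: coord_bilinear.
Qed.

Lemma vcoactE i : vcoact E (e i) = \sum_j e j ⊗ coact_entry j i.
Proof. exact: tensorV_basis. Qed.

Lemma coord_tens_inj (U : lmodType C) (c c' : 'I_d -> U) :
  \sum_j e j ⊗ c j = \sum_j e j ⊗ c' j -> c =1 c'.
Proof.
have cE (b : 'I_d -> U) k : tlift (fun x c => coord theta k x *: c) (\sum_j e j ⊗ b j) = b k.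
  have bk := coord_bilinear U k.
  rewrite (lin_sum (tlift_linear bk)) (bigD1 k) //= tliftE //.
  rewrite coord_delta // eqxx scale1r big1 ?addr0 // => j jk.
  by rewrite tliftE // coord_delta // (negPf jk) scale0r.
by move=> h k; rewrite -(cE c k) h cE.
Qed.

Lemma coact_entry_cop j k : cop G (coact_entry j k) =
  \sum_i coact_entry j i ⊗ coact_entry i k.
Proof.
have [/(_ (e k)) h _] := vcoactP E.
have copL : linear (cop G) by move=> c x y; rewrite linearP.
have coL : linear (vcoact E) by move=> c x y; rewrite linearP.
have idV : linear (@id V) by [].
have idA : linear (@id A) by [].
have mL := tmap_linear coL idA; have mR := tmap_linear idV copL.
have bassoc : bilinear_map (fun (uv : tensor V A) (w : A) =>
    tlift (fun (u : V) (v : A) => u ⊗ (v ⊗ w)) uv).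
  have b3 (a3 : A) : bilinear_map (fun (a1 : V) (a2 : A) => a1 ⊗ (a2 ⊗ a3)).
    split=> z c x y; first exact: (tens_bilinear _ _).1.
    by rewrite (tens_bilinear _ _).1 (tens_bilinear _ _).2.
  split=> [w|uv]; first exact: tlift_linear.
  apply: tlift_param => u w c x y.
  by rewrite !(tens_bilinear _ _).2.
move: j; apply: coord_tens_inj; symmetry.
move: h; rewrite [in RHS]vcoactE (lin_sum mR).
under [RHS]eq_bigr => j _ do rewrite tmapE //.
move=> <-; rewrite vcoactE (lin_sum mL).
have aL : linear (@tassoc C V A A) by exact: tlift_linear bassoc.
rewrite (lin_sum aL); under [RHS]eq_bigr => i _.
  rewrite tmapE // vcoactE tens_suml (lin_sum aL).
  under eq_bigr => j _.
    rewrite /tassoc tliftE // tliftE; last first.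
      split=> z c x y; first exact: (tens_bilinear _ _).1.
      by rewrite (tens_bilinear _ _).1 (tens_bilinear _ _).2.
    over.
  over.
rewrite exchange_big; apply: eq_bigr => j _.
by rewrite tens_sumr.
Qed.

Lemma coact_entry_eps j k : eps G (coact_entry j k) = (k == j)%:R.
Proof.
have [_ /(_ (e k))] := vcoactP E.
have be : bilinear_map (fun (x : V) c => eps G c *: x).
  split=> z c x y; first by rewrite scalerDr !scalerA mulrC.
  by rewrite linearP scalerDl scalerA.
rewrite vcoactE (lin_sum (tlift_linear be)).
under eq_bigr => i _ do rewrite tliftE //.
move/(congr1 (coord theta j)); rewrite coord_delta // => <-.
have cL : linear (coord theta j : V -> C^o) by move=> c x y; rewrite linearP.
rewrite [RHS](lin_sum cL) (bigD1 j) //= [X in _ = X + _](linZ cL) coord_delta // eqxx.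
rewrite big1 => [|i ij]; first by rewrite addr0 [RHS]mulr1.
by rewrite [LHS](linZ cL) coord_delta // (negPf ij) scaler0.
Qed.

(** The transpose of u has to be inverted, so the factors stand in the order opposite to the
    coproduct of u_k'k, and the inverse antipode replaces the antipode. *)
Lemma coact_entry_inverse k k' :
  \sum_i antipV G (coact_entry i k) * coact_entry k' i = (k' == k)%:R.
Proof.
have bT : bilinear_map (fun a1 a2 => antipV G a2 * a1).
  split=> z c x y; first by rewrite mulrDr scalerAr.
  by rewrite (antipV_linear G c) mulrDl scalerAl.
have := antipVl G (coact_entry k' k).
rewrite /sw coact_entry_cop (lin_sum (tlift_linear bT)) coact_entry_eps.
under eq_bigr => i _ do rewrite tliftE //.
by move=> ->; rewrite eq_sym scaler_nat.
Qed.

Lemma coact2_inner xk (ck : A) : bilinear_map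
  (fun (yl : V) (cl : A) => (xk ⊗ yl) ⊗ (ck * cl) : tensor (tensor V V) A).
Proof.
split=> z c x y; first by rewrite (tens_bilinear _ _).2 (tens_bilinear _ _).1.
by rewrite mulrDr -scalerAr (tens_bilinear _ _).2.
Qed.

Lemma coact2_middle t : bilinear_map (fun (xk : V) (ck : A) =>
  tlift (fun (yl : V) (cl : A) => (xk ⊗ yl) ⊗ (ck * cl)) t).
Proof.
split=> z; apply: tlift_param => y cl c x x'.
  by rewrite !(tens_bilinear _ _).1.
by rewrite mulrDl -scalerAl (tens_bilinear _ _).2.
Qed.

Lemma coact2_outer : bilinear_map (fun x y =>
  tlift (fun xk ck =>
    tlift (fun yl cl => (xk ⊗ yl) ⊗ (ck * cl)) (vcoact E y)) (vcoact E x)).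
Proof.
split=> z c x y; first by rewrite linearP (tlift_linear (coact2_middle _)).
move: c x y; apply: tlift_param => xk ck c x y.
by rewrite linearP (tlift_linear (coact2_inner _ _)).
Qed.

Lemma coact2_linear : linear (coact2 E).
Proof. exact: tlift_linear coact2_outer. Qed.

Lemma coact2_basis i j : coact2 E (e i ⊗ e j) =
  \sum_k \sum_l (e k ⊗ e l) ⊗ (coact_entry k i * coact_entry l j).
Proof.
rewrite [LHS](tliftE _ _ coact2_outer) (vcoactE i).
rewrite (lin_sum (tlift_linear (coact2_middle _))); apply: eq_bigr => k _.
rewrite (tliftE _ _ (coact2_middle _)) (vcoactE j).
rewrite (lin_sum (tlift_linear (coact2_inner _ _))); apply: eq_bigr => l _.
exact: (tliftE _ _ (coact2_inner _ _)).
Qed.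

Lemma braidV_coact t : coact2 E (braidV M t) = tmap (braidV M) id (coact2 E t).
Proof.
have idA : linear (@id A) by [].
have bL : linear (braid M) by move=> c x y; rewrite linearP.
have bVL : linear (braidV M) by move=> c x y; rewrite linearP.
rewrite -{2}(braidVK M t) braid_coact; move: (coact2 E _).
apply: tensor_ext => [//|x y|x c].
  by rewrite (linD (tmap_linear bL idA)) (linD (tmap_linear bVL idA)).
by rewrite !tmapE // braidK.
Qed.

Lemma coact_braid (f : {linear tensor V V -> tensor V V}) i j a b :
  (forall t, coact2 E (f t) = tmap f id (coact2 E t)) ->
  \sum_k \sum_l entry theta f i j k l *: (coact_entry a k * coact_entry b l) =
  \sum_k \sum_l entry theta f k l a b *: (coact_entry k i * coact_entry l j).
Proof.
move=> fco; have idA : linear (@id A) by [].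
have fL : linear f by move=> c x y; rewrite linearP.
pose bc x y := coord theta a x * coord theta b y : C^o.
have bbc : bilinear_map bc.
  split=> z c x y; rewrite /bc linearP; first by rewrite mulrDl scalerAl.
  by rewrite mulrDr scalerAr.
pose F (t : tensor V V) (c : A) : A := tlift bc t *: c.
have bF : bilinear_map F.
  split=> z c x y; rewrite /F; first by rewrite (tlift_linear bbc) scalerDl scalerA.
  by rewrite scalerDr !scalerA mulrC.
have FE (h : 'I_d -> 'I_d -> A) :
    tlift F (\sum_k \sum_l (e k ⊗ e l) ⊗ h k l) = h a b.
  rewrite (lin_sum (tlift_linear bF)) (bigD1 a) //= [X in _ + X]big1 => [|k ka].
    rewrite addr0 (lin_sum (tlift_linear bF)) (bigD1 b) //= [X in _ + X]big1 => [|l lb].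
      by rewrite addr0 tliftE // /F tliftE // /bc !coord_delta // !eqxx mulr1 scale1r.
    by rewrite tliftE // /F tliftE // /bc !coord_delta // (negPf lb) mulr0 scale0r.
  rewrite (lin_sum (tlift_linear bF)) big1 // => l _.
  by rewrite tliftE // /F tliftE // /bc !coord_delta // (negPf ka) mul0r scale0r.
have coL := coact2_linear.
have := congr1 (tlift F) (fco (e i ⊗ e j)).
rewrite {1}(tensor_basis theta_basis (f (e i ⊗ e j))) (lin_sum coL).
rewrite (lin_sum (tlift_linear bF)).
under eq_bigr => k _.
  rewrite (lin_sum coL) (lin_sum (tlift_linear bF)).
  under eq_bigr => l _ do rewrite (linZ coL) (linZ (tlift_linear bF)) coact2_basis FE.
  over.
move=> ->; rewrite coact2_basis (lin_sum (tmap_linear fL idA)).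
rewrite (lin_sum (tlift_linear bF)); apply: eq_bigr => k _.
rewrite (lin_sum (tmap_linear fL idA)) (lin_sum (tlift_linear bF)); apply: eq_bigr => l _.
by rewrite tmapE // tliftE.
Qed.

Lemma tens1_mull (x : W) (t : tensor_alg W A) : (x ⊗ 1 : tensor_alg W A) * t =
  tmap (fun z => x * z) id t.
Proof.
have xL : linear (fun z : W => x * z) by move=> c y z; rewrite mulrDr scalerAr.
have idA : linear (@id A) by [].
move: t; apply: tensor_ext => [s t|s t|y c].
- exact: mulrDr.
- by rewrite (linD (tmap_linear xL idA)).
by rewrite tmapE // [LHS]tmulE mul1r.
Qed.

Lemma tens1_mulr (x : W) (t : tensor_alg W A) : t * (x ⊗ 1 : tensor_alg W A) =
  tmap (fun z => z * x) id t.
Proof.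
have xL : linear (fun z : W => z * x) by move=> c y z; rewrite mulrDl scalerAl.
have idA : linear (@id A) by [].
move: t; apply: tensor_ext => [s t|s t|y c].
- exact: mulrDl.
- by rewrite (linD (tmap_linear xL idA)).
by rewrite tmapE // [LHS]tmulE mulr1.
Qed.

Lemma hodge_coact y :
  wcoact X (hodge v fr y) = tmap (hodge v fr) id (wcoact X y).
Proof.
have idA : linear (@id A) by [].
pose iota (x : W) : tensor_alg W A := x ⊗ 1.
pose emb (c : A) : tensor_alg W A := 1 ⊗ c.
have iotaL : linear (fun x : W => x ⊗ (1 : A)) by exact: (tens_bilinear _ _).1.
have embL : linear (fun c : A => (1 : W) ⊗ c) by exact: (tens_bilinear _ _).2.
have embM a b : emb (a * b) = emb a * emb b by rewrite [RHS]tmulE mul1r.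
have iota_emb x c : iota x * emb c = x ⊗ c by rewrite [LHS]tmulE mulr1 mul1r.
have tE (x z : W) (c c' : A) : (x ⊗ c : tensor_alg W A) * (z ⊗ c') = (x * z) ⊗ (c * c').
  exact: tmulE.
have embL' : linear emb := embL.
have braidE (f : {linear tensor V V -> tensor V V}) i j a b :
    (forall t, coact2 E (f t) = tmap f id (coact2 E t)) ->
    \sum_k \sum_l iota (entry theta f i j k l)%:A *
      (emb (coact_entry a k) * emb (coact_entry b l)) =
    \sum_k \sum_l iota (entry theta f k l a b)%:A *
      (emb (coact_entry k i) * emb (coact_entry l j)).
  move=> fco; have termE (c : C) z z' : iota c%:A * (emb z * emb z') = emb (c *: (z * z')).
    by rewrite -embM iota_emb /emb tensZl tensZr.
  under eq_bigr => k _ do under eq_bigr => l _ do rewrite termE.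
  under [RHS]eq_bigr => k _ do under eq_bigr => l _ do rewrite termE.
  under eq_bigr => k _ do rewrite -(lin_sum embL').
  under [RHS]eq_bigr => k _ do rewrite -(lin_sum embL').
  by rewrite -!(lin_sum embL') (coact_braid i j a b fco).
(* The volume element is coinvariant, so the factor [lamB] is 1 here. *)
rewrite -[RHS](@mulr1 (tensor_alg W A)).
apply: (@hodge_covariant _ _ _ _ _ _ _ theta_basis _ _ _ X positive_selfadj asig_pos v fr
  fr_deg frR frL (tensor_alg W A) iota (fun f => tmap f id)
  (fun b => exists c, b = emb c) (wcoact X : W -> tensor_alg W A)
  (fun j i => emb (coact_entry j i)) (fun i k => emb (antipV G (coact_entry i k))) 1).
- exact: (linD iotaL).
- by move=> x z; rewrite /iota tE mulr1.
- by [].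
- by exists 1.
- by move=> _ _ [a ->] [b ->]; exists (a * b); rewrite embM.
- by move=> _ x [c ->]; rewrite iota_emb tE mul1r mulr1.
- by move=> f fL; exact: (linD (tmap_linear fL idA)).
- move=> f h b fL hL; have fhL : linear (fun z => f (h z)).
    by move=> c x z; rewrite hL fL.
  move: b; apply: tensor_ext => [s t|s t|x c].
  + by rewrite (linD (tmap_linear fhL idA)).
  + by rewrite (linD (tmap_linear hL idA)) (linD (tmap_linear fL idA)).
  by rewrite !tmapE.
- by move=> x b; rewrite tens1_mull.
- by move=> x b; rewrite tens1_mulr.
- move=> f _ b fL [c ->]; split; move: b; apply: tensor_ext => [s t|s t|x c'].
  + by rewrite [X in tmap _ _ X]mulrDr (linD (tmap_linear fL idA)).
  + by rewrite (linD (tmap_linear fL idA)) [LHS]mulrDr.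
  + by rewrite tE mul1r !tmapE // tE mul1r.
  + by rewrite [X in tmap _ _ X]mulrDl (linD (tmap_linear fL idA)).
  + by rewrite (linD (tmap_linear fL idA)) [LHS]mulrDl.
  + by rewrite tE mulr1 !tmapE // tE mulr1.
- have zL : linear ((fun=> 0) : W -> W) by move=> c x z; rewrite scaler0 addr0.
  apply: tensor_ext => [s t|s t|x c].
  + by rewrite (linD (tmap_linear zL idA)).
  + by rewrite addr0.
  rewrite tmapE //; exact: (lin0 ((tens_bilinear _ _).1 _)).
- move=> f h b fL hL; have fhL : linear (fun z => f z + h z).
    by move=> c x z; rewrite hL fL scalerDr addrACA.
  move: b; apply: tensor_ext => [s t|s t|x c].
  + by rewrite (linD (tmap_linear fhL idA)).
  + by rewrite (linD (tmap_linear hL idA)) (linD (tmap_linear fL idA)) addrACA.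
  by rewrite !tmapE // (linD ((tens_bilinear _ _).1 _)).
- by move=> x z; rewrite linearD.
- by move=> x z; rewrite wcoactM.
- have sgL := sg_linear X.
  have sgE q : wcoact X (sg q) = tmap (fun q => sg q) id (scoact M q).
    rewrite scalarWE wcoact_scalar; apply: eq_tlift => q' c.
    by rewrite scalarWE.
  have -> : wcoact X 1 = wcoact X (sg 1) by rewrite sg1.
  by rewrite sgE scoact1 tmapE // sg1.
- have sgL := sg_linear X; have c0L := comp_linear X 0.
  move=> q; rewrite scalarWE wcoact_scalar; move: (scoact M q).
  have sL : linear (fun q => of_sigma X q).
    by move=> c q1 q2; rewrite -!scalarWE sg_linear.
  apply: tensor_ext => [s t|s t|q' c].
  + by rewrite (linD (tmap_linear sL idA)) (linD (tmap_linear c0L idA)).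
  + by rewrite (linD (tmap_linear sL idA)).
  by rewrite !tmapE // -[pr X _]/(of_sigma X q') -scalarWE comp0_scalar.
- by move=> i j; exists (coact_entry i j).
- move=> i; rewrite -(vecW_basis theta_basis X) /vecW unlock wcoact_vec vcoactE.
  have vL : linear (fun x => pr X (of_vec theta Sig x)).
    by move=> c x z; have := vecW_linear X c x z; rewrite /vecW unlock.
  rewrite (lin_sum (tmap_linear vL idA)); apply: eq_bigr => j _.
  rewrite tmapE // iota_emb; congr (_ ⊗ _).
  by rewrite -(vecW_basis theta_basis X) /vecW unlock.
- move=> i j; rewrite scalarWE wcoact_scalar scoact_met coact2_basis.
  have sL : linear (fun q => of_sigma X q).
    by move=> c q1 q2; rewrite -!scalarWE sg_linear.
  have metL : linear (met M) by move=> c x z; rewrite linearP.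
  rewrite (lin_sum (tmap_linear metL idA)) (lin_sum (tmap_linear sL idA)).
  apply: eq_bigr => k _.
  rewrite (lin_sum (tmap_linear metL idA)) (lin_sum (tmap_linear sL idA)).
  apply: eq_bigr => l _.
  by rewrite !tmapE // -embM iota_emb scalarWE.
- move=> c; have sgL := sg_linear X; have wL : linear (wcoact X) by move=> ? ? ?; rewrite linearP.
  rewrite (linZ wL) [RHS](linZ iotaL); congr (_ *: _).
  have sL : linear (fun q => of_sigma X q).
    by move=> c' q1 q2; rewrite -!scalarWE sg_linear.
  have -> : wcoact X 1 = wcoact X (sg 1) by rewrite sg1.
  by rewrite scalarWE wcoact_scalar scoact1 tmapE // -[pr X _]/(of_sigma X 1) -scalarWE sg1.
- by move=> i j a b; apply: braidE => t; exact: braid_coact.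
- by move=> i j a b; apply: braidE => t; exact: braidV_coact.
- move=> k k'; under eq_bigr => i _ do rewrite -embM.
  rewrite -(lin_sum embL') coact_entry_inverse; case: eqP => _ //.
  exact: (lin0 embL').
- by rewrite mulr1 vol_coact.
- by exists 1.
Qed.

(* Matrix elements of the action, e_i o a = \sum_j act_entry j i a e_j.       *)
Definition act_entry j i (a : A) : C := coord theta j (vact E (e i) a).

Lemma vact_linearr x : linear (vact E x).
Proof. by case: (vactP E) => [[_ h] _ _]; exact: h. Qed.

Lemma vact_linearl a : linear (fun x => vact E x a).
Proof. by case: (vactP E) => [[h _] _ _]; exact: h. Qed.

Lemma act_entry_linear j i : linear (act_entry j i : A -> C^o).
Proof. by move=> c a b; rewrite /act_entry (vact_linearr _ c) linearP. Qed.

Lemma vactE i a : vact E (e i) a = \sum_j act_entry j i a *: e j.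
Proof. exact: basis_expand. Qed.

Lemma act_entry_mul j i a b :
  act_entry j i (a * b) = \sum_k act_entry k i a * act_entry j k b.
Proof.
have [_ _ h] := vactP E; rewrite /act_entry -h {1}vactE (lin_sum (vact_linearl b)).
have cL : linear (coord theta j : V -> C^o) by move=> c x y; rewrite linearP.
rewrite [LHS](lin_sum cL); apply: eq_bigr => k _.
rewrite (linZ (vact_linearl b)) [LHS](linZ cL).
reflexivity.
Qed.

Lemma act2_outer a : bilinear_map (fun x y =>
  sw G a (fun a1 a2 => vact E x a1 ⊗ vact E y a2)).
Proof.
split=> z; apply: tlift_param => a1 a2 c x y.
  by rewrite (vact_linearl _ c) (tens_bilinear _ _).1.
by rewrite (vact_linearl _ c) (tens_bilinear _ _).2.
Qed.

Lemma act2_linear a : linear (fun t => act2 E t a).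
Proof. exact: tlift_linear (act2_outer a). Qed.

Lemma act2_basis i j a : act2 E (e i ⊗ e j) a = \sum_k \sum_l
  sw G a (fun a1 a2 => act_entry k i a1 * act_entry l j a2 : C^o) *: (e k ⊗ e l).
Proof.
rewrite [LHS](tliftE _ _ (act2_outer a)).
transitivity (sw G a (fun a1 a2 => \sum_k \sum_l
    (act_entry k i a1 * act_entry l j a2) *: (e k ⊗ e l))).
  apply: eq_sw => a1 a2; rewrite !vactE tens_suml; apply: eq_bigr => k _.
  by rewrite tens_sumr; apply: eq_bigr => l _; rewrite tensZl tensZr scalerA.
rewrite sw_sum; apply: eq_bigr => k _; rewrite sw_sum; apply: eq_bigr => l _.
symmetry; apply: (sw_comp G (f := fun c : C^o => c *: (e k ⊗ e l))) => c x y.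
by rewrite scalerDl scalerA.
Qed.

Lemma braidV_act t a : braidV M (act2 E t a) = act2 E (braidV M t) a.
Proof. by rewrite -{1}(braidVK M t) -braid_act braidK. Qed.

Lemma act_braid (f : {linear tensor V V -> tensor V V}) i j k l a :
  (forall t a, f (act2 E t a) = act2 E (f t) a) ->
  \sum_p \sum_q entry theta f i j p q *:
    sw G a (fun a1 a2 => act_entry k p a1 * act_entry l q a2 : C^o) =
  \sum_p \sum_q entry theta f p q k l *:
    sw G a (fun a1 a2 => act_entry p i a1 * act_entry q j a2 : C^o).
Proof.
move=> fact.
pose bc x y := coord theta k x * coord theta l y : C^o.
have bbc : bilinear_map bc.
  split=> z c x y; rewrite /bc linearP; first by rewrite mulrDl scalerAl.
  by rewrite mulrDr scalerAr.
have bL := tlift_linear bbc.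
have bE (h : 'I_d -> 'I_d -> C) :
    tlift bc (\sum_p \sum_q h p q *: (e p ⊗ e q)) = h k l.
  rewrite (lin_sum bL) (bigD1 k) //= [X in _ + X]big1 => [|p pk].
    rewrite addr0 (lin_sum bL) (bigD1 l) //= [X in _ + X]big1 => [|q ql].
      by rewrite addr0 (linZ bL) tliftE // /bc !coord_delta // !eqxx mulr1 [LHS]mulr1.
    by rewrite (linZ bL) tliftE // /bc !coord_delta // (negPf ql) mulr0 scaler0.
  rewrite (lin_sum bL) big1 // => q _.
  by rewrite (linZ bL) tliftE // /bc !coord_delta // (negPf pk) mul0r scaler0.
have aL := act2_linear a; have fL : linear f by move=> c x y; rewrite linearP.
have := congr1 (tlift bc) (fact (e i ⊗ e j) a).
rewrite [X in _ = tlift bc (act2 E X a)](tensor_basis theta_basis) (lin_sum aL) (lin_sum bL).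
under [RHS]eq_bigr => p _.
  rewrite (lin_sum aL) (lin_sum bL).
  under eq_bigr => q _ do rewrite (linZ aL) (linZ bL) act2_basis bE.
  over.
move=> <-; rewrite act2_basis (lin_sum fL) (lin_sum bL); apply: eq_bigr => p _.
rewrite (lin_sum fL) (lin_sum bL); apply: eq_bigr => q _.
by rewrite (linZ fL) (linZ bL) [LHS]mulrC.
Qed.

(** In the convolution algebra [iota x] is eps times x and the coefficients are functionals times 1.
    The factor [lamB] is lambda, because w spans a one-dimensional module. The matrix [u'] uses the
    antipode itself, since the action on V is multiplicative. *)
Lemma hodge_act y a :
  wact X (hodge v fr y) a = hodge v fr (wact X y (twist_arg v a)).
Proof.
have wL x : linear (wact X x) by case: (wact_bilinear X).
have wLl b : linear (fun x => wact X x b) by case: (wact_bilinear X) => h _; exact: h.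
have epsL (x : W) : linear (fun b => eps G b *: x).
  by move=> c b b'; rewrite linearP scalerDl scalerA.
pose iota (x : W) : conv_alg W G := Conv (epsL x).
have embP (f : A -> C) : linear (f : A -> C^o) -> linear (fun b => f b *: (1 : W)).
  by move=> fL c b b'; rewrite fL scalerDl -scalerA.
pose emb f (fL : linear (f : A -> C^o)) : conv_alg W G := Conv (embP f fL).
pose Phi (x : W) : conv_alg W G := Conv (wL x).
have liftP (f : W -> W) (b : conv_alg W G) : linear f -> linear (fun x => f (cfun b x)).
  by move=> fL c x z; rewrite (cfun_linear b c) fL.
(* Composition with a nonlinear f would leave Hom(A, W); the value 0 is a default for that case. *)
pose lift (f : W -> W) (b : conv_alg W G) : conv_alg W G :=
  if pselect (linear f) is left fL then Conv (liftP f b fL) else 0.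
have liftE f b x : linear f -> cfun (lift f b) x = f (cfun b x).
  by move=> fL; rewrite /lift; case: pselect.
pose D (b : conv_alg W G) := exists f : A -> C,
  linear (f : A -> C^o) /\ forall x, cfun b x = f x *: 1.
have mE (b b' : conv_alg W G) x :
  cfun (b * b') x = sw G x (fun a1 a2 => cfun b a1 * cfun b' a2) by [].
have iota_l x b a0 : cfun (iota x * b) a0 = x * cfun b a0.
  rewrite mE /= -(sw_epsl G a0 (f := fun z => x * cfun b z)) => [|c z z'].
    by apply: eq_sw => a1 a2; rewrite scalerAl.
  by rewrite (cfun_linear b c) mulrDr scalerAr.
have iota_r x b a0 : cfun (b * iota x) a0 = cfun b a0 * x.
  rewrite mE /= -(sw_epsr G a0 (f := fun z => cfun b z * x)) => [|c z z'].
    by apply: eq_sw => a1 a2; rewrite scalerAr.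
  by rewrite (cfun_linear b c) mulrDl scalerAl.
have lamL : linear (lam v : A -> C^o) by move=> c z z'; rewrite linearP.
have uL i k : linear (fun b => act_entry i k (antip G b) : C^o).
  by move=> c b b'; rewrite linearP (act_entry_linear i k c).
have emb_lr f fL x a0 : cfun (iota x * emb f fL) a0 = f a0 *: x.
  by rewrite iota_l /= mulr_algr.
have embE f fL f' fL' a0 : cfun (emb f fL * emb f' fL') a0 =
    sw G a0 (fun a1 a2 => f a1 * f' a2 : C^o) *: 1.
  rewrite mE (sw_comp G (f := fun c : C^o => c *: (1 : W))) => [|c x z].
    by apply: eq_sw => a1 a2; rewrite /= -scalerAl mul1r scalerA.
  by rewrite scalerDl -scalerA.
have sumE n (F : 'I_n -> conv_alg W G) a0 : cfun (\sum_i F i) a0 = \sum_i cfun (F i) a0.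
  exact: conv_sumE.
have DE b : D b -> exists f fL, b = emb f fL.
  case=> f [fL bE]; exists f, fL; apply: conv_ext => a0; exact: bE.
have embD f fL : D (emb f fL) by exists f.
have Phi_sgE q a0 : wact X (sg q) a0 = sg (sact M q a0).
  by rewrite !scalarWE wact_scalar.
have wact1 a0 : wact X 1 a0 = eps G a0 *: 1.
  by rewrite -(sg1 X) Phi_sgE sact1 (linZ (sg_linear X)).
have vec_act x a0 : wact X (vecW X x) a0 = vecW X (vact E x a0).
  by rewrite /vecW unlock wact_vec.
have braidE (f : {linear tensor V V -> tensor V V}) :
    (forall t b, f (act2 E t b) = act2 E (f t) b) ->
    commutes_braiding theta iota (fun j i => emb _ (act_entry_linear j i)) f.
  move=> fact i j k l; apply: conv_ext => a0; rewrite !sumE.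
  transitivity ((\sum_p \sum_q entry theta f i j p q *:
    sw G a0 (fun a1 a2 => act_entry k p a1 * act_entry l q a2 : C^o)) *: (1 : W)).
    rewrite scaler_suml; apply: eq_bigr => p _; rewrite sumE scaler_suml.
    apply: eq_bigr => q _.
    by rewrite iota_l embE mulr_algl scalerA.
  rewrite (act_braid _ _ _ _ _ fact) scaler_suml; apply: eq_bigr => p _.
  rewrite sumE scaler_suml; apply: eq_bigr => q _.
  by rewrite iota_l embE mulr_algl scalerA.
have h : Phi (hodge v fr y) = lift (hodge v fr) (Phi y) * emb _ lamL.
  apply: (@hodge_covariant _ _ _ _ _ _ _ theta_basis _ _ _ X positive_selfadj asig_pos v fr
    fr_deg frR frL (conv_alg W G) iota lift D Phi
    (fun j i => emb _ (act_entry_linear j i))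
    (fun i k => emb _ (uL i k))).
  - by move=> x z; apply: conv_ext => a0; rewrite /= scalerDr.
  - by move=> x z; apply: conv_ext => a0; rewrite iota_l /= scalerAr.
  - exact: conv_ext.
  - by exists (eps G); split=> // c z z'; rewrite linearP.
  - move=> b b' /DE[f [fL ->]] /DE[f' [fL' ->]].
    exists (fun x => sw G x (fun a1 a2 => f a1 * f' a2 : C^o)).
    split=> [|x]; last exact: embE.
    apply: sw_linear; split=> z c x x'; first by rewrite fL mulrDl scalerAl.
    by rewrite fL' mulrDr scalerAr.
  - move=> b x /DE[f [fL ->]]; apply: conv_ext => a0.
    by rewrite iota_r iota_l /= mulr_algl mulr_algr.
  - move=> f fL b b'; apply: conv_ext => a0.
    by rewrite liftE //= !liftE // (linD fL).
  - move=> f f' b fL fL'; have ffL : linear (fun z => f (f' z)).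
      by move=> c z z'; rewrite fL' fL.
    by apply: conv_ext => a0; rewrite !liftE.
  - move=> x b; apply: conv_ext => a0; rewrite iota_l liftE // => c z z'.
    by rewrite mulrDr scalerAr.
  - move=> x b; apply: conv_ext => a0; rewrite iota_r liftE // => c z z'.
    by rewrite mulrDl scalerAl.
  - move=> f b b' fL /DE[f' [fL' ->]]; split; apply: conv_ext => a0; rewrite liftE //.
      rewrite !mE (sw_comp _ _ _ fL); apply: eq_sw => a1 a2.
      by rewrite liftE //= !mulr_algl (linZ fL).
    rewrite !mE (sw_comp _ _ _ fL); apply: eq_sw => a1 a2.
    by rewrite liftE //= !mulr_algr (linZ fL).
  - by move=> b; apply: conv_ext => a0; rewrite liftE // => c z z'; rewrite scaler0 addr0.
  - move=> f f' b fL fL'; apply: conv_ext => a0; rewrite /= !liftE // => c z z'.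
    by rewrite fL fL' scalerDr addrACA.
  - by move=> x z; apply: conv_ext => a0; rewrite /= (linD (wLl a0)).
  - by move=> x z; apply: conv_ext => a0; rewrite /= wactM.
  - by apply: conv_ext => a0; rewrite /= wact1.
  - move=> q; apply: conv_ext => a0; rewrite liftE /= ?Phi_sgE ?comp0_scalar //.
    exact: comp_linear.
  - by move=> i j; exact: embD.
  - move=> i; apply: conv_ext => a0; rewrite sumE [LHS]/= -(vecW_basis theta_basis X).
    rewrite vec_act vactE (lin_sum (vecW_linear X)); apply: eq_bigr => j _.
    by rewrite emb_lr (linZ (vecW_linear X)) vecW_basis.
  - move=> i j; apply: conv_ext => a0; rewrite sumE [LHS]/= Phi_sgE sact_met.
    have metL : linear (met M) by move=> c x z; rewrite linearP.
    rewrite -(sw_comp G _ _ metL) -[sw _ _ _](tliftE _ _ (act2_outer a0)) -/(act2 E _ _).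
    rewrite act2_basis (lin_sum metL) (lin_sum (sg_linear X)); apply: eq_bigr => k _.
    rewrite sumE (lin_sum metL) (lin_sum (sg_linear X)); apply: eq_bigr => l _.
    by rewrite iota_l embE mulr_algr (linZ metL) (linZ (sg_linear X)).
  - move=> c; apply: conv_ext => a0; rewrite /= (linZ (wLl a0)) wact1.
    by rewrite !scalerA mulrC.
  - exact: braidE (braid_act M).
  - exact: braidE braidV_act.
  - move=> k k'; apply: conv_ext => a0; rewrite sumE.
    have aL := act_entry_linear k' k.
    transitivity (act_entry k' k (eps G a0 *: 1) *: (1 : W)).
      rewrite -antipl -/(sw G a0 _) [in RHS](sw_comp G _ _ aL).
      under eq_bigr => i _ do rewrite embE.
      rewrite -scaler_suml; congr (_ *: _); rewrite -sw_sum.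
      by apply: eq_sw => a1 a2; rewrite act_entry_mul.
    have [_ act1 _] := vactP E.
    rewrite [act_entry _ _ _](linZ aL) /act_entry act1 coord_delta // eq_sym.
    case: eqP => _; first by congr (_ *: _); exact: mulr1.
    by rewrite -[RHS](scale0r 1); congr (_ *: _); exact: mulr0.
  - by apply: conv_ext => a0; rewrite emb_lr /= vol_act.
  - exact: embD.
(* At a, convolution with lambda on the right gives the Sweedler sum of lambda(a2) star(y o a1),
   which is the star of y o a_lambda. *)
have := congr1 (fun b : conv_alg W G => cfun b a) h; rewrite /= => ->.
have hL := hodge_linear v fr.
rewrite /twist_arg (sw_comp G _ _ (wL y)) (sw_comp G _ _ hL).
apply: eq_sw => a1 a2; rewrite liftE //= mulr_algr.
by rewrite (linZ (wL y)) (linZ hL).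
Qed.

End Covariances.


Theorem proposition2p8 (R : realType) (A : algType R[i]) (G : hopf_star A)
  (hG : compact_matrix_qgroup G)
  (V : vectType R[i]) (E : coord_space G V)
  (d : nat) (theta : d.-tuple V) (htheta : basis_of fullv theta)
  (Sig : algType R[i]) (M : quantum_metric E theta Sig)
  (hpos : asig_positive M) (him : asig_image M)
  (W : algType R[i]) (X : exterior M W) (v : volume X) :
  exists star : {linear W -> W},
    [/\ forall x y : W, wmet X x y = jpair v x (star y),
        forall f : W -> W,
          (forall x y : W, wmet X x y = jpair v x (f y)) -> f =1 star,
        forall (k : nat) (x : W), wdeg X k x ->
          if (k <= vtop v)%N then wdeg X (vtop v - k) (star x) else star x = 0
      & [/\ bijective star,
            forall (x : W) (q : Sig),
              star (x * of_sigma X q) = star x * of_sigma X (twistV v q),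
            forall (q : Sig) (x : W),
              star (of_sigma X q * x) = of_sigma X q * star x,
            forall x : W, wcoact X (star x) = tmap star id (wcoact X x)
          & forall (x : W) (a : A),
              star (wact X x (twist_arg v a)) = wact X (star x) a]].
Proof.
have sa (q : Sig) := @positive_selfadjoint R Sig (sstar M) (real M) q.
have [fr [fr_deg frR frL]] := exists_frame v.
pose H := lin_fun (hodge_linear v fr).
have HP x y : wmet X x y = jpair v x (H y).
  by rewrite jpair_top hodgeP.
exists H; split=> [//|f fP y|k x|].
- apply: (hodge_unique htheta frR) => x.
  by rewrite -!jpair_top -fP HP.
- exact: hodge_degree.
split=> [|x q|q x|x|x a].
- exact: (hodge_bijective htheta sa hpos fr_deg frR frL).
- rewrite -!scalarWE; exact: (hodge_scalarr htheta sa hpos fr_deg frR frL).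
- rewrite -!scalarWE; exact: (hodge_scalarl htheta fr_deg frR frL).
- exact: (hodge_coact htheta sa hpos fr_deg frR frL).
- exact/esym/(hodge_act htheta sa hpos fr_deg frR frL).
Qed.
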